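(* Let $\mathcal G=(V,E,W)$ be a finite connected weighted graph, let $U\subset V$ be non-empty and indistinguishable from outside, and let $i_0\in V\setminus U$. Let $\beta\sim\nu^W$, $G=H_\beta^{-1}$, and define $$e^{u_k}=\frac{G(k,i_0)}{G(i_0,i_0)}\quad(k\in V),\qquad \gamma=\frac{1}{2G(i_0,i_0)}.$$ Let $V'=(V\setminus U)\cup\{u\}$, let $G'$ and $\beta'$ be the coarse-graining of $G$ and $\beta$, and put $e^{u'_k}=\frac{G'(k,i_0)}{G'(i_0,i_0)}$ for $k\in V'$. Let $\mathcal F'$ be the $\sigma$-algebra generated by $(\beta'_k)_{k\in V'\setminus\{i_0\}}$ and $\gamma$. Then $$\forall k\in V\setminus U,\quad \mathbb E\left[e^{u_k}\,|\,\mathcal F'\right]=e^{u'_k},\qquad\text{and}\qquad \forall k\in U,\quad \mathbb E\left[e^{u_k}\,|\,\mathcal F'\right]=e^{u'_u},$$ where $e^{u'_u}$ denotes the value of $e^{u'_k}$ at the reduced vertex $k=u$.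
   Context: A finite weighted graph $\mathcal G=(V,E,W)$ is a simple, unoriented, finite connected graph with edge weights $W_{ij}=W_{ji}>0$ for $\{i,j\}\in E$, and $W_{ij}=0$ if $\{i,j\}$ is not an edge; $W_{ii}=0$. For $\beta\in\mathbb R^V$, $H_\beta$ is the symmetric matrix indexed by $V$ with $H_\beta(i,i)=2\beta_i$ and $H_\beta(i,j)=-W_{ij}$ for $i\ne j$. The law of the random potential of the $H^{2|2}$-model on $\mathcal G$ is the probability measure on $\mathbb R^V$ $$\nu^{W}(d\beta)=\Big(\sqrt{\tfrac{2}{\pi}}\Big)^{|V|}\mathbf 1_{\{H_\beta>0\}}\,e^{-\frac12\langle 1,H_\beta 1\rangle}\frac{1}{\sqrt{\det H_\beta}}\prod_{i\in V}d\beta_i,$$ where $H_\beta>0$ means positive definite and $1$ is the all-ones vector. It is known that $\gamma=1/(2G(i_0,i_0))$ is Gamma$(\frac12)$-distributed and independent of $(\beta_k)_{k\ne i_0}$ restricted to the information carried by $(u_k)_{k\in V}$. A subset $U\subset V$ is indistinguishable from outside if $W_{ki}=W_{kj}$ for all $i,j\in U$ and $k\notin U$. Coarse-graining: with $u$ a new vertex, $G'$ is the symmetric matrix indexed by $V'$ with $G'(k,\ell)=G(k,\ell)$ for $k,\ell\in V\setminus U$, $G'(k,u)=\frac1{|U|}\sum_{i\in U}G(k,i)$ for $k\in V\setminus U$, and $G'(u,u)=\frac1{|U|^2}\sum_{i,j\in U}G(i,j)$. The coarse-grained potential is $\beta'_k=\beta_k$ for $k\in V\setminus U$ and $\frac1{2\beta'_u}=\frac1{|U|^2}\sum_{i,j\in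 U}(H_{U,U})^{-1}(i,j)$, where $H_{U,U}$ is the submatrix of $H_\beta$ indexed by $U$; $(G')^{-1}$ has diagonal entries $2\beta'_k$. *)

(* Defs.v *)
From HB Require Import structures.
From mathcomp Require Import all_boot all_order all_algebra.
From mathcomp Require Import all_classical all_reals all_analysis.

Set Implicit Arguments.
Unset Strict Implicit.
Unset Printing Implicit Defensive.

Import Order.TTheory GRing.Theory Num.Theory.

Local Open Scope classical_set_scope.
Local Open Scope ring_scope.

Section lebesgue_tuple.
Context {R : realType}.
Local Open Scope ereal_scope.
Local Notation Rn n := (n.-tuple (measurableTypeR R)).

Definition cons_pair n (x : measurableTypeR R * Rn n) : Rn n.+1 :=
  [tuple of x.1 :: x.2].

Lemma measurable_cons_pair n : measurable_fun setT (@cons_pair n).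
Proof. exact: measurable_cons. Qed.

Fixpoint lebesgue_tuple n : set (Rn n) -> \bar R :=
  match n with
  | 0%N => \d_([tuple] : Rn 0)
  | m.+1 => pushforward (lebesgue_measure \x @lebesgue_tuple m) (@cons_pair m)
  end.

Lemma sigma_finite_cons n (m : {sigma_finite_measure set (Rn n) -> \bar R}) :
  sigma_finite setT (pushforward (lebesgue_measure \x m) (@cons_pair n)).
Proof.
have [F TF Foo] : sigma_finite setT (lebesgue_measure \x m).
  have /sigma_finiteP[A [TA ndA Aoo]] := sigma_finiteT (@lebesgue_measure R).
  have /sigma_finiteP[B [TB ndB Boo]] := sigma_finiteT m.
  exists (fun k => A k `*` B k).
    rewrite -setXTT TA TB predeqE => -[x y]; split.
      move=> [/= [i _ Aix] [j _ Bjy]]; exists (maxn i j) => //; split.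
      - by move: x Aix; exact/subsetPset/ndA/leq_maxl.
      - by move: y Bjy; exact/subsetPset/ndB/leq_maxr.
    by move=> [i _ []/= ? ?]; split; exists i.
  move=> k; have [? ?] := Aoo k; have [? ?] := Boo k.
  split; first exact: measurableX.
  by rewrite product_measure1E// lte_mul_pinfty// ge0_fin_numE.
pose uncons (t : Rn n.+1) : measurableTypeR R * Rn n :=
  (thead t, [tuple of behead t]).
have unconsK : cancel (@cons_pair n) uncons.
  by case=> x t; congr (_, _); apply/val_inj.
have muncons : measurable_fun setT uncons.
  apply/measurable_fun_pairP; split.
    exact: measurable_tnth.
  exact: measurable_behead.
exists (fun k => uncons @^-1` F k).
  by rewrite -preimage_bigcup -TF preimage_setT.
move=> k; have [mF Fk] := Foo k; split.
  by rewrite -[X in measurable X]setTI; exact: muncons.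
rewrite /pushforward (_ : _ @^-1` _ = F k)//.
by apply/seteqP; split=> x /=; rewrite unconsK.
Qed.

Lemma lebesgue_tuple_measure n :
  [/\ @lebesgue_tuple n set0 = 0,
      forall A, 0 <= @lebesgue_tuple n A,
      semi_sigma_additive (@lebesgue_tuple n) &
      sigma_finite setT (@lebesgue_tuple n)].
Proof.
elim: n => [|n [m0 m_ge0 m_add m_fin]].
  split; [exact: measure0 | by move=> A; exact: measure_ge0 | |].
    exact: measure_semi_sigma_additive.
  by exists (fun=> setT) => [|k]; [rewrite bigcup_const// | rewrite /= diracT ltry].
have -> : @lebesgue_tuple n.+1 =
  pushforward (lebesgue_measure \x @lebesgue_tuple n) (@cons_pair n) by [].
move: (@lebesgue_tuple n) m0 m_ge0 m_add m_fin => m m0 m_ge0 m_add m_fin.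
pose mm := isMeasure.Build _ _ _ m m0 m_ge0 m_add.
pose M1 : {measure set (Rn n) -> \bar R} := HB.pack m mm.
pose ms := @Measure_isSigmaFinite.Build _ _ _ M1 m_fin.
pose M : {sigma_finite_measure set (Rn n) -> \bar R} := HB.pack m mm ms.
have -> : m = M by [].
split.
- by rewrite /pushforward preimage_set0; exact: (measure0 (lebesgue_measure \x M)).
- by move=> A; exact: (measure_ge0 (lebesgue_measure \x M)).
- apply: (@measure_semi_sigma_additive _ _ _
    (pushforward (lebesgue_measure \x M) (@cons_pair n))).
  exact: measurable_cons_pair.
- exact: sigma_finite_cons.
Qed.

HB.instance Definition _ n := isMeasure.Build _ _ _ (@lebesgue_tuple n)
  (let: And4 m0 _ _ _ := lebesgue_tuple_measure n in m0)
  (let: And4 _ m_ge0 _ _ := lebesgue_tuple_measure n in m_ge0)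
  (let: And4 _ _ m_add _ := lebesgue_tuple_measure n in m_add).

HB.instance Definition _ n :=
  Measure_isSigmaFinite.Build _ _ _ (@lebesgue_tuple n)
  (let: And4 _ _ _ m_fin := lebesgue_tuple_measure n in m_fin).

Lemma lebesgue_tuple_box n (A : 'I_n -> set (measurableTypeR R)) :
  (forall i, measurable (A i)) ->
  @lebesgue_tuple n [set t : Rn n | forall i, A i (tnth t i)] =
  \prod_(i < n) lebesgue_measure (A i).
Proof.
elim: n A => [|n IHn] A mA.
  rewrite big_ord0 /= diracE mem_set// => -[]//.
rewrite big_ord_recl -IHn// -product_measure1E//; last first.
  rewrite (_ : [set _ | _] = \bigcap_(i in [set: 'I_n])
      ((fun t : Rn n => tnth t i) @^-1` A (lift ord0 i))); last first.
    by apply/seteqP; split=> t /= At i => [_|]; apply: At.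
  apply: fin_bigcap_measurable => // i _.
  by rewrite -[X in measurable X]setTI; exact: measurable_tnth.
rewrite /= /pushforward; congr (_ _); apply/seteqP; split=> -[x t] /= At.
  by split=> [|i]; [exact: (At ord0) | rewrite -(tnthS x); exact: At].
case: At => Ax At i; case: (unliftP ord0 i) => [j|] ->; last exact: Ax.
by rewrite tnthS.
Qed.

End lebesgue_tuple.

Section finite_matrices.
Context {R : realType}.
Implicit Type I : finType.

Definition fin_mx I (A : I -> I -> R) : 'M[R]_#|I| :=
  \matrix_(i, j) A (enum_val i) (enum_val j).

Definition fin_det I (A : I -> I -> R) : R := \det (fin_mx A).

(* invmx is the identity on singular matrices, so this is only meaningful     *)
(* where fin_mx A is invertible.                                             *)
Definition fin_inv I (A : I -> I -> R) (i j : I) : R :=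
  invmx (fin_mx A) (enum_rank i) (enum_rank j).

Definition posdef I (A : I -> I -> R) : Prop :=
  forall x : I -> R, (exists i, x i != 0) ->
    0 < \sum_i \sum_j x i * A i j * x j.

End finite_matrices.

Record weighted_graph (R : realType) (V : finType) := WeightedGraph {
  edge : rel V;
  edge_sym : symmetric edge;
  edge_irr : irreflexive edge;
  edge_connected : forall i j, connect edge i j;
  weight : V -> V -> R;
  weight_sym : forall i j, weight i j = weight j i;
  weight_gt0 : forall i j, edge i j -> 0 < weight i j;
  weight_eq0 : forall i j, ~~ edge i j -> weight i j = 0 }.

Section potential.
Context {R : realType} {V : finType}.
Variable g : weighted_graph R V.

Definition Hmx (beta : V -> R) (i j : V) : R :=
  if i == j then 2 * beta i else - weight g i j.

Definition nu_density (beta : V -> R) : R :=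
  Num.sqrt (2 / pi) ^+ #|V|
  * \1_[set b | posdef (Hmx b)] beta
  * expR (- (1 / 2) * \sum_i \sum_j Hmx beta i j)
  * (1 / Num.sqrt (fin_det (Hmx beta))).

(* R^V is represented by tuples of length #|V|, the coordinate of the vertex *)
(* k being the one of index enum_rank k.                                     *)
Definition nu (A : set (#|V|.-tuple (measurableTypeR R))) : \bar R :=
  (\int[@lebesgue_tuple R #|V|]_(t in A)
    (nu_density (fun k => tnth t (enum_rank k)))%:E)%E.

Definition has_law_nu d (Omega : measurableType d) (P : probability Omega R)
    (beta : V -> {RV P >-> R}) : Prop :=
  forall A : set (#|V|.-tuple (measurableTypeR R)), measurable A ->
    P [set w | A [tuple beta (enum_val i) w | i < #|V|]] = nu A.

Definition indistinguishable (U : {set V}) : Prop :=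
  forall i j k, i \in U -> j \in U -> k \notin U ->
    weight g k i = weight g k j.

End potential.

Section coarse_graining.
Context {R : realType} {V : finType}.
Variable U : {set V}.

(* The new vertex u is None. *)
Definition coarse_vertex : Type := option {k : V | k \notin U}.

Definition coarse_G (G : V -> V -> R) (k l : coarse_vertex) : R :=
  match k, l with
  | Some k, Some l => G (val k) (val l)
  | Some k, None => #|U|%:R^-1 * \sum_(i in U) G (val k) i
  | None, Some l => #|U|%:R^-1 * \sum_(i in U) G (val l) i
  | None, None => (#|U|%:R ^+ 2)^-1 * \sum_(i in U) \sum_(j in U) G i j
  end.

Definition principal_submx (H : V -> V -> R) (i j : {i : V | i \in U}) : R :=
  H (val i) (val j).

(* At u, this solves 1 / (2 beta'_u) = |U|^-2 \sum_(i, j) (H_{U,U})^-1 i j.  *)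
Definition coarse_beta (H : V -> V -> R) (beta : V -> R)
    (k : coarse_vertex) : R :=
  match k with
  | Some k => beta (val k)
  | None =>
    1 / (2 * ((#|U|%:R ^+ 2)^-1
              * \sum_i \sum_j fin_inv (principal_submx H) i j))
  end.

End coarse_graining.

(* This is e^{u_k}; u itself is not introduced because the quotient is only  *)
(* guaranteed to be positive where H_beta is positive definite.              *)
Definition exp_u (R : realType) (T : Type) (G : T -> T -> R) (i0 k : T) : R :=
  G k i0 / G i0 i0.

Section conditional_expectation.
Context d (Omega : measurableType d) (R : realType).
Variable P : probability Omega R.
Implicit Types (F : set (set Omega)) (X Y Z : Omega -> R).

Record cond_exp_version F X Z : Prop := CondExpVersion {
  cond_exp_sigma_algebra : sigma_algebra setT F;
  cond_exp_sub : F `<=` measurable;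
  cond_exp_integrable_arg : P.-integrable setT (EFin \o X);
  cond_exp_integrable : P.-integrable setT (EFin \o Z);
  cond_exp_measurable :
    forall B : set (measurableTypeR R), measurable B -> F (Z @^-1` B);
  cond_exp_integral : forall A, F A ->
    (\int[P]_(w in A) (X w)%:E = \int[P]_(w in A) (Z w)%:E)%E }.

(* E[X | F] = Y almost surely: as F is not completed, Y is only required to  *)
(* agree P-a.s. with an F-measurable version.                                *)
Definition cond_exp_eq F X Y : Prop :=
  exists2 Z, cond_exp_version F X Z & {ae P, forall w, Y w = Z w}.

End conditional_expectation.

Definition preimages d (Omega : measurableType d) (R : realType)
    (X : Omega -> measurableTypeR R) : set (set Omega) :=
  preimage_set_system setT X measurable.

(* Main.v *)
Require Import Defs.
From HB Require Import structures.
From mathcomp Require Import all_boot all_order all_algebra.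
From mathcomp Require Import all_classical all_reals all_analysis.
From mathcomp Require Import perm measurable_realfun ring.

Set Implicit Arguments.
Unset Strict Implicit.
Unset Printing Implicit Defensive.

Import Order.TTheory GRing.Theory Num.Theory.
Import numFieldNormedType.Exports.

Local Open Scope classical_set_scope.
Local Open Scope ring_scope.

(** Order the vertices so that those of U come first and write H in blocks,
with A = H_{U,U} in the upper left corner, C the block of V \ U and - N the
off-diagonal block.  Indistinguishability says that all rows of N are the same
row w.  The Schur complement of A is then C - s w^T w with s = <1, A^-1 1>, so
it depends on the potential on U through s only, and
1 / (2 beta'_u) = s / |U|^2.  Let b be the potential on V \ U.  Wherever H is
positive definite, block inversion shows that gamma, the coarse potential and
the ratios e^{u_k} with k outside U are functions of (b, s), and that

  e^{u_k} = (A^-1 1)_k * (a function of (b, s))      for k in U.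

As the entries of A^-1 1 sum to s, the mean of e^{u_k} over U is a function of
(b, s); by definition of G' it is e^{u'_u}.  Two points remain: the
conditional expectation of e^{u_k} must not depend on k in U, and both
candidates need versions that are measurable for F' itself, not up to null
events.

Exchange ([ratio_exchange]).  Given b, the law of the potential on U is a
function of s times exp(- <1, A 1> / 2) / sqrt(det A), so it is enough that the
integral of f(s) (A^-1 1)_k against this last density be the same for all k,
for every f >= 0 ([row_green_exchange]).  By uniqueness of Laplace transforms
([laplace_determines]) one may take f(s) = exp(- l s).  With
eta = sqrt(2 l) 1, the product of f(s) and the density is

  exp(- (<1, A 1> + <eta, A^-1 eta>) / 2) / sqrt(det A),

a member of a family whose integral is (pi / 2)^{n / 2} exp(- sum_i eta_i) for
all weights.  Differentiating this in eta_k suggests that the integral of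
(A^-1 eta)_k against it has that same value, for each k.  Both facts are
[hdens_integral]; the proof eliminates the vertices one at a time, which keeps
the density in the family and leaves one-dimensional integrals with an explicit
primitive.

Measurability ([green_ratio_pinned]).  The ratios e^{u_k} with k outside U are
the column of i0 of the inverse Schur complement, divided by its entry at i0.
They solve the rows k <> i0 of the linear system of the Schur complement, with
value 1 at i0.  Those rows do not contain the potential at i0, so the ratios
are functions of the coarse potential off i0.

Integrability of e^{u_k} ([integrable_exp_u]) is the same computation with i0
alone in the second block: e^{u_k} is then (A^-1 N)_k, where A is the block of
V \ {i0}, and [hdens_integral] bounds its mean with eta = N. *)

(** * Image measures and products of Lebesgue measure *)
Section integral_transfer.
Local Open Scope ereal_scope.
Context d1 d2 (X : measurableType d1) (Y : measurableType d2) (R : realType).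
Variables (mu : {measure set X -> \bar R}) (m : {measure set Y -> \bar R}).
Variables (phi : X -> Y) (g : X -> R).
Hypotheses (mphi : measurable_fun setT phi) (mg : measurable_fun setT g).
Hypothesis g0 : forall x, (0 <= g x)%R.
Hypothesis mE : forall A, measurable A -> m A = \int[mu]_(x in phi @^-1` A) (g x)%:E.

Import HBNNSimple.

(** The hypothesis is the formula for f the indicator of A; monotone
convergence along simple functions extends it. *)
Lemma integral_transfer (f : Y -> \bar R) :
  measurable_fun [set: Y] f -> (forall y, 0 <= f y) ->
  \int[m]_y f y = \int[mu]_x (f (phi x) * (g x)%:E).
Proof.
move=> mf f0; pose f_ := nnsfun_approx measurableT mf.
have mg' : measurable_fun setT (EFin \o g) by exact/measurable_EFinP.
have mind (A : set Y) : measurable A ->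
    measurable_fun setT (fun x => (\1_A (phi x))%:E : \bar R).
  move=> mA; apply/measurable_EFinP.
  by apply: measurableT_comp mphi; exact: measurable_indic.
transitivity (limn (fun n => \int[m]_x (f_ n x)%:E)).
  rewrite -monotone_convergence//.
  - apply: eq_integral => y _; apply/esym/cvg_lim => //.
    by apply: cvg_nnsfun_approx.
  - by move=> n; exact/measurable_EFinP/measurable_funP.
  - by move=> n y _; rewrite lee_fin.
  - by move=> y _ k n kn; rewrite lee_fin; exact/lefP/nd_nnsfun_approx.
rewrite [X in limn X](_ : _ =
    (fun n => \int[mu]_x ((f_ n (phi x))%:E * (g x)%:E))); last first.
  apply/funext => n.
  transitivity (\sum_(k \in range (f_ n))
      \int[mu]_x (k%:E * ((\1_(f_ n @^-1` [set k]) (phi x))%:E * (g x)%:E))).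
    under eq_integral do rewrite fimfunE -fsumEFin//.
    rewrite ge0_integral_fsum//; last 2 first.
    - by move=> y; exact/measurable_EFinP/measurable_funM.
    - by move=> y x _; rewrite nnfun_muleindic_ge0.
    apply: eq_fsbigr => r; rewrite inE => -[y _ yr].
    have r0 : (0 <= r)%R by rewrite -yr.
    under eq_integral do rewrite EFinM.
    rewrite ge0_integralZl//; last first.
      by apply/measurable_EFinP; exact: measurable_indic.
    rewrite ge0_integralZl//; last 2 first.
    - by apply: emeasurable_funM => //; exact: mind.
    - by move=> x _; rewrite mule_ge0// lee_fin.
    congr (_ * _); rewrite integral_indic// setIT mE// integral_mkcond.
    apply: eq_integral => x _; rewrite patchE indicE.
    have -> : (phi x \in f_ n @^-1` [set r]) =
              (x \in phi @^-1` (f_ n @^-1` [set r])).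
      by apply/idP/idP; rewrite !inE.
    by case: ifPn => _; rewrite ?mul1e// mul0e.
  rewrite -ge0_integral_fsum//.
  - apply: eq_integral => x _; rewrite [in RHS]fimfunE -fsumEFin//.
    rewrite ge0_mule_fsuml//; last by move=> r; rewrite nnfun_muleindic_ge0.
    by apply: eq_fsbigr => r _; rewrite EFinM muleA.
  - move=> r; apply: measurable_funeM.
    by apply: emeasurable_funM => //; exact: mind.
  - move=> r x _; rewrite muleA; apply: mule_ge0; last by rewrite lee_fin.
    by rewrite -EFinM nnfun_muleindic_ge0.
rewrite -monotone_convergence//.
- apply: eq_integral => x _; apply/cvg_lim => //.
  have fc : (f_ n (phi x))%:E @[n --> \oo] --> f (phi x).
    by apply: cvg_nnsfun_approx.
  rewrite muleC; under eq_fun do rewrite muleC.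
  exact: cvgeZl.
- move=> n; apply: emeasurable_funM => //; apply/measurable_EFinP.
  exact: measurableT_comp.
- by move=> n x _; rewrite mule_ge0// lee_fin.
- move=> x _ k n kn; apply: lee_wpmul2r; first by rewrite lee_fin.
  by have /lefP/(_ (phi x)) := nd_nnsfun_approx measurableT mf kn; rewrite lee_fin.
Qed.

End integral_transfer.

Lemma density_image_measure d1 d2 (X : measurableType d1) (Y : measurableType d2)
    (R : realType) (mu : {measure set X -> \bar R}) (phi : X -> Y) (g : X -> R) :
  measurable_fun setT phi -> measurable_fun setT g -> (forall x, 0 <= g x) ->
  exists m : {measure set Y -> \bar R}, forall A, measurable A ->
    m A = (\int[mu]_(x in phi @^-1` A) (g x)%:E)%E.
Proof.
move=> mphi mg g0.
pose D (A : set X) := (\int[mu]_(x in A) (g x)%:E)%E.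
have D0 : D set0 = 0%E by rewrite /D integral_set0.
have D_ge0 A : (0 <= D A)%E by apply: integral_ge0 => x _; rewrite lee_fin.
have Dadd : semi_sigma_additive D.
  by apply: semi_sigma_additive_nng_induced => //; exact/measurable_EFinP.
pose DM : {measure set X -> \bar R} := HB.pack D (isMeasure.Build _ _ _ D D0 D_ge0 Dadd).
suff: exists m : {measure set Y -> \bar R}, forall A, m A = pushforward DM phi A.
  by move=> [m mE]; exists m => A _; rewrite mE.
pose P := pushforward DM phi.
have P0 : P set0 = 0%E by rewrite /P /pushforward preimage_set0 measure0.
have P_ge0 A : (0 <= P A)%E by exact: D_ge0.
have Padd : semi_sigma_additive P by exact: measure_semi_sigma_additive.
pose PM : {measure set Y -> \bar R} := HB.pack P (isMeasure.Build _ _ _ P P0 P_ge0 Padd).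
by exists (PM mphi).
Qed.

Section tuple_reindexing.
Context {R : realType}.
Local Notation Rn n := (n.-tuple (measurableTypeR R)).
Local Open Scope ereal_scope.

Definition box n (A : 'I_n -> set (measurableTypeR R)) : set (Rn n) :=
  [set t | forall i, A i (tnth t i)].

Lemma measurable_box n (A : 'I_n -> set (measurableTypeR R)) :
  (forall i, measurable (A i)) -> measurable (box A).
Proof.
move=> mA; rewrite (_ : box A = \bigcap_(i in [set: 'I_n])
      ((fun t : Rn n => tnth t i) @^-1` A i)); last first.
  by apply/seteqP; split=> t /= At i => [_|]; apply: At.
apply: fin_bigcap_measurable => // i _.
by rewrite -[X in measurable X]setTI; exact: measurable_tnth.
Qed.

(** Boxes are stable under intersection, generate the product sigma-algebra and
contain an exhaustion of the space by sets of finite measure. *)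
Lemma lebesgue_tuple_unique n (m : {measure set (Rn n) -> \bar R}) :
  (forall A : 'I_n -> set (measurableTypeR R), (forall i, measurable (A i)) ->
    m (box A) = \prod_(i < n) lebesgue_measure (A i)) ->
  forall B, measurable B -> m B = lebesgue_tuple B.
Proof.
move=> mbox B mB.
pose G : set (set (Rn n)) :=
  [set box A | A in [set A | forall i, measurable (A i)]].
pose g k : set (Rn n) := box (fun=> `[(- k%:R)%R, k%:R%R]%classic).
apply: (measure_unique G g) => //.
- apply/seteqP; split.
    apply: smallest_sub; first exact: smallest_sigma_algebra.
    case: n {m mbox B mB} @G @g => [|n] G g; first by rewrite big_ord0.
    rewrite -bigcup_mkord_ord => C [i _ [D mD <-]].
    apply: sub_sigma_algebra; exists (fun j => if j == inord i then D else setT).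
      by move=> j; case: ifP.
    rewrite setTI; apply/seteqP; split=> t /=.
      by move=> /(_ (inord i)); rewrite eqxx.
    by move=> Dt j; case: eqP => [->|].
  apply: smallest_sub; first exact: sigma_algebra_measurable.
  by move=> _ [A mA <-]; exact: measurable_box.
- move=> _ _ [A mA <-] [D mD <-]; exists (fun i => A i `&` D i).
    by move=> i; exact: measurableI.
  by apply/seteqP; split=> t /=; [move=> AD; split=> i; have [] := AD i
    |move=> [At Dt] i; split; [exact: At|exact: Dt]].
- by move=> k; exists (fun=> `[(- k%:R)%R, k%:R%R]%classic).
- apply/seteqP; split=> // t _.
  pose M : R := (\sum_(i < n) `|tnth t i|)%R.
  have M0 : (0 <= M)%R by apply: sumr_ge0 => i _; exact: normr_ge0.
  exists (Num.truncn M).+1 => // i /=; rewrite in_itv /= -ler_norml.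
  apply: le_trans (ltW (truncnS_gt M)).
  by rewrite /M (bigD1 i)//= lerDl sumr_ge0// => j _; exact: normr_ge0.
- by move=> _ [A mA <-]; rewrite mbox//; exact/esym/lebesgue_tuple_box.
- move=> k; rewrite mbox// (eq_bigr (fun=> (k%:R + k%:R)%R%:E)).
    by rewrite prodEFin ltry.
  move=> i _; rewrite lebesgue_measure_itv/= lte_fin.
  case: ltP => [_|]; first by rewrite opprK -EFinD.
  rewrite -subr_le0 opprK => k0.
  by apply/eqP; rewrite eqe eq_le k0 addr_ge0// ler0n.
Qed.

Lemma lebesgue_tuple_reindex n q (s : 'I_q -> 'I_n) : bijective s ->
  forall B : set (Rn q), measurable B ->
  @lebesgue_tuple R n ((fun t => [tuple tnth t (s i) | i < q]) @^-1` B)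
    = lebesgue_tuple B.
Proof.
move=> bs; have mf : measurable_fun setT
    ((fun t => [tuple tnth t (s i) | i < q]) : Rn n -> Rn q).
  apply/measurable_fun_tnthP => i.
  rewrite (_ : _ \o _ = (fun t => tnth t (s i))); first exact: measurable_tnth.
  by apply/funext => t /=; rewrite tnth_mktuple.
apply: (@lebesgue_tuple_unique _
  (pushforward (@lebesgue_tuple R n) (fun t => [tuple tnth t (s i) | i < q])
    : {measure set _ -> \bar R})) => A mA.
have [s' sK s'K] := bs.
rewrite /= /pushforward.
rewrite (_ : _ @^-1` _ = box (fun i => A (s' i))); last first.
  apply/seteqP; split=> t /= At i.
    by have := At (s' i); rewrite tnth_mktuple s'K.
  by have := At (s i); rewrite tnth_mktuple sK.
rewrite lebesgue_tuple_box// (reindex s)/=; last exact: onW_bij.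
by apply: eq_bigr => i _; rewrite sK.
Qed.

Lemma measurable_cat m p : measurable_fun setT
    ((fun ab : Rn m * Rn p => [tuple of ab.1 ++ ab.2]) : _ -> Rn (m + p)).
Proof.
apply/measurable_fun_tnthP => i; case: (split_ordP i) => j ->.
  rewrite (_ : _ \o _ = (fun t => tnth t j) \o fst); last first.
    by apply/funext => ab /=; rewrite tnth_lshift.
  by apply: measurableT_comp; [exact: measurable_tnth|exact: measurable_fst].
rewrite (_ : _ \o _ = (fun t => tnth t j) \o snd); last first.
  by apply/funext => ab /=; rewrite tnth_rshift.
by apply: measurableT_comp; [exact: measurable_tnth|exact: measurable_snd].
Qed.

Lemma lebesgue_tuple_cat m p (B : set (Rn (m + p))) : measurable B ->
  (@lebesgue_tuple R m \x @lebesgue_tuple R p)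
    ((fun ab : Rn m * Rn p => [tuple of ab.1 ++ ab.2]) @^-1` B)
  = lebesgue_tuple B.
Proof.
have mcat := @measurable_cat m p.
move: B; apply: (@lebesgue_tuple_unique _
  (pushforward (@lebesgue_tuple R m \x @lebesgue_tuple R p)
    (fun ab : Rn m * Rn p => [tuple of ab.1 ++ ab.2])
    : {measure set _ -> \bar R})) => A mA. rewrite /= /pushforward.
rewrite (_ : _ @^-1` _ =
    box (fun i => A (lshift p i)) `*` box (fun i => A (rshift m i))).
  rewrite product_measure1E//; [|exact: measurable_box|exact: measurable_box].
  by rewrite big_split_ord; congr (_ * _); exact: lebesgue_tuple_box.
apply/seteqP; split=> -[a b] /=.
  move=> At; split=> i.
    by have := At (lshift p i); rewrite tnth_lshift.
  by have := At (rshift m i); rewrite tnth_rshift.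
move=> [Aa Ab] i; case: (split_ordP i) => j ->.
  by rewrite tnth_lshift; exact: Aa.
by rewrite tnth_rshift; exact: Ab.
Qed.

End tuple_reindexing.

(** * The one-dimensional integrals *)
Section improper_FTC.
Context {R : realType}.
Local Notation mu := lebesgue_measure.

(** The integrand may be singular at a, so the integral over [c, +oo[ is taken
first and c then decreases to a. *)
Lemma ge0_FTC2_oy (f F : R -> R) (a l r : R) :
  (forall x, a < x -> 0 <= f x) ->
  (forall x, a < x -> {for x, continuous f}) ->
  (forall x, a < x -> is_derive x 1 F (f x)) ->
  F x @[x --> +oo] --> l -> F x @[x --> a^'+] --> r ->
  (\int[mu]_(x in `]a, +oo[) (f x)%:E = (l - r)%:E)%E.
Proof.
move=> f0 cf dF Fl Fr.
pose c n : R := a + n.+1%:R^-1.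
have ac n : a < c n by rewrite ltrDl invr_gt0.
have cE : `]a, +oo[%classic = \bigcup_n `[c n, +oo[%classic :> set R.
  apply/seteqP; split=> x /=; rewrite in_itv/= andbT.
    move=> ax; exists (Num.truncn (x - a)^-1) => //=; rewrite in_itv/= andbT.
    rewrite -lerBrDl -[leRHS]invrK lef_pV2 ?posrE ?invr_gt0 ?subr_gt0//.
    by rewrite ltW// truncnS_gt.
  by move=> [n _ /=]; rewrite in_itv/= andbT => /(lt_le_trans (ac n)).
have mfo : measurable_fun `]a, +oo[%classic f.
  apply: open_continuous_measurable_fun => // x.
  by rewrite inE/= in_itv/= andbT => /cf.
have sub n : `[c n, +oo[%classic `<=` `]a, +oo[%classic.
  by move=> x /=; rewrite !in_itv/= !andbT; exact: lt_le_trans.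
have h : (\int[mu]_(x in `[c n, +oo[) (f x)%:E @[n --> \oo] -->
          \int[mu]_(x in `]a, +oo[) (f x)%:E)%E.
  rewrite cE; apply: ge0_nondecreasing_set_cvg_integral => //.
  - apply/nondecreasing_seqP => n; apply/subsetPset => x /=.
    rewrite !in_itv/= !andbT; apply: le_trans.
    by rewrite lerD2l lef_pV2 ?posrE// ler_nat.
  - by move=> i; apply/measurable_EFinP; exact: measurable_funS (sub i) mfo.
  - move=> n x /=; rewrite in_itv/= andbT lee_fin => cx; apply: f0.
    exact: lt_le_trans (ac n) cx.
have dd x : a < x -> derivable F x 1 by move=> /dF [].
have hE n : (\int[mu]_(x in `[c n, +oo[) (f x)%:E = l%:E - (F (c n))%:E)%E.
  apply: ge0_continuous_FTC2y => //.
  - by move=> x cx; apply: f0; exact: lt_le_trans (ac n) cx.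
  - apply: continuous_in_subspaceT => x; rewrite inE/= in_itv/= andbT => cx.
    by apply: cf; exact: lt_le_trans (ac n) cx.
  - by move=> x cx; apply: dd; exact: lt_trans cx.
  - apply: cvg_at_right_filter.
    by apply: differentiable_continuous; exact/derivable1_diffP/dd.
  - move=> x; rewrite in_itv/= andbT => cx; rewrite derive1E.
    by apply: derive_val; apply: dF; exact: lt_trans cx.
apply: (cvg_unique _ h) => //; rewrite (funext hE).
rewrite (_ : (fun n => _) = EFin \o (fun n => l - F (c n))); last first.
  by apply/funext => n /=; rewrite EFinB.
apply: cvg_EFin; first exact: nearW.
apply: cvgB; first exact: cvg_cst.
move/cvg_at_rightP : Fr; apply; split=> // .
rewrite -[X in _ --> X]addr0; apply: (@cvgD _ R^o); first exact: cvg_cst.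
exact: cvg_harmonic.
Qed.

End improper_FTC.

Section gauss_primitive.
Context {R : realType}.
Local Notation mu := lebesgue_measure.

(** The centred primitive of the Gauss function.  Its limits at infinity carry
the value of the Gaussian integral, obtained here from the distribution
function of the standard normal law. *)
Lemma gauss_primitive : exists Psi : R -> R,
  [/\ forall y : R, is_derive y (1 : R) Psi (expR (- y ^+ 2 / 2)), Psi 0 = 0,
      Psi y @[y --> +oo] --> Num.sqrt (pi / 2) &
      Psi y @[y --> -oo] --> - Num.sqrt (pi / 2)].
Proof.
pose f : R -> R := normal_pdf 0 1.
pose Phi y := \int[mu]_(x in `]-oo, y]) f x.
pose X : measurableTypeR R -> R := idfun.
have mX : measurable_fun setT X by exact: measurable_id.
pose mXX := isMeasurableFun.Build _ _ _ _ _ mX.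
pose XX : {RV (normal_prob 0 1 : probability _ R) >-> R} := HB.pack X mXX.
have cdfE y : cdf XX y = (Phi y)%:E.
  rewrite /Phi /Rintegral fineK.
    by rewrite /cdf/= /distribution/= /pushforward /normal_prob.
  apply: integrable_fin_num => //.
  by apply: integrableS (integrable_normal_pdf 0 1).
have Phi1 : Phi y @[y --> +oo] --> (1 : R).
  have := @cvg_cdfy1 _ _ _ _ XX; rewrite (funext cdfE) => /fine_cvgP[_].
  by apply: cvg_trans.
have Phi0 : Phi y @[y --> -oo] --> (0 : R).
  have := @cvg_cdfNy0 _ _ _ _ XX; rewrite (funext cdfE) => /fine_cvgP[_].
  by apply: cvg_trans.
have cf : continuous f by apply: continuous_normal_pdf; rewrite oner_eq0.
have dPhi (y : R) : is_derive y (1 : R) Phi (f y).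
  have yy1 : y < y + 1 by rewrite ltrDl.
  have intf : mu.-integrable [set` Interval -oo%O (BRight (y + 1))] (EFin \o f).
    by apply: integrableS (integrable_normal_pdf 0 1).
  have [d1 d2] := continuous_FTC1 yy1 intf (ltNyr y) (@cf y).
  by split; [exact: d1|rewrite -d2 derive1E].
pose c : R := Num.sqrt (pi / 2).
have fE y : f y = expR (- y ^+ 2 / 2) / (2 * c).
  have -> : f y = (Num.sqrt (1 ^+ 2 * pi *+ 2))^-1
                  * expR (- (y - 0) ^+ 2 / (1 ^+ 2 *+ 2)).
    by rewrite /f normal_pdfE ?oner_eq0.
  have -> : (1 ^+ 2 * pi *+ 2 : R) = 2 ^+ 2 * (pi / 2) by field.
  have -> : - (y - 0) ^+ 2 / (1 ^+ 2 *+ 2) = - y ^+ 2 / 2 :> R by field.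
  rewrite mulrC; congr (_ / _).
  by rewrite sqrtrM ?exprn_ge0// sqrtr_sqr ger0_norm.
have c0 : 0 < c by rewrite sqrtr_gt0 divr_gt0// pi_gt0.
(* antisymmetrising makes the primitive vanish at 0 with no appeal to the value of
   Phi there *)
exists (fun y => c * (Phi y - Phi (- y))); split.
- move=> y.
  have dN : is_derive y (1 : R) (fun y : R => Phi (- y)) (- f y).
    have := @is_derive1_comp _ Phi -%R y (f (- y)) (-1) (dPhi _) _.
    have -> : f (- y) = f y by rewrite !fE sqrrN.
    by rewrite mulrN1; apply; apply: is_deriveNid.
  have -> : expR (- y ^+ 2 / 2) = c *: (f y - - f y).
    by rewrite /GRing.scale /= fE; field; rewrite gt_eqF.
  by apply: is_deriveZ; apply: is_deriveB.
- by rewrite oppr0 subrr mulr0.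
- have -> : Num.sqrt (pi / 2) = c * (1 - 0) :> R by rewrite subr0 mulr1.
  apply: cvgM; first exact: cvg_cst.
  apply: cvgB => //; have := Phi0; rewrite cvgNy_compNP; exact.
- have -> : - Num.sqrt (pi / 2) = c * (0 - 1) :> R by rewrite sub0r mulrN1.
  apply: cvgM; first exact: cvg_cst.
  apply: cvgB => //; have := Phi1; rewrite cvgy_compNP; exact.
Qed.

End gauss_primitive.

Section kernel_integrals.
Context {R : realType}.
Local Notation mu := lebesgue_measure.

(** Up to an exponential, the factor contributed by a vertex of diagonal entry h
when it is eliminated; b will be the sum of the weights of its edges and of the linear
term at it. *)
Definition pivot_kernel (h b : R) : R :=
  expR (- (h + b ^+ 2 / h) / 2) / Num.sqrt h.

(** With u = sqrt (2 x - w) the functions Psi (u - b / u) and Psi (u + b / u)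
have derivatives that are, up to the factors exp b and exp (- b), the kernel
times 1 + b / (2 x - w) and 1 - b / (2 x - w).  Both the kernel and its product
with b / (2 x - w) are therefore combinations of the two. *)
Section primitive.
Variables (w b : R) (Psi : R -> R).
Hypothesis b0 : 0 <= b.
Hypothesis dPsi : forall y : R, is_derive y (1 : R) Psi (expR (- y ^+ 2 / 2)).
Hypothesis Psi0 : Psi 0 = 0.
Hypothesis Psiy : Psi y @[y --> +oo] --> Num.sqrt (pi / 2).
Hypothesis PsiNy : Psi y @[y --> -oo] --> - Num.sqrt (pi / 2).
Let u (x : R) : R := Num.sqrt (2 * x - w).
Let P1 (x : R) : R := Psi (u x - b / u x).
Let P2 (x : R) : R := Psi (u x + b / u x).
Let a := w / 2.
Let c : R := Num.sqrt (pi / 2).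

Let h_gt0 x : (a < x) = (0 < 2 * x - w).
Proof. by rewrite subr_gt0 /a ltr_pdivrMr// mulrC. Qed.

Let u_gt0 x : a < x -> 0 < u x.
Proof. by rewrite h_gt0 sqrtr_gt0. Qed.

Let sqr_u x : a < x -> u x ^+ 2 = 2 * x - w.
Proof. by rewrite h_gt0 => /ltW; exact: sqr_sqrtr. Qed.

Let du x : a < x -> is_derive x (1 : R) u (u x)^-1.
Proof.
move=> ax; have -> : (u x)^-1 = (2 * Num.sqrt (2 * x - w))^-1 * 2.
  by rewrite -/(u x); field; rewrite gt_eqF// u_gt0.
apply: (@is_derive1_comp _ Num.sqrt (fun x => 2 * x - w)).
  by apply: is_derive1_sqrt; rewrite -h_gt0.
apply: (is_derive_eq (is_deriveB (is_deriveZ 2 (is_derive_id x (1 : R)))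
  (is_derive_cst w x 1))).
by rewrite subr0 /GRing.scale/= mulr1.
Qed.

Let dbu x : a < x -> is_derive x (1 : R) (fun x => b / u x) (- (b / u x ^+ 3)).
Proof.
move=> ax; have u0 := u_gt0 ax.
have un0 : u x != 0 by rewrite gt_eqF.
apply: (is_derive_eq (is_deriveZ b (is_deriveV un0 (du ax)))).
by rewrite /GRing.scale/=; field; rewrite gt_eqF.
Qed.

Let kern (x : R) : R := pivot_kernel (2 * x - w) b.

Let dP1 x : a < x ->
  is_derive x (1 : R) P1 (expR b * (1 + b / (2 * x - w)) * kern x).
Proof.
move=> ax; have u0 := u_gt0 ax.
apply: (is_derive_eq (@is_derive1_comp _ Psi (fun x => u x - b / u x) x _ _
  (dPsi _) (is_deriveB (du ax) (dbu ax)))).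
rewrite /kern /pivot_kernel -(sqr_u ax) sqrtr_sqr gtr0_norm//.
have -> : - (u x - b / u x) ^+ 2 / 2 = b + - (u x ^+ 2 + b ^+ 2 / u x ^+ 2) / 2.
  by field; rewrite gt_eqF.
by rewrite expRD; field; rewrite gt_eqF.
Qed.

Let dP2 x : a < x ->
  is_derive x (1 : R) P2 (expR (- b) * (1 - b / (2 * x - w)) * kern x).
Proof.
move=> ax; have u0 := u_gt0 ax.
apply: (is_derive_eq (@is_derive1_comp _ Psi (fun x => u x + b / u x) x _ _
  (dPsi _) (is_deriveD (du ax) (dbu ax)))).
rewrite /kern /pivot_kernel -(sqr_u ax) sqrtr_sqr gtr0_norm//.
have -> : - (u x + b / u x) ^+ 2 / 2 = - b + - (u x ^+ 2 + b ^+ 2 / u x ^+ 2) / 2.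
  by field; rewrite gt_eqF.
by rewrite expRD; field; rewrite gt_eqF.
Qed.

Let kern_cont x : a < x -> {for x, continuous kern}.
Proof.
move=> ax; have h0 : 0 < 2 * x - w by rewrite -h_gt0.
have ch : {for x, continuous (fun x : R => 2 * x - w : R)}.
  by apply: cvgB; [apply: cvgM; [exact: cvg_cst|exact: cvg_id]|exact: cvg_cst].
have chV : {for x, continuous (fun x : R => (2 * x - w)^-1 : R)}.
  by apply: cvgV => //; rewrite gt_eqF.
apply: cvgM.
  apply: continuous_comp; last exact: continuous_expR.
  apply: cvgM; last exact: cvg_cst.
  apply: cvgN; apply: cvgD; first exact: ch.
  by apply: cvgM => //; exact: cvg_cst.
apply: cvgV; first by rewrite gt_eqF// sqrtr_gt0.
by apply: continuous_comp; [exact: ch|exact: sqrt_continuous].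
Qed.

Let chV_cont x : a < x -> {for x, continuous (fun x : R => b / (2 * x - w) : R)}.
Proof.
rewrite h_gt0 => h0; apply: cvgM; first exact: cvg_cst.
apply: cvgV; first by rewrite gt_eqF.
by apply: cvgB; [apply: cvgM; [exact: cvg_cst|exact: cvg_id]|exact: cvg_cst].
Qed.

Let uy : u x @[x --> +oo] --> +oo.
Proof.
apply/cvgryPge => A; near=> x.
apply: le_trans (ler_norm A) _; rewrite -sqrtr_sqr ler_wsqrtr//.
by rewrite lerBrDr -ler_pdivrMl//; near: x; apply: nbhs_pinfty_ge; rewrite num_real.
Unshelve. all: by end_near. Qed.

Let u0 : u x @[x --> a^'+] --> (0 : R).
Proof.
have <- : u a = 0 by rewrite /u /a (_ : 2 * _ - _ = 0) ?sqrtr0//; field.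
apply: cvg_at_right_filter.
apply: (@continuous_comp _ _ _ (fun x : R => 2 * x - w) Num.sqrt);
  last exact: sqrt_continuous.
by apply: cvgB; [apply: cvgM; [exact: cvg_cst|exact: cvg_id]|exact: cvg_cst].
Qed.

Let near_a : \forall x \near a^'+, a < x.
Proof. exact: nbhs_right_gt. Qed.

Let buy : 0 < b -> b / u x @[x --> a^'+] --> +oo.
Proof.
move=> bgt0; apply/cvgryPge => A; near=> x.
have ax : a < x by near: x; exact: near_a.
apply: le_trans (ler_norm A) _; apply: (@le_trans _ _ (`|A| + 1)).
  by rewrite lerDl.
have A1 : 0 < `|A| + 1 by rewrite ltr_wpDl.
rewrite ler_pdivlMr ?u_gt0// mulrC -ler_pdivlMr//.
apply/ltW; near: x; apply: (cvgr_lt 0 u0).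
exact: divr_gt0.
Unshelve. all: by end_near. Qed.

Let P1y : P1 x @[x --> +oo] --> c.
Proof.
apply: (cvg_comp _ _ _ Psiy); apply/cvgryPge => A; near=> x.
have u1 : 1 <= u x by near: x; exact: (cvgryPge _).1 uy _.
apply: (@le_trans _ _ (u x - b)).
  by rewrite lerBrDr; near: x; exact: (cvgryPge _).1 uy _.
by rewrite lerB// ler_pdivrMr ?(lt_le_trans _ u1)// ler_peMr.
Unshelve. all: by end_near. Qed.

Let P2y : P2 x @[x --> +oo] --> c.
Proof.
apply: (cvg_comp _ _ _ Psiy); apply/cvgryPge => A; near=> x.
apply: (@le_trans _ _ (u x)); last by rewrite lerDl divr_ge0// sqrtr_ge0.
by near: x; exact: (cvgryPge _).1 uy _.
Unshelve. all: by end_near. Qed.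

Let P1a : 0 < b -> P1 x @[x --> a^'+] --> - c.
Proof.
move=> bgt0; apply: (cvg_comp _ _ _ PsiNy); apply/cvgrNyPle => A; near=> x.
have u1 : u x <= 1 by apply/ltW; near: x; exact: (cvgr_lt 0 u0).
rewrite lerBlDr -lerBlDl (le_trans _ (_ : 1 - A <= _)) ?lerD2r//.
by near: x; exact: (cvgryPge _).1 (buy bgt0) _.
Unshelve. all: by end_near. Qed.

Let P2a : 0 < b -> P2 x @[x --> a^'+] --> c.
Proof.
move=> bgt0; apply: (cvg_comp _ _ _ Psiy); apply/cvgryPge => A; near=> x.
apply: (@le_trans _ _ (b / u x)); last by rewrite lerDr sqrtr_ge0.
by near: x; exact: (cvgryPge _).1 (buy bgt0) _.
Unshelve. all: by end_near. Qed.

Let kern_ge0 x : 0 <= kern x.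
Proof. by rewrite /kern divr_ge0 ?expR_ge0// sqrtr_ge0. Qed.

Let restrict_itv (f : R -> R) :
  (\int[mu]_x (if 0 < 2 * x - w then f x else 0)%:E =
   \int[mu]_(x in `]a, +oo[) (f x)%:E)%E.
Proof.
rewrite [RHS]integral_mkcond; apply: eq_integral => x _.
by rewrite patchE mem_setE/= in_itv/= andbT h_gt0; case: ifP.
Qed.

(** The weight p = exp (- b) / 2 of the first primitive is common to both uses.
The second primitive tends to c at both ends, so the value of the integral is
that of the first, whatever the weight q. *)
Let integral_comb (q : R) (f : R -> R) : 0 < b ->
  (forall x, a < x -> 0 <= f x) ->
  (forall x, a < x -> {for x, continuous f}) ->
  (forall x, a < x -> f x = expR (- b) / 2 * (expR b * (1 + b / (2 * x - w)) * kern x)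
    + q * (expR (- b) * (1 - b / (2 * x - w)) * kern x)) ->
  (\int[mu]_(x in `]a, +oo[) (f x)%:E = (c * expR (- b))%:E)%E.
Proof.
move=> b_gt0 f0 cf fE; set p := expR (- b) / 2.
have -> : c * expR (- b) = p * c + q * c - (p * - c + q * c).
  by rewrite /p; field.
refine (@ge0_FTC2_oy _ f (fun x => p * P1 x + q * P2 x) a _ _ f0 cf _ _ _).
- move=> x ax; apply: (is_derive_eq
    (is_deriveD (is_deriveZ p (dP1 ax)) (is_deriveZ q (dP2 ax)))).
  by rewrite fE.
- by apply: cvgD; (apply: cvgM; first exact: cvg_cst).
- apply: cvgD; (apply: cvgM; first exact: cvg_cst); first exact: P1a.
  exact: P2a.
Qed.

Let expRVb : expR (- b) * expR b = 1.
Proof. by rewrite -expRD addNr expR0. Qed.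

Lemma integral_pivot_kernel_section :
  (\int[mu]_x (if (0 < 2 * x - w)%R then pivot_kernel (2 * x - w) b else 0)%:E =
   (c * expR (- b))%:E)%E.
Proof.
rewrite (restrict_itv kern).
(* for b = 0 the two primitives coincide and b / u has no infinite limit at a *)
have [b_gt0|b_le0] := ltP 0 b; last first.
  have bE : b = 0 by apply/eqP; rewrite eq_le b_le0.
  have PE : P1 = Psi \o u.
    by apply/funext => x; rewrite /P1 bE mul0r subr0.
  rewrite bE oppr0 expR0 mulr1 -[c]subr0.
  apply: (@ge0_FTC2_oy _ _ P1) => //.
  - move=> x ax; apply: (is_derive_eq (dP1 ax)).
    by rewrite bE expR0 mul0r addr0 !mul1r.
  - have cPsi : {for (0 : R), continuous Psi}.
      apply: differentiable_continuous; apply/derivable1_diffP.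
      by have [] := dPsi 0.
    rewrite /prop_for/= /continuous_at Psi0 in cPsi.
    by rewrite PE; exact: (cvg_comp _ _ u0 cPsi).
apply: (@integral_comb (expR b / 2)) => // x ax.
transitivity (expR (- b) * expR b * kern x); first by rewrite expRVb mul1r.
by field; rewrite gt_eqF// -h_gt0.
Qed.

Lemma integral_pivot_kernel_div_section : 0 < b ->
  (\int[mu]_x (if (0 < 2 * x - w)%R
     then b / (2 * x - w) * pivot_kernel (2 * x - w) b else 0)%:E =
   (c * expR (- b))%:E)%E.
Proof.
move=> b_gt0; rewrite (restrict_itv (fun x => b / (2 * x - w) * kern x)).
apply: (@integral_comb (- (expR b / 2))) => // x ax.
- by rewrite mulr_ge0// divr_ge0// ltW// -h_gt0.
- by apply: cvgM; [exact: chV_cont|exact: kern_cont].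
transitivity (expR (- b) * expR b * (b / (2 * x - w) * kern x)).
  by rewrite expRVb mul1r.
by field; rewrite gt_eqF// -h_gt0.
Qed.

End primitive.

Lemma integral_pivot_kernel (w b : R) : 0 <= b ->
  (\int[mu]_x (if (0 < 2 * x - w)%R then pivot_kernel (2 * x - w) b else 0)%:E =
   (Num.sqrt (pi / 2) * expR (- b))%:E)%E.
Proof.
move=> b0; have [Psi [dPsi Psi0 Psiy PsiNy]] := @gauss_primitive R.
exact: (integral_pivot_kernel_section _ b0 dPsi).
Qed.

Lemma integral_pivot_kernel_div (w b : R) : 0 < b ->
  (\int[mu]_x (if (0 < 2 * x - w)%R
     then b / (2 * x - w) * pivot_kernel (2 * x - w) b else 0)%:E =
   (Num.sqrt (pi / 2) * expR (- b))%:E)%E.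
Proof.
move=> b0; have [Psi [dPsi Psi0 Psiy PsiNy]] := @gauss_primitive R.
exact: (integral_pivot_kernel_div_section _ (ltW b0) dPsi).
Qed.

End kernel_integrals.

(** * Positive definite matrices and Schur complements *)
Section positive_definite.
Context {R : realType}.
Implicit Types m n p : nat.

Definition qform n (A : 'M[R]_n) (x : 'cV_n) : R := (x^T *m A *m x) 0 0.

Definition posdefmx n (A : 'M[R]_n) : Prop :=
  forall x : 'cV_n, x != 0 -> 0 < qform A x.

Lemma qform0 n (A : 'M[R]_n) : qform A 0 = 0.
Proof. by rewrite /qform mulmx0 mxE. Qed.

Lemma qform_ge0 n (A : 'M[R]_n) x : posdefmx A -> 0 <= qform A x.
Proof. by move=> pA; have [->|/pA/ltW//] := eqVneq x 0; rewrite qform0. Qed.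

Let addE (X Y : 'M[R]_1) : (X + Y) 0 0 = X 0 0 + Y 0 0.
Proof. by rewrite mxE. Qed.

Let trE (X : 'M[R]_1) : X 0 0 = X^T 0 0.
Proof. by rewrite mxE. Qed.

Lemma mulmx11 (A B : 'M[R]_1) : (A *m B) 0 0 = A 0 0 * B 0 0.
Proof. by rewrite mxE big_ord1. Qed.

Lemma posdefmx_ker n (A : 'M[R]_n) (x : 'cV_n) :
  posdefmx A -> qform A x = 0 -> x = 0.
Proof.
by move=> pA Ax; apply/eqP; apply: contra_eqT Ax => /pA; rewrite lt0r => /andP[].
Qed.

Lemma unitmx_ker n (A : 'M[R]_n) :
  (forall x : 'cV_n, A *m x = 0 -> x = 0) -> A \in unitmx.
Proof.
move=> inj; rewrite -unitmx_tr -row_free_unit -kermx_eq0.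
apply/eqP/row_matrixP => i; rewrite row0; apply: trmx_inj; rewrite trmx0.
apply: inj; have : row i (kermx A^T) *m A^T = 0 by rewrite -row_mul mulmx_ker row0.
by move=> /(congr1 trmx); rewrite trmx_mul trmxK trmx0.
Qed.

Lemma posdefmx_unit n (A : 'M[R]_n) : posdefmx A -> A \in unitmx.
Proof.
move=> pA; apply: unitmx_ker => x Ax; apply: (posdefmx_ker pA).
by rewrite /qform -mulmxA Ax mulmx0 mxE.
Qed.

Lemma qform_inv n (A : 'M[R]_n) x : A^T = A -> A \in unitmx ->
  qform (invmx A) (A *m x) = qform A x.
Proof.
by move=> sA uA; rewrite /qform trmx_mul sA mulmxA mulmxK.
Qed.

Lemma qform_invV n (A : 'M[R]_n) x : A^T = A -> A \in unitmx ->
  qform (invmx A) x = qform A (invmx A *m x).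
Proof. by move=> sA uA; rewrite -{1}(mulKVmx uA x) qform_inv. Qed.

Lemma qformD n (A : 'M[R]_n) x z : A^T = A ->
  qform A (x + z) = qform A x + 2 * (x^T *m (A *m z)) 0 0 + qform A z.
Proof.
move=> sA; rewrite /qform [(x + z)^T]linearD/= !mulmxDl !mulmxDr !addE.
have -> : (z^T *m A *m x) 0 0 = (x^T *m (A *m z)) 0 0.
  by rewrite trE !trmx_mul trmxK sA.
by rewrite !mulmxA; ring.
Qed.

Section schur.
Variables (m p : nat) (A : 'M[R]_m) (B : 'M[R]_(m, p)) (C : 'M[R]_p).
Hypotheses (sA : A^T = A).

Let M := block_mx A B B^T C.
Definition schur := C - B^T *m invmx A *m B.
Let S := schur.

Lemma qform_block x y :
  qform M (col_mx x y) = qform A x + 2 * (x^T *m B *m y) 0 0 + qform C y.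
Proof.
rewrite /qform tr_col_mx mul_row_block mul_row_col !mulmxDl !addE.
have -> : (y^T *m B^T *m x) 0 0 = (x^T *m B *m y) 0 0.
  by rewrite trE !trmx_mul !trmxK mulmxA.
by ring.
Qed.

Lemma posdefmx_ul : posdefmx M -> posdefmx A.
Proof.
move=> pM x x0; have := pM (col_mx x 0).
rewrite qform_block mulmx0 qform0 mxE mulr0 !addr0.
by apply; rewrite col_mx_eq0 negb_and x0.
Qed.

Hypothesis uA : A \in unitmx.

Lemma block_mx_schur : M = block_mx 1%:M 0 (B^T *m invmx A) 1%:M
  *m block_mx A 0 0 S *m block_mx 1%:M (invmx A *m B) 0 1%:M.
Proof.
rewrite !mulmx_block !(mul1mx, mulmx1, mul0mx, mulmx0, addr0, add0r).
by rewrite mulmxKV// mulKVmx// mulmxA /S /schur addrC subrK.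
Qed.

Lemma det_schur : \det M = \det A * \det S.
Proof.
rewrite block_mx_schur !det_mulmx det_lblock det_ublock det_ublock !det1.
by rewrite !mul1r !mulr1.
Qed.

Lemma qform_schur x y : qform M (col_mx x y)
  = qform A (x + invmx A *m B *m y) + qform S y.
Proof.
rewrite qform_block qformD//. rewrite -!(mulmxA (invmx A)) mulKVmx//.
have -> : qform S y = qform C y - qform A (invmx A *m (B *m y)).
  rewrite /qform /S /schur mulmxBr mulmxBl [LHS]mxE [X in _ + X]mxE.
  congr (_ - _ 0 0); rewrite !trmx_mul !mulmxA trmx_inv sA.
  by rewrite mulmxKV.
by rewrite !mulmxA; ring.
Qed.

Hypothesis uM : M \in unitmx.

Let uS : S \in unitmx.
Proof. by move: uM; rewrite !unitmxE det_schur unitrM => /andP[]. Qed.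

Lemma invmx_block (u : 'cV_m) (v : 'cV_p) : let y := invmx S *m (v - B^T *m invmx A *m u) in
  invmx M *m col_mx u v = col_mx (invmx A *m (u - B *m y)) y.
Proof.
move=> y; apply: (can_inj (mulKmx uM)); rewrite mulKVmx// mul_block_col.
rewrite mulKVmx// subrK; congr col_mx.
have -> : C = S + B^T *m invmx A *m B by rewrite /S /schur subrK.
rewrite mulmxDl mulKVmx// !mulmxBr !mulmxA.
by rewrite [RHS]addrC -addrA [X in _ + X]addrCA subrr addr0 subrK.
Qed.

Hypothesis sC : C^T = C.

Lemma tr_schur : S^T = S.
Proof.
rewrite /S /schur linearB/= sC !trmx_mul trmxK trmx_inv sA; congr (_ - _).
by rewrite mulmxA.
Qed.

Lemma tr_block : M^T = M.
Proof. by rewrite tr_block_mx trmxK sA sC. Qed.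

Lemma qform_inv_block (u : 'cV_m) (v : 'cV_p) : qform (invmx M) (col_mx u v) =
  qform (invmx A) u + qform (invmx S) (v - B^T *m invmx A *m u).
Proof.
rewrite qform_invV ?tr_block// invmx_block qform_schur mulmxBr !mulmxA subrK.
by rewrite -!qform_invV ?tr_schur.
Qed.

End schur.

Lemma posdefmx_block m p (A : 'M[R]_m) (B : 'M[R]_(m, p)) (C : 'M[R]_p) : A^T = A ->
  posdefmx (block_mx A B B^T C) <-> posdefmx A /\ posdefmx (schur A B C).
Proof.
move=> sA; split=> [pM|[pA pS] z z0].
  have pA := posdefmx_ul pM; split=> // y y0.
  have := pM (col_mx (- (invmx A *m B *m y)) y).
  rewrite qform_schur ?posdefmx_unit// addNr qform0 add0r; apply.
  by rewrite col_mx_eq0 negb_and y0 orbT.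
rewrite -(vsubmxK z) qform_schur ?posdefmx_unit//.
have [y0|y0] := eqVneq (dsubmx z) 0; last first.
  by rewrite ltr_wpDl ?pS// qform_ge0.
rewrite y0 mulmx0 addr0 qform0 addr0 pA//.
by apply: contra z0 => /eqP x0; rewrite -(vsubmxK z) x0 y0 col_mx0.
Qed.

Lemma det_gt0 n (A : 'M[R]_n) : A^T = A -> posdefmx A -> 0 < \det A.
Proof.
elim: n A => [A _ _|n IHn]; first by rewrite det_mx00.
rewrite -[n.+1]/(1 + n)%N => A; rewrite -(submxK A).
move: (ulsubmx A) (ursubmx A) (dlsubmx A) (drsubmx A) => {A} a b b' c.
rewrite tr_block_mx => /eq_block_mx[sa _ <- sc] pM.
have [pa ps] := (posdefmx_block b c sa).1 pM.
have ua := posdefmx_unit pa.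
rewrite det_schur// mulr_gt0 ?IHn ?tr_schur//.
have /pa : (1%:M : 'cV[R]_1) != 0 by rewrite oner_neq0.
by rewrite /qform trmx1 mul1mx mulmx1 det_mx11.
Qed.

Lemma qform_inv_ge0 n (A : 'M[R]_n) x :
  A^T = A -> posdefmx A -> 0 <= qform (invmx A) x.
Proof. by move=> sA pA; rewrite qform_invV ?posdefmx_unit// qform_ge0. Qed.

Definition offdiag_le0 n (A : 'M[R]_n) := forall i j, i != j -> A i j <= 0.

(** A positive definite matrix with nonpositive off-diagonal entries is an
M-matrix: its inverse preserves nonnegative vectors.  The proof tests the
quadratic form on the negative part y of x, where y_i (x_i + y_i) = 0 leaves
only off-diagonal terms. *)
Lemma mmatrix_ge0 n (A : 'M[R]_n) (x : 'cV_n) : posdefmx A -> offdiag_le0 A ->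
  (forall i, 0 <= (A *m x) i 0) -> forall i, 0 <= x i 0.
Proof.
move=> pA oA Ax.
pose y : 'cV[R]_n := \col_i Num.max 0 (- x i 0).
have yE i : y i 0 = Num.max 0 (- x i 0) by rewrite mxE.
have y_ge0 i : 0 <= y i 0 by rewrite yE le_max lexx.
have xy_ge0 i : 0 <= x i 0 + y i 0 by rewrite yE -lerBlDl sub0r le_max lexx orbT.
have yxy i : y i 0 * (x i 0 + y i 0) = 0.
  rewrite yE; case: (leP 0 (- x i 0)) => _; first by rewrite subrr mulr0.
  by rewrite mul0r.
suff y0 : y = 0.
  by move=> i; have := xy_ge0 i; rewrite y0 mxE addr0.
apply: (posdefmx_ker pA); apply/eqP; rewrite eq_le qform_ge0// andbT.
have -> : qform A y = - (\sum_i y i 0 * (A *m x) i 0)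
   + \sum_i y i 0 * (A *m (x + y)) i 0.
  rewrite -sumrN -big_split/= /qform -mulmxA mxE; apply: eq_bigr => i _.
  have -> : (A *m (x + y)) i 0 = (A *m x) i 0 + (A *m y) i 0.
    by rewrite mulmxDr mxE.
  by rewrite [y^T _ _]mxE; ring.
rewrite -[leRHS]addr0 lerD//.
  by rewrite oppr_le0 sumr_ge0// => i _; rewrite mulr_ge0.
rewrite sumr_le0// => i _.
rewrite [(A *m (x + y)) i 0]mxE mulr_sumr sumr_le0// => j _.
have [<-|ij] := eqVneq i j; first by rewrite mulrCA [(x + y) _ _]mxE yxy mulr0.
by rewrite mulr_ge0_le0// [(x + y) _ _]mxE mulr_le0_ge0// oA.
Qed.

Lemma invmx_ge0 n (A : 'M[R]_n) (x : 'cV_n) : posdefmx A -> offdiag_le0 A ->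
  (forall i, 0 <= x i 0) -> forall i, 0 <= (invmx A *m x) i 0.
Proof.
move=> pA oA x0; apply: (mmatrix_ge0 pA oA) => i.
by rewrite mulKVmx// posdefmx_unit.
Qed.

Lemma qform11 (a : 'M[R]_1) x : qform a x = x 0 0 ^+ 2 * a 0 0.
Proof. by rewrite /qform !mulmx11 [x^T _ _]mxE; ring. Qed.

Lemma posdefmx11 (a : 'M[R]_1) : posdefmx a <-> 0 < a 0 0.
Proof.
split=> [/(_ 1%:M)|a0 x x0].
  by rewrite qform11 mxE eqxx expr1n mul1r; apply; rewrite oner_neq0.
rewrite qform11 mulr_gt0// exprn_even_gt0//=; apply: contra x0 => /eqP x0.
by apply/eqP/matrixP => i j; rewrite !ord1 x0 mxE.
Qed.

End positive_definite.

Section density.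
Context {R : realType}.

(** For eta = 0 this is the density of the random potential, up to its
constant.  The linear term eta makes the family stable under elimination of
vertices and turns a Laplace transform in <1, A^-1 1> into a change of eta. *)
Definition hdens n (A : 'M[R]_n) (eta : 'cV_n) : R :=
  if `[< posdefmx A >] then
    expR (- (qform A (const_mx 1) + qform (invmx A) eta) / 2) / Num.sqrt (\det A)
  else 0.

Lemma hdens_ge0 n (A : 'M[R]_n) eta : 0 <= hdens A eta.
Proof. by rewrite /hdens; case: ifP => // _; rewrite divr_ge0 ?expR_ge0// sqrtr_ge0. Qed.

(** Once A is fixed, the density is that of a member of the same family for the
Schur complement, with linear term v - B^T A^-1 u. *)
Lemma hdens_block m p (A : 'M[R]_m) (B : 'M[R]_(m, p)) (C : 'M[R]_p) u v :
  A^T = A -> C^T = C ->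
  hdens (block_mx A B B^T C) (col_mx u v) =
  if `[< posdefmx A >] then
    expR (- (qform A (const_mx 1) + 2 * ((const_mx 1 : 'cV_m)^T *m B *m (const_mx 1 : 'cV_p)) 0 0
       + qform (invmx A) (B *m (const_mx 1 : 'cV_p)) + qform (invmx A) u) / 2)
      / Num.sqrt (\det A)
    * hdens (schur A B C) (v - B^T *m invmx A *m u)
  else 0.
Proof.
move=> sA sC; rewrite /hdens.
have [pA|npA] := pselect (posdefmx A); last first.
  by rewrite asboolF ?(asboolF npA)// => /posdefmx_ul.
rewrite (asboolT pA); have uA := posdefmx_unit pA.
have [pS|npS] := pselect (posdefmx (schur A B C)); last first.
  by rewrite asboolF ?(asboolF npS) ?mulr0// => pM; apply: npS;
    have [] := (posdefmx_block B C sA).1 pM.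
have pM : posdefmx (block_mx A B B^T C).
  exact/(posdefmx_block B C sA).2.
have uM := posdefmx_unit pM.
rewrite (asboolT pM) (asboolT pS) det_schur// sqrtrM; last first.
  by rewrite ltW// det_gt0.
rewrite qform_inv_block// -col_mx_const qform_schur// qformD//.
rewrite -(mulmxA (invmx A)) mulKVmx// -qform_invV//.
rewrite [RHS]mulrACA -expRD invfM; congr (expR _ * _).
by rewrite !mulmxA; field.
Qed.

End density.

(** * Measurability of matrix operations *)
Section measurable_matrix.
Context d (T : measurableType d) (R : realType).

Definition measurable_mx m n (A : T -> 'M[R]_(m, n)) :=
  forall i j, measurable_fun setT (fun t => A t i j).

Lemma measurable_inverse (f : T -> R) :
  measurable_fun setT f -> measurable_fun setT (fun t => (f t)^-1).
Proof.
move=> mf; suff mV : measurable_fun setT (fun x : R => x^-1 : R).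
  exact: measurableT_comp mV mf.
have -> : (fun x : R => x^-1 : R) =
    (fun x : R => if x == 0 then 0 else ((fun y : R => y^-1 : R) \_ [set y | y != 0]) x).
  apply/funext => x; case: eqVneq => [->|x0]; first by rewrite invr0.
  by rewrite patchE mem_set.
apply: measurable_fun_ifT; [exact: measurable_fun_eqr|by []|].
have mD : measurable [set y : R | y != 0].
  rewrite (_ : [set _ | _] = ~` [set 0]); first exact: measurableC.
  by apply/seteqP; split=> y /= /eqP.
apply/(measurable_restrictT _ mD).
apply: open_continuous_measurable_fun; first exact: open_neq.
by move=> x; rewrite inE/= => x0; apply: cvgV => //; exact: cvg_id.
Qed.

Lemma measurable_sqrt_comp (f : T -> R) :
  measurable_fun setT f -> measurable_fun setT (fun t => Num.sqrt (f t)).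
Proof.
move=> mf; apply: measurableT_comp mf.
by apply: continuous_measurable_fun; exact: sqrt_continuous.
Qed.

Lemma measurable_expR_comp (f : T -> R) :
  measurable_fun setT f -> measurable_fun setT (fun t => expR (f t)).
Proof. by move=> mf; apply: measurableT_comp mf. Qed.

Lemma measurable_div (f g : T -> R) : measurable_fun setT f ->
  measurable_fun setT g -> measurable_fun setT (fun t => f t / g t).
Proof. by move=> mf mg; apply: measurable_funM => //; exact: measurable_inverse. Qed.

Lemma measurable_mulmx m n p (A : T -> 'M[R]_(m, n)) (B : T -> 'M[R]_(n, p)) :
  measurable_mx A -> measurable_mx B -> measurable_mx (fun t => A t *m B t).
Proof.
move=> mA mB i j; under eq_fun do rewrite mxE.
by apply: measurable_sum => k; exact: measurable_funM.
Qed.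

Lemma measurable_trmx m n (A : T -> 'M[R]_(m, n)) :
  measurable_mx A -> measurable_mx (fun t => (A t)^T).
Proof. by move=> mA i j; under eq_fun do rewrite mxE; exact: mA. Qed.

Lemma measurable_addmx m n (A B : T -> 'M[R]_(m, n)) :
  measurable_mx A -> measurable_mx B -> measurable_mx (fun t => A t + B t).
Proof.
by move=> mA mB i j; under eq_fun do rewrite mxE; exact: measurable_funD.
Qed.

Lemma measurable_oppmx m n (A : T -> 'M[R]_(m, n)) :
  measurable_mx A -> measurable_mx (fun t => - A t).
Proof.
move=> mA i j; under eq_fun do rewrite mxE.
exact: (measurable_funN (mA i j)).
Qed.

Lemma measurable_cstmx m n (A : 'M[R]_(m, n)) : measurable_mx (fun=> A).
Proof. by []. Qed.

Lemma measurable_scalemx m n (f : T -> R) (A : T -> 'M[R]_(m, n)) :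
  measurable_fun setT f -> measurable_mx A -> measurable_mx (fun t => f t *: A t).
Proof.
by move=> mf mA i j; under eq_fun do rewrite mxE; exact: measurable_funM.
Qed.

Lemma measurable_det n (A : T -> 'M[R]_n) :
  measurable_mx A -> measurable_fun setT (fun t => \det (A t)).
Proof.
move=> mA; apply: measurable_sum => s; apply: measurable_funM => //.
by apply: measurable_prod => i _; exact: mA.
Qed.

Lemma measurable_invmx n (A : T -> 'M[R]_n) :
  measurable_mx A -> measurable_mx (fun t => invmx (A t)).
Proof.
move=> mA i j; have md := measurable_det mA.
rewrite /invmx; under eq_fun do rewrite unitmxE unitfE.
have -> : (fun t => (if \det (A t) != 0 then (\det (A t))^-1 *: \adj (A t)
    else A t) i j) = (fun t => if \det (A t) == 0 then A t i j
    else (\det (A t))^-1 * \adj (A t) i j).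
  by apply/funext => t; case: eqP => //= _; rewrite mxE.
apply: measurable_fun_ifT => //; first exact: measurable_fun_eqr.
apply: measurable_funM; first exact: measurable_inverse.
under eq_fun do rewrite mxE /cofactor.
apply: measurable_funM => //; apply: measurable_det => k l.
by under eq_fun do rewrite !mxE; exact: mA.
Qed.

Lemma measurable_qform n (A : T -> 'M[R]_n) (x : T -> 'cV[R]_n) :
  measurable_mx A -> measurable_mx x ->
  measurable_fun setT (fun t => qform (A t) (x t)).
Proof.
move=> mA mx; apply: (measurable_mulmx _ mx); apply: (measurable_mulmx _ mA).
exact: measurable_trmx.
Qed.

(** Positive definiteness quantifies over uncountably many vectors; eliminating
the first vertex reduces it to the positivity of one entry and to the Schur
complement. *)
Lemma measurable_posdefmx n (A : T -> 'M[R]_n) : (forall t, (A t)^T = A t) ->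
  measurable_mx A -> measurable [set t | posdefmx (A t)].
Proof.
elim: n A => [|n IHn] A sA mA.
  rewrite (_ : [set _ | _] = setT)//; apply/seteqP; split=> // t _ x.
  by rewrite flatmx0 eqxx.
pose A' t : 'M[R]_(1 + n) := A t.
pose a t := ulsubmx (A' t); pose b t := ursubmx (A' t); pose c t := drsubmx (A' t).
have AE t : A' t = block_mx (a t) (b t) (b t)^T (c t).
  by rewrite trmx_ursub sA submxK.
have sa t : (a t)^T = a t by rewrite trmx_ulsub sA.
have sc t : (c t)^T = c t by rewrite trmx_drsub sA.
have ma : measurable_mx a by move=> i j; under eq_fun do rewrite !mxE; exact: mA.
have mb : measurable_mx b by move=> i j; under eq_fun do rewrite !mxE; exact: mA.
have mc : measurable_mx c by move=> i j; under eq_fun do rewrite !mxE; exact: mA.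
rewrite (_ : [set _ | _] = [set t | 0 < a t 0 0] `&`
    [set t | posdefmx (schur (a t) (b t) (c t))]).
  apply: measurableI.
    have ma0 : measurable_fun setT (fun t => 0 < a t 0 0).
      by apply: measurable_fun_ltr => //; exact: ma.
    by rewrite -[X in measurable X]setTI; exact: (ma0 measurableT [set true]).
  apply: IHn => [t|]; first by rewrite tr_schur.
  apply: measurable_addmx => //; apply: measurable_oppmx.
  apply: measurable_mulmx => //; apply: measurable_mulmx.
    exact: measurable_trmx.
  exact: measurable_invmx.
apply/seteqP; split=> t /=; rewrite -/(A' t) AE.
  by move=> /(posdefmx_block _ _ (sa t)).1 [/posdefmx11 a0].
by move=> [/posdefmx11 pa ps]; apply/(posdefmx_block _ _ (sa t)).2.
Qed.

Lemma measurable_hdens n (A : T -> 'M[R]_n) (eta : T -> 'cV[R]_n) :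
  (forall t, (A t)^T = A t) -> measurable_mx A -> measurable_mx eta ->
  measurable_fun setT (fun t => hdens (A t) (eta t)).
Proof.
move=> sA mA me; apply: measurable_fun_ifT => //.
  apply: (measurable_fun_bool true).
  rewrite setTI (_ : _ @^-1` _ = [set t | posdefmx (A t)]).
    exact: measurable_posdefmx.
  by apply/seteqP; split=> t /= => [/asboolP//|]; exact: asboolT.
apply: measurable_div; last exact/measurable_sqrt_comp/measurable_det.
apply/measurable_expR_comp/measurable_funM => //.
apply: measurable_funN; apply: measurable_funD; first exact: measurable_qform.
by apply: measurable_qform => //; exact: measurable_invmx.
Qed.

End measurable_matrix.

(** * Normalisation of the densities with a linear term *)
Section hmx.
Context {R : realType}.
Local Notation Rn n := (n.-tuple (measurableTypeR R)).

(** A diagonal of W is allowed: eliminating a vertex adds weights between all its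
neighbours, loops included. *)
Definition hmx n (W : 'M[R]_n) (t : n.-tuple R) : 'M[R]_n :=
  \matrix_(i, j) ((2 * tnth t i) *+ (i == j) - W i j).

Definition symnonneg n (W : 'M[R]_n) := W^T = W /\ forall i j, 0 <= W i j.

Lemma tr_hmx n (W : 'M[R]_n) t : W^T = W -> (hmx W t)^T = hmx W t.
Proof.
move=> sW; apply/matrixP => i j; rewrite !mxE -[in LHS]sW mxE eq_sym.
by case: eqVneq => [->|].
Qed.

Lemma offdiag_hmx n (W : 'M[R]_n) t : (forall i j, 0 <= W i j) ->
  offdiag_le0 (hmx W t).
Proof. by move=> W0 i j /negbTE ij; rewrite mxE ij mulr0n sub0r oppr_le0. Qed.

Lemma measurable_hmx n (W : 'M[R]_n) :
  measurable_mx (fun t : Rn n => hmx W t).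
Proof.
move=> i j.
have -> : (fun t : Rn n => hmx W t i j) =
    (fun t : Rn n => (2 *+ (i == j)) * tnth t i - W i j).
  by apply/funext => t; rewrite mxE [in RHS]mulrnAl.
apply: measurable_funB => //; apply: measurable_funM => //.
exact: measurable_tnth.
Qed.

Lemma hmx_cons n w (r : 'rV[R]_n) (W : 'M[R]_n) x (t : n.-tuple R) :
  hmx (block_mx w%:M r r^T W) [tuple of x :: t] =
  block_mx (2 * x - w)%:M (- r) (- r)^T (hmx W t).
Proof.
have tS (i : 'I_n) : tnth [tuple of x :: t] (rshift 1 i) = tnth t i.
  by rewrite rshift1 tnthS.
have t0 (i : 'I_1) : tnth [tuple of x :: t] (lshift n i) = x.
  by rewrite ord1 (tnth_nth x).
apply/matrixP => i j; rewrite [LHS]mxE.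
case: (split_ordP i) => {}i ->; case: (split_ordP j) => {}j ->.
- by rewrite !block_mxEul t0 !ord1 !mxE !eqxx.
- by rewrite !block_mxEur t0 mxE eq_lrshift sub0r.
- by rewrite !block_mxEdl tS !mxE eq_rlshift sub0r.
- by rewrite !block_mxEdr tS !mxE eq_rshift.
Qed.

(** For h > 0, the Schur complement of one vertex is again the matrix of a weighted
graph, with the weights increased by the paths of length two through that vertex. *)
Lemma schur_hmx n h (r : 'rV[R]_n) (W : 'M[R]_n) (t : n.-tuple R) : h != 0 ->
  schur h%:M (- r) (hmx W t) = hmx (W + h^-1 *: (r^T *m r)) t.
Proof.
move=> h0; rewrite /schur invmx_scalar [(- r)^T]linearN/= !mulNmx mulmxN opprK.
rewrite mul_mx_scalar -scalemxAl; apply/matrixP => i j.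
rewrite !mxE; set q := \sum_k _; rewrite opprD addrA; congr (_ - _ - _).
Qed.

Lemma hdens_cons n h (r : 'rV[R]_n) (C : 'M[R]_n) e (v : 'cV[R]_n) :
  let a := \sum_j r 0 j in C^T = C ->
  hdens (block_mx h%:M (- r) (- r)^T C) (col_mx e%:M v) =
  if 0 < h then expR (a + e * a / h) * pivot_kernel h (a + e)
    * hdens (schur h%:M (- r) C) (v + (e / h) *: r^T) else 0.
Proof.
move=> a sC; rewrite hdens_block ?tr_scalar_mx//.
have -> : `[< posdefmx (h%:M : 'M[R]_1) >] = (0 < h).
  by apply/asboolP/idP => [/posdefmx11|h0]; [|apply/posdefmx11]; rewrite mxE eqxx.
case: ifPn => // h0; rewrite det_scalar1 invmx_scalar.
have r1 : (r *m const_mx 1 : 'M[R]_1) 0 0 = a.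
  by rewrite mxE; apply: eq_bigr => j _; rewrite mxE mulr1.
have -> : v - (- r)^T *m h^-1%:M *m e%:M = v + (e / h) *: r^T.
  rewrite [(- r)^T]linearN/= !mulNmx opprK !mul_mx_scalar scalerA.
  by congr (_ + _ *: _).
have Nr1 : (- r *m const_mx 1 : 'M[R]_1) 0 0 = - a by rewrite mulNmx mxE r1.
have -> : const_mx 1 = 1%:M :> 'cV[R]_1.
  by apply/matrixP => i j; rewrite !mxE !ord1 eqxx.
rewrite trmx1 mul1mx Nr1 !qform11 Nr1 ![_%:M _ _]mxE eqxx !mulr1n.
congr (_ * _).
rewrite /pivot_kernel mulrA -expRD; congr (expR _ / _).
by field; rewrite gt_eqF.
Qed.

Section tonelli.
Local Open Scope ereal_scope.
Variables (n : nat) (f : Rn n.+1 -> R).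
Hypotheses (mf : measurable_fun setT f) (f0 : forall t, (0 <= f t)%R).

Let mcp : measurable_fun setT (fun xt => (f (@cons_pair R n xt))%:E).
Proof.
apply/measurable_EFinP.
by apply: measurableT_comp mf _; exact: measurable_cons_pair.
Qed.

Lemma integral_lebesgue_tupleS :
  \int[@lebesgue_tuple R n.+1]_t (f t)%:E =
  \int[lebesgue_measure]_x \int[@lebesgue_tuple R n]_t (f [tuple of x :: t])%:E.
Proof.
transitivity (\int[pushforward (lebesgue_measure \x @lebesgue_tuple R n)
   (@cons_pair R n)]_t (f t)%:E); first by [].
rewrite ge0_integral_pushforward//=; last 3 first.
- exact: measurable_cons_pair.
- exact/measurable_EFinP.
- by move=> t _; rewrite lee_fin.
rewrite preimage_setT.
apply: (fubini_tonelli1 (fun xt => (f (@cons_pair R n xt))%:E)); first exact: mcp.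
by move=> xt; rewrite lee_fin.
Qed.

Lemma measurable_integral_lebesgue_tupleS : measurable_fun setT
  (fun x => \int[@lebesgue_tuple R n]_t (f [tuple of x :: t])%:E).
Proof.
apply: (measurable_fun_fubini_tonelli_F (fun xt => (f (@cons_pair R n xt))%:E)).
  exact: mcp.
by move=> xt; rewrite lee_fin.
Qed.

End tonelli.

Section normalisation.
Local Open Scope ereal_scope.
Let c : R := Num.sqrt (pi / 2).
Let c0 : (0 <= c)%R. Proof. exact: sqrtr_ge0. Qed.

(** The density weighted by the k-th coordinate of the solution of A x = eta, that
is, for A symmetric, minus the partial derivative of [hdens A eta] in eta_k. *)
Definition hsol n (A : 'M[R]_n) (eta : 'cV[R]_n) k : R :=
  ((invmx A *m eta) k 0 * hdens A eta)%R.

Lemma hsol_ge0 n (W : 'M[R]_n) t (eta : 'cV[R]_n) k : symnonneg W ->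
  (forall i, 0 <= eta i 0)%R -> (0 <= hsol (hmx W t) eta k)%R.
Proof.
move=> [_ W0] e0; rewrite /hsol /hdens; case: ifPn => [/asboolP pA|_].
  rewrite mulr_ge0 ?invmx_ge0 ?divr_ge0 ?expR_ge0 ?sqrtr_ge0//.
  exact: offdiag_hmx.
by rewrite mulr0.
Qed.

Lemma measurable_hsol d (T : measurableType d) n (A : T -> 'M[R]_n)
  (eta : T -> 'cV[R]_n) k : (forall t, (A t)^T = A t) ->
  measurable_mx A -> measurable_mx eta ->
  measurable_fun setT (fun t => hsol (A t) (eta t) k).
Proof.
move=> sA mA me; apply: measurable_funM; last exact: measurable_hdens.
apply: (measurable_mulmx _ me); exact: measurable_invmx.
Qed.

Lemma measurable_hdens_hmx n (W : 'M[R]_n) eta : W^T = W ->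
  measurable_fun setT (fun t : Rn n => hdens (hmx W t) eta).
Proof.
move=> sW; apply: measurable_hdens => //; last exact: measurable_hmx.
by move=> t; exact: tr_hmx.
Qed.

Let mhsol n (W : 'M[R]_n) eta k : W^T = W ->
  measurable_fun setT (fun t : Rn n => hsol (hmx W t) eta k).
Proof.
move=> sW; apply: measurable_hsol => //; last exact: measurable_hmx.
by move=> t; exact: tr_hmx.
Qed.

Definition hmass n (eta : 'cV[R]_n) : R := (c ^+ n * expR (- \sum_i eta i 0))%R.

(** Elimination of the first vertex, of diagonal entry h x = 2 x - w.  Given x,
the remaining potential follows a density of the same family with weights W' x
and linear term v' x, which are nonnegative, and [IH0] and [IH1] are the
induction hypotheses for it. *)
Section step.
Variables (n : nat) (w : R) (r : 'rV[R]_n) (W : 'M[R]_n) (e : R) (v : 'cV[R]_n).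
Hypotheses (snW : symnonneg W) (r0 : forall j, (0 <= r 0 j)%R).
Hypotheses (e0 : (0 <= e)%R) (v0 : forall i, (0 <= v i 0)%R).
Let a := (\sum_j r 0%R j)%R.
Let W1 : 'M[R]_(1 + n) := block_mx w%:M r r^T W.
Let e1 : 'cV[R]_(1 + n) := col_mx e%:M v.
Let h (x : R) : R := (2 * x - w)%R.
Let W' (x : R) : 'M[R]_n := (W + (h x)^-1 *: (r^T *m r))%R.
Let v' (x : R) : 'cV[R]_n := (v + (e / h x) *: r^T)%R.

Let a0 : (0 <= a)%R. Proof. exact: sumr_ge0. Qed.

Lemma symnonneg_step x : (0 < h x)%R -> symnonneg (W' x).
Proof.
move=> h0; have [sW W0] := snW; split=> [|i j].
  by rewrite linearD linearZ/= trmx_mul trmxK sW.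
rewrite mxE [X in (_ + X)%R]mxE; apply: addr_ge0; first exact: W0.
apply: mulr_ge0; first by rewrite invr_ge0 ltW.
by rewrite mxE big_ord1 mxE mulr_ge0.
Qed.

Lemma eta_step_ge0 (x : R) : (0 < h x)%R -> forall i, (0 <= v' x i 0)%R.
Proof.
by move=> h0 i; rewrite !mxE addr_ge0// mulr_ge0// divr_ge0// ltW.
Qed.

Let C (x : R) : R := (expR (a + e * a / h x) * pivot_kernel (h x) (a + e))%R.

Let C0 (x : R) : (0 <= C x)%R.
Proof. by rewrite mulr_ge0 ?expR_ge0// divr_ge0 ?expR_ge0 ?sqrtr_ge0. Qed.

Lemma hdens_step x (t : n.-tuple R) : hdens (hmx W1 [tuple of x :: t]) e1 =
  (if (0 < h x)%R then C x * hdens (hmx (W' x) t) (v' x) else 0)%R.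
Proof.
rewrite hmx_cons hdens_cons ?tr_hmx//; last by case: snW.
by case: ifPn => // h0; rewrite schur_hmx// gt_eqF.
Qed.

(** The total masses for the eliminated graphs depend on x through e a / h x,
which cancels with the factor produced by the elimination; only the kernel is
left under the integral over x. *)
Lemma hmass_step x : (0 < h x)%R -> (C x * hmass (v' x) =
  c ^+ n * expR (a - \sum_i v i 0) * pivot_kernel (h x) (a + e))%R.
Proof.
move=> h0; rewrite /C /hmass.
have -> : (\sum_i v' x i 0 = \sum_i v i 0 + e * a / h x)%R.
  rewrite -[(e * a / _)%R]mulrAC mulr_sumr -big_split/=.
  by apply: eq_bigr => i _; rewrite !mxE.
set s := (\sum_i _)%R; set q := (e * a / h x)%R.
have -> : (a - s = (a + q) + - (s + q))%R by ring.
by rewrite !expRD; ring.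
Qed.

Let scalar_addE (X : 'M[R]_1) i j : ((e%:M + X) i j = e + X i j)%R.
Proof. by rewrite !ord1 mxE mxE eqxx mulr1n. Qed.

Let hsol_step x (t : n.-tuple R) : (0 < h x)%R -> posdefmx (hmx (W' x) t) ->
  let y := (invmx (hmx (W' x) t) *m v' x)%R in
  (invmx (hmx W1 [tuple of x :: t]) *m e1 =
  col_mx ((h x)^-1 *: (e%:M + r *m y)) y)%R.
Proof.
move=> h0 pS; rewrite hmx_cons => y.
have pM : posdefmx (block_mx (h x)%:M (- r) (- r)^T (hmx W t)).
  apply/posdefmx_block; first by rewrite tr_scalar_mx.
  by split; [apply/posdefmx11; rewrite mxE|rewrite schur_hmx// gt_eqF].
have uM := posdefmx_unit pM.
have uh : ((h x)%:M : 'M[R]_1) \in unitmx.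
  by rewrite unitmxE det_scalar1 unitfE gt_eqF.
rewrite /e1 -/(h x) invmx_block// invmx_scalar schur_hmx ?gt_eqF//.
have -> : (v - (- r)^T *m (h x)^-1%:M *m e%:M = v' x)%R.
  rewrite [((- r)^T)%R]linearN/= !mulNmx opprK !mul_mx_scalar scalerA.
  by congr (_ + _ *: _)%R.
by rewrite mul_scalar_mx mulNmx opprK.
Qed.

Lemma hsol_step_rshift x (t : n.-tuple R) i :
  hsol (hmx W1 [tuple of x :: t]) e1 (rshift 1 i) =
  (if (0 < h x)%R then C x * hsol (hmx (W' x) t) (v' x) i else 0)%R.
Proof.
rewrite /hsol hdens_step; case: ifPn => [h0|_]; last by rewrite mulr0.
have [pS|npS] := pselect (posdefmx (hmx (W' x) t)); last first.
  by rewrite /hdens asboolF// !mulr0.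
by rewrite hsol_step// col_mxEd mulrCA.
Qed.

Lemma hsol_step_lshift x (t : n.-tuple R) :
  hsol (hmx W1 [tuple of x :: t]) e1 (lshift n 0%R) =
  (if (0 < h x)%R then C x * ((e / h x) * hdens (hmx (W' x) t) (v' x)
     + \sum_j (r 0%R j / h x) * hsol (hmx (W' x) t) (v' x) j) else 0)%R.
Proof.
rewrite /hsol hdens_step; case: ifPn => [h0|_]; last by rewrite mulr0.
have [pS|npS] := pselect (posdefmx (hmx (W' x) t)); last first.
  rewrite /hdens asboolF// big1 ?mulr0 ?addr0 ?mulr0// => j _.
  by rewrite !mulr0.
rewrite hsol_step// col_mxEu mxE mulrCA; congr (_ * _)%R.
rewrite scalar_addE mulrDr mulrDl.
rewrite [((h x)^-1 * e)%R]mulrC; congr (_ + _)%R.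
rewrite mxE mulr_sumr mulr_suml; apply: eq_bigr => j _.
by rewrite mulrA [((h x)^-1 * _)%R]mulrC mulrA.
Qed.

Let K := (c ^+ n * expR (a - \sum_i v i 0))%R.

Let K0 : (0 <= K)%R.
Proof. by rewrite mulr_ge0 ?exprn_ge0 ?expR_ge0. Qed.

Let KE : (K * (c * expR (- (a + e))) = c ^+ n.+1 * expR (- (e + \sum_i v i 0)))%R.
Proof.
rewrite /K exprS; set s := (\sum_i _)%R.
have -> : (- (e + s) = (a - s) + - (a + e))%R by ring.
by rewrite (expRD (a - s)); ring.
Qed.

Let hmassE : hmass e1 = (c ^+ n.+1 * expR (- (e + \sum_i v i 0)))%R.
Proof.
rewrite /hmass /e1 big_split_ord/= big_ord1 col_mxEu mxE eqxx mulr1n.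
by congr (_ * expR (- (_ + _)))%R; apply: eq_bigr => i _; rewrite col_mxEd.
Qed.

Hypothesis IH0 : forall x, (0 < h x)%R ->
  \int[@lebesgue_tuple R n]_t (hdens (hmx (W' x) t) (v' x))%:E
  = (hmass (v' x))%:E.
Hypothesis IH1 : forall x k, (0 < h x)%R ->
  \int[@lebesgue_tuple R n]_t (hsol (hmx (W' x) t) (v' x) k)%:E
  <= (hmass (v' x))%:E.

Let sW : W^T = W. Proof. by case: snW. Qed.

Let sW' x : (0 < h x)%R -> (W' x)^T = W' x.
Proof. by move=> /symnonneg_step []. Qed.

Let sW1 : W1^T = W1.
Proof. by rewrite /W1 tr_block_mx tr_scalar_mx trmxK sW. Qed.

Let mh : measurable_fun setT h.
Proof.
apply: measurable_funB => //; apply: measurable_funM => //.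
Qed.

Let m0h : measurable_fun setT (fun x => 0 < h x)%R.
Proof. exact: measurable_fun_ltr. Qed.

Let mpk : measurable_fun setT (fun x => pivot_kernel (h x) (a + e)).
Proof.
apply: measurable_div; last exact: measurable_sqrt_comp.
apply: measurable_expR_comp; apply: measurable_funM => //.
apply: measurable_funN; apply: measurable_funD => //.
exact: measurable_div.
Qed.

Let mkern : measurable_fun setT
  (fun x => (if (0 < h x)%R then pivot_kernel (h x) (a + e) else 0%R)%:E).
Proof. by apply/measurable_EFinP; exact: measurable_fun_ifT. Qed.

Let mkern' : measurable_fun setT
  (fun x => (if (0 < h x)%R
     then (a + e) / h x * pivot_kernel (h x) (a + e) else 0)%R%:E).
Proof.
apply/measurable_EFinP; apply: measurable_fun_ifT => //.
by apply: measurable_funM => //; exact: measurable_div.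
Qed.

Let kern0 (x : R) : 0 <= (if (0 < h x)%R then pivot_kernel (h x) (a + e) else 0%R)%:E.
Proof.
by rewrite lee_fin; case: ifP => // _; rewrite divr_ge0 ?expR_ge0// sqrtr_ge0.
Qed.

Let kern0' (x : R) : 0 <= (if (0 < h x)%R
  then (a + e) / h x * pivot_kernel (h x) (a + e) else 0)%R%:E.
Proof.
rewrite lee_fin; case: ifP => // h0; apply: mulr_ge0.
  by apply: divr_ge0; [exact: addr_ge0|exact: ltW].
by rewrite divr_ge0 ?expR_ge0// sqrtr_ge0.
Qed.

Lemma integral_hdens_step :
  \int[@lebesgue_tuple R n.+1]_t (hdens (hmx W1 t) e1)%:E = (hmass e1)%:E.
Proof.
rewrite integral_lebesgue_tupleS; last 2 first.
- exact: measurable_hdens_hmx.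
- by move=> t; exact: hdens_ge0.
transitivity (\int[lebesgue_measure]_x
  (K%:E * (if (0 < h x)%R then pivot_kernel (h x) (a + e) else 0%R)%:E)).
  apply: eq_integral => x _.
  case: (boolP (0 < h x)%R) => h0; last first.
    rewrite mule0 -[RHS](integral0 (@lebesgue_tuple R n) setT).
    by apply: eq_integral => t _; rewrite hdens_step (negbTE h0).
  under eq_integral do rewrite hdens_step h0 EFinM.
  rewrite ge0_integralZl_EFin//; last 2 first.
  - by move=> t _; rewrite lee_fin hdens_ge0.
  - by apply/measurable_EFinP; apply: measurable_hdens_hmx; exact: sW'.
  by rewrite IH0// -!EFinM hmass_step.
rewrite ge0_integralZl_EFin//.
by rewrite integral_pivot_kernel ?addr_ge0// -EFinM KE hmassE.
Qed.

Let e1_ge0 i : (0 <= e1 i 0)%R.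
Proof.
case: (split_ordP i) => {}i ->; rewrite ?col_mxEu ?col_mxEd//.
by rewrite ord1 mxE eqxx.
Qed.

Let W1_ge0 : (0 <= w)%R -> symnonneg W1.
Proof.
move=> w0; split=> // i j; have [_ W0] := snW.
case: (split_ordP i) => {}i ->; case: (split_ordP j) => {}j ->.
- by rewrite block_mxEul !ord1 mxE eqxx.
- by rewrite block_mxEur ord1.
- by rewrite block_mxEdl mxE ord1.
- by rewrite block_mxEdr.
Qed.

Let J (x : R) k := \int[@lebesgue_tuple R n]_t (hsol (hmx (W' x) t) (v' x) k)%:E.

Let J_ge0 x k : (0 < h x)%R -> 0 <= J x k.
Proof.
move=> h0; apply: integral_ge0 => t _; rewrite lee_fin.
by apply: hsol_ge0; [exact: symnonneg_step|exact: eta_step_ge0].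
Qed.

Let Fr (x : R) i :
  \int[@lebesgue_tuple R n]_t (hsol (hmx W1 [tuple of x :: t]) e1 (rshift 1 i))%:E
  = if (0 < h x)%R then (C x)%:E * J x i else 0.
Proof.
have [h0|h0] := boolP (0 < h x)%R; last first.
  rewrite -[RHS](integral0 (@lebesgue_tuple R n) setT).
  by apply: eq_integral => t _; rewrite hsol_step_rshift (negbTE h0).
under eq_integral do rewrite hsol_step_rshift h0 EFinM.
rewrite ge0_integralZl_EFin//.
- move=> t _; rewrite lee_fin.
  by apply: hsol_ge0; [exact: symnonneg_step|exact: eta_step_ge0].
- by apply/measurable_EFinP; apply: mhsol; exact: sW'.
Qed.

(** The head coordinate of the solution is h^-1 (e + r y), with y the solution of
the eliminated system, so its integral is a combination of integrals of y. *)
Let Fl (x : R) :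
  \int[@lebesgue_tuple R n]_t (hsol (hmx W1 [tuple of x :: t]) e1 (lshift n 0%R))%:E
  = if (0 < h x)%R then (C x)%:E * ((e / h x)%:E * (hmass (v' x))%:E
      + \sum_j (r 0%R j / h x)%:E * J x j) else 0.
Proof.
have [h0|h0] := boolP (0 < h x)%R; last first.
  rewrite -[RHS](integral0 (@lebesgue_tuple R n) setT).
  by apply: eq_integral => t _; rewrite hsol_step_lshift (negbTE h0).
have s0 j t : (0 <= hsol (hmx (W' x) t) (v' x) j)%R.
  by apply: hsol_ge0; [exact: symnonneg_step|exact: eta_step_ge0].
have ms j : measurable_fun setT (fun t : Rn n => hsol (hmx (W' x) t) (v' x) j).
  by apply: mhsol; exact: sW'.
have md : measurable_fun setT (fun t : Rn n => hdens (hmx (W' x) t) (v' x)).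
  by apply: measurable_hdens_hmx; exact: sW'.
have rh j : (0 <= r 0%R j / h x)%R by rewrite divr_ge0// ltW.
have eh : (0 <= e / h x)%R by rewrite divr_ge0// ltW.
under eq_integral do rewrite hsol_step_lshift h0 EFinM.
rewrite ge0_integralZl_EFin//; last 2 first.
- move=> t _; rewrite lee_fin; apply: addr_ge0.
    by apply: mulr_ge0; last exact: hdens_ge0.
  by apply: sumr_ge0 => j _; exact: mulr_ge0.
- apply/measurable_EFinP; apply: measurable_funD; first exact: measurable_funM.
  by apply: measurable_sum => j; exact: measurable_funM.
congr (_ * _); under eq_integral do rewrite EFinD -sumEFin.
rewrite ge0_integralD//; last 4 first.
- by move=> t _; rewrite lee_fin mulr_ge0// hdens_ge0.
- by apply/measurable_EFinP; exact: measurable_funM.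
- by move=> t _; apply: sume_ge0 => j _; rewrite lee_fin mulr_ge0.
- by apply: emeasurable_sum => j; apply/measurable_EFinP; exact: measurable_funM.
rewrite ge0_integral_sum//; last 2 first.
- by move=> j; apply/measurable_EFinP; exact: measurable_funM.
- by move=> j t _; rewrite lee_fin mulr_ge0.
congr (_ + _).
  under eq_integral do rewrite EFinM.
  rewrite ge0_integralZl_EFin//; last 2 first.
  - by move=> t _; rewrite lee_fin hdens_ge0.
  - exact/measurable_EFinP.
  by rewrite IH0.
apply: eq_bigr => j _; under eq_integral do rewrite EFinM.
rewrite ge0_integralZl_EFin//; last exact/measurable_EFinP.
by move=> t _; rewrite lee_fin.
Qed.

Let sum_r (x : R) : (e / h x + \sum_j r 0 j / h x = (a + e) / h x)%R.
Proof. by rewrite -mulr_suml -mulrDl addrC. Qed.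

Let Fl_le x : (0 < h x)%R -> (e / h x)%:E * (hmass (v' x))%:E
      + \sum_j (r 0%R j / h x)%:E * J x j <= ((a + e) / h x)%:E * (hmass (v' x))%:E.
Proof.
move=> h0; rewrite -sum_r EFinD muleDl//.
apply: leeD => //; rewrite -sumEFin ge0_sume_distrl.
  by apply: lee_sum => j _; rewrite lee_wpmul2l ?IH1// lee_fin divr_ge0// ltW.
by move=> j _; rewrite lee_fin divr_ge0// ltW.
Qed.

Let Fl_eq x : (0 < h x)%R -> (forall k, J x k = (hmass (v' x))%:E) ->
  (e / h x)%:E * (hmass (v' x))%:E
      + \sum_j (r 0%R j / h x)%:E * J x j = ((a + e) / h x)%:E * (hmass (v' x))%:E.
Proof.
move=> h0 JE; under eq_bigr do rewrite JE.
rewrite -sum_r EFinD muleDl// -sumEFin ge0_sume_distrl//.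
by move=> j _; rewrite lee_fin divr_ge0// ltW.
Qed.

Let integral_K : \int[lebesgue_measure]_x
  (K%:E * (if (0 < h x)%R then pivot_kernel (h x) (a + e) else 0%R)%:E)
  = (hmass e1)%:E.
Proof.
rewrite ge0_integralZl_EFin//.
by rewrite integral_pivot_kernel ?addr_ge0// -EFinM KE hmassE.
Qed.

Let integral_K' : (0 < a + e)%R -> \int[lebesgue_measure]_x
  (K%:E * (if (0 < h x)%R then (a + e) / h x * pivot_kernel (h x) (a + e)
    else 0)%R%:E) = (hmass e1)%:E.
Proof.
move=> ae; rewrite ge0_integralZl_EFin//.
by rewrite integral_pivot_kernel_div// -EFinM KE hmassE.
Qed.

Let hmass_ge0 m (eta : 'cV[R]_m) : (0 <= hmass eta)%R.
Proof. by rewrite mulr_ge0 ?exprn_ge0 ?expR_ge0. Qed.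

Let integral_K'_le : \int[lebesgue_measure]_x
  (K%:E * (if (0 < h x)%R then (a + e) / h x * pivot_kernel (h x) (a + e)
    else 0)%R%:E) <= (hmass e1)%:E.
Proof.
have [ae|ae] := ltP 0%R (a + e)%R; first by rewrite integral_K'.
have -> : (a + e = 0)%R by apply/eqP; rewrite eq_le ae addr_ge0.
under eq_integral => x _.
  rewrite (_ : (if _ then _ else _)%R = 0%R) ?mule0; last first.
    by case: ifP => // _; rewrite !mul0r.
  over.
by rewrite integral0 lee_fin.
Qed.

Hypothesis w0 : (0 <= w)%R.

Let f_ge0 k (t : Rn n.+1) : (0 <= hsol (hmx W1 t) e1 k)%R.
Proof. by apply: hsol_ge0 => //; exact: W1_ge0. Qed.

Lemma integral_hsol_step_le k :
  \int[@lebesgue_tuple R n.+1]_t (hsol (hmx W1 t) e1 k)%:E <= (hmass e1)%:E.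
Proof.
have mF := @measurable_integral_lebesgue_tupleS _ _ (mhsol e1 k sW1) (f_ge0 k).
rewrite integral_lebesgue_tupleS//; last exact: (mhsol e1 k sW1).
case: (split_ordP k) mF => {}k -> mF.
- rewrite ord1 in mF *; apply: le_trans integral_K'_le.
  apply: ge0_le_integral => //.
  + by move=> x _; apply: integral_ge0 => t _; rewrite lee_fin.
  + exact: measurable_funeM.
  move=> x _; rewrite Fl; case: (boolP (0 < h x)%R) => h0; last by rewrite mule0.
  apply: (@le_trans _ _ ((C x)%:E * (((a + e) / h x)%:E * (hmass (v' x))%:E))).
    by rewrite lee_wpmul2l ?lee_fin// Fl_le.
  by rewrite -!EFinM mulrCA hmass_step// -/K mulrCA.
rewrite -integral_K; apply: ge0_le_integral => //.
+ by move=> x _; apply: integral_ge0 => t _; rewrite lee_fin.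
+ exact: measurable_funeM.
move=> x _; rewrite Fr; case: (boolP (0 < h x)%R) => h0; last by rewrite mule0.
apply: (@le_trans _ _ ((C x)%:E * (hmass (v' x))%:E)).
  by rewrite lee_wpmul2l ?lee_fin// IH1.
by rewrite -!EFinM hmass_step.
Qed.

Lemma integral_hsol_step_eq k : (0 < e)%R ->
  (forall x k, (0 < h x)%R ->
    \int[@lebesgue_tuple R n]_t (hsol (hmx (W' x) t) (v' x) k)%:E
    = (hmass (v' x))%:E) ->
  \int[@lebesgue_tuple R n.+1]_t (hsol (hmx W1 t) e1 k)%:E = (hmass e1)%:E.
Proof.
move=> e_gt0 JE.
rewrite integral_lebesgue_tupleS//; last exact: (mhsol e1 k sW1).
case: (split_ordP k) => {}k ->.
- rewrite ord1 -integral_K' ?ltr_wpDl//.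
  apply: eq_integral => x _; rewrite Fl.
  case: (boolP (0 < h x)%R) => h0; last by rewrite mule0.
  rewrite Fl_eq//; last by move=> j; exact: JE.
  by rewrite -!EFinM mulrCA hmass_step// -/K mulrCA.
rewrite -integral_K; apply: eq_integral => x _; rewrite Fr.
case: (boolP (0 < h x)%R) => h0; last by rewrite mule0.
by rewrite /J JE// -!EFinM hmass_step.
Qed.

End step.

(** The equality for the solution fails when eta vanishes, for instance at
eta = 0, where A^-1 eta = 0; only the inequality survives for eta >= 0. *)
Theorem hdens_integral n (W : 'M[R]_n) (eta : 'cV[R]_n) :
  symnonneg W -> (forall i, 0 <= eta i 0)%R ->
  [/\ \int[@lebesgue_tuple R n]_t (hdens (hmx W t) eta)%:E = (hmass eta)%:E,
    forall k, \int[@lebesgue_tuple R n]_t (hsol (hmx W t) eta k)%:E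
      <= (hmass eta)%:E
  & (forall i, 0 < eta i 0)%R -> forall k,
    \int[@lebesgue_tuple R n]_t (hsol (hmx W t) eta k)%:E = (hmass eta)%:E].
Proof.
elim: n W eta => [|n IHn] W eta snW e0.
  split=> [|[]//|_ []//].
  rewrite integral_dirac//=; last first.
    by apply/measurable_EFinP; apply: measurable_hdens_hmx; case: snW.
  rewrite diracT mul1e /hmass big_ord0 oppr0 expr0 mul1r /hdens asboolT; last first.
    by move=> x; rewrite flatmx0 eqxx.
  by rewrite det_mx00 sqrtr1 divr1 /qform !flatmx0 !mulmx0 mxE addr0 oppr0 mul0r.
move: W eta snW e0; rewrite -[n.+1]/(1 + n)%N => W eta.
rewrite -(submxK W) -(vsubmxK eta).
move: (ulsubmx W) (ursubmx W) (dlsubmx W) (drsubmx W) => {W} w r r' W.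
move: (usubmx eta) (dsubmx eta) => {eta} e v.
rewrite [w]mx11_scalar [e]mx11_scalar; move: (w 0 0)%R (e 0 0)%R => {w e} w e.
move=> [sW W0] e0.
have [rE sWW] : r' = (r^T)%R /\ (W^T)%R = W.
  by move: sW; rewrite tr_block_mx => /eq_block_mx[_ _ <- ->].
rewrite rE in sW W0 *.
have w0 : (0 <= w)%R by have := W0 (lshift n ord0) (lshift n ord0); rewrite block_mxEul mxE eqxx.
have r0 j : (0 <= r 0 j)%R by have := W0 (lshift n ord0) (rshift 1 j); rewrite block_mxEur.
have snW : symnonneg W.
  by split=> // i j; have := W0 (rshift 1 i) (rshift 1 j); rewrite block_mxEdr.
have v0 i : (0 <= v i 0)%R by have := e0 (rshift 1 i); rewrite col_mxEd.
have ee0 : (0 <= e)%R by have := e0 (lshift n ord0); rewrite col_mxEu mxE eqxx.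
have IH (x : R) : (0 < 2 * x - w)%R -> _ := fun h0 =>
  IHn _ _ (symnonneg_step snW r0 h0) (eta_step_ge0 r0 ee0 v0 h0).
split.
- by apply: integral_hdens_step => // x /IH[].
- by apply: integral_hsol_step_le => // x; [|move=> k] => /IH[].
move=> e_gt0 k; apply: integral_hsol_step_eq => //.
- by move=> x /IH[].
- by have := e_gt0 (lshift n ord0); rewrite col_mxEu mxE eqxx mulr1n.
- move=> x k' h0; have [_ _] := IH _ h0; apply=> i.
  rewrite mxE; apply: ltr_pwDl.
    by have := e_gt0 (rshift 1 i); rewrite col_mxEd.
  by rewrite !mxE; apply: mulr_ge0 => //; apply: divr_ge0 => //; exact: ltW.
Qed.

End normalisation.

End hmx.

(** * Uniqueness of Laplace transforms *)
Section step_polynomials.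
Context {R : realType}.

Lemma bernoulli_ineq (y : R) n : -1 <= y -> 1 + n%:R * y <= (1 + y) ^+ n.
Proof.
move=> y1; elim: n => [|n IHn]; first by rewrite mul0r addr0 expr0.
rewrite exprSr; apply: le_trans (_ : (1 + n%:R * y) * (1 + y) <= _).
  have -> : (1 + n%:R * y) * (1 + y) = 1 + n.+1%:R * y + n%:R * y ^+ 2.
    by rewrite -natr1; ring.
  by rewrite lerDl mulr_ge0// sqr_ge0.
by rewrite ler_wpM2r// -lerBlDl sub0r.
Qed.

Lemma cvg_natM_geometric (z : R) : 0 < z < 1 ->
  (fun n => n%:R * z ^+ n) @ \oo --> (0 : R).
Proof.
move=> /andP[z0 z1]; pose w := Num.sqrt z.
have w0 : 0 < w by rewrite sqrtr_gt0.
have w1 : w < 1 by rewrite -sqrtr1 ltr_sqrt.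
have ww : w ^+ 2 = z by rewrite sqr_sqrtr// ltW.
pose del := w^-1 - 1.
have del0 : 0 < del by rewrite subr_gt0 invf_gt1.
have gw : (fun n => del^-1 * w ^+ n) @ \oo --> (0 : R).
  by apply: cvg_geometric; rewrite gtr0_norm.
apply: (squeeze_cvgr _ (cvg_cst 0) gw); near=> n.
rewrite mulr_ge0 ?exprn_ge0 ?(ltW z0)//= -ww exprAC [w ^+ n ^+ 2]expr2 mulrA.
rewrite ler_wpM2r ?exprn_ge0 ?(ltW w0)// -[leRHS]mul1r ler_pdivlMr//.
have wn0 : 0 < w ^+ n by rewrite exprn_gt0.
have : n%:R * del <= (w ^+ n)^-1.
  apply: le_trans (_ : 1 + n%:R * del <= _); first by rewrite lerDr.
  rewrite -exprVn (_ : w^-1 = 1 + del); last by rewrite /del addrC subrK.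
  by apply: bernoulli_ineq; rewrite (le_trans _ (ltW del0))// lerN10.
rewrite -(ler_pM2r wn0) mulVf ?gt_eqF//.
by rewrite mulrAC.
Unshelve. all: by end_near. Qed.

(** By the Bernoulli inequality the value at x in ]0, 1] is at least
1 - n (2 x)^n, which tends to 1 if x < 1/2, and at most 1 / (n (2 x)^n), which
tends to 0 if x >= 1/2. *)
Definition step_poly n : {poly R} := (1 - 'X^n) ^+ (n * 2 ^ n).

Lemma horner_step_poly n (x : R) : (step_poly n).[x] = (1 - x ^+ n) ^+ (n * 2 ^ n).
Proof. by rewrite /step_poly !hornerE. Qed.

Lemma step_poly_bounds n (x : R) : 0 < x <= 1 -> 0 <= (step_poly n).[x] <= 1.
Proof.
move=> /andP[x0 x1]; have xn1 : x ^+ n <= 1 by rewrite exprn_ile1// ltW.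
have xn0 : 0 <= x ^+ n by rewrite exprn_ge0// ltW.
rewrite horner_step_poly exprn_ge0 ?subr_ge0//=.
by rewrite exprn_ile1// ?subr_ge0// lerBlDl lerDr.
Qed.

Lemma cvg_step_poly (x : R) : 0 < x <= 1 ->
  (step_poly n).[x] @[n --> \oo] --> ((x < 2^-1)%R%:R : R).
Proof.
move=> x01; have /andP[x0 x1] := x01.
have xn1 n : x ^+ n <= 1 by rewrite exprn_ile1// ltW.
have xn0 n : 0 <= x ^+ n by rewrite exprn_ge0// ltW.
have [x2|x2] := ltP x 2^-1.
  have z1 : 0 < 2 * x < 1.
    by rewrite mulr_gt0//= mulrC -ltr_pdivlMr// mul1r.
  have h : (fun n => 1 - n%:R * (2 * x) ^+ n) @ \oo --> (1 - 0 : R).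
    by apply: cvgB; [exact: cvg_cst|exact: cvg_natM_geometric].
  suff : (step_poly n).[x] @[n --> \oo] --> (1 : R) by [].
  rewrite subr0 in h. apply: (squeeze_cvgr _ h (cvg_cst (1 : R))); near=> n.
  have /andP[_ ->] := step_poly_bounds n x01; rewrite andbT horner_step_poly.
  apply: le_trans (bernoulli_ineq _ _); last by rewrite lerN2.
  by rewrite mulrN natrM natrX exprMn mulrA.
suff : (step_poly n).[x] @[n --> \oo] --> (0 : R) by [].
apply: (squeeze_cvgr _ (cvg_cst 0) cvg_harmonic); near=> n.
have /andP[-> _] := step_poly_bounds n x01; rewrite /= horner_step_poly /harmonic/=.
set N := (n * 2 ^ n)%N.
rewrite -[leRHS]mul1r ler_pdivlMr//.
apply: le_trans (_ : (1 - x ^+ n) ^+ N * (1 + x ^+ n) ^+ N <= _).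
  rewrite ler_wpM2l ?exprn_ge0 ?subr_ge0//.
  apply: le_trans (bernoulli_ineq _ _); last by rewrite (le_trans _ (xn0 n))// lerN10.
  rewrite -natr1 addrC lerD2l /N natrM natrX -mulrA -[leLHS]mulr1 ler_wpM2l//.
  by rewrite -exprMn exprn_ege1// mulrC -ler_pdivrMr// mul1r.
rewrite -exprMn (_ : (1 - _) * _ = 1 - x ^+ n ^+ 2); last by ring.
apply: exprn_ile1; first by rewrite subr_ge0 exprn_ile1.
by rewrite lerBlDl lerDr exprn_ge0.
Unshelve. all: by end_near. Qed.

End step_polynomials.

Section laplace.
Local Open Scope ereal_scope.
Context d (T : measurableType d) (R : realType) (mu : {measure set T -> \bar R}).
Variables (S : T -> R).
Hypothesis mS : measurable_fun setT S.

Let mexp (l : R) : measurable_fun setT (fun t => expR (l * S t)).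
Proof. by apply: measurable_expR_comp; exact: measurable_funM. Qed.

Section one.
Variable Y : T -> R.
Hypotheses (mY : measurable_fun setT Y) (Y0 : forall t, (0 <= Y t)%R).
Hypothesis SY : forall t, (Y t != 0 -> 0 < S t)%R.
Hypothesis fY : forall l : R, (0 < l)%R ->
  \int[mu]_t (expR (- l * S t) * Y t)%:E < +oo.

Lemma laplace_integrable (l : R) : (0 < l)%R ->
  mu.-integrable setT (fun t => (expR (- l * S t) * Y t)%:E).
Proof.
move=> l0; apply/integrableP; split.
  by apply/measurable_EFinP; apply: measurable_funM => //; exact: mexp.
under eq_integral do rewrite gee0_abs ?lee_fin ?mulr_ge0 ?expR_ge0//.
exact: fY.
Qed.

Lemma laplace_poly (k : R) (p : {poly R}) : (0 < k)%R ->
  \int[mu]_t (p.[expR (- k * S t)] * (expR (- 1 * S t) * Y t))%:E =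
  \sum_(i < size p) (p`_i)%:E * \int[mu]_t (expR (- (1 + k * i%:R) * S t) * Y t)%:E.
Proof.
move=> k0.
have ki i : (0 < 1 + k * i%:R)%R by rewrite ltr_pwDl// mulr_ge0// ltW.
under eq_integral => t _.
  rewrite horner_coef mulr_suml -sumEFin.
  under eq_bigr => i _.
    rewrite -mulrA EFinM mulrA -expRM_natr -expRD.
    rewrite (_ : - k * S t * i%:R + - 1 * S t = - (1 + k * i%:R) * S t)%R; last by ring.
    over.
  over.
rewrite integral_sum//; last first.
  by move=> i; apply: integrableZl => //; exact: laplace_integrable.
by apply: eq_bigr => i _; rewrite integralZl//; exact: laplace_integrable.
Qed.

(** A polynomial in exp (- k s) is a combination of the exponentials
exp (- k i s).  With k = ln 2 / a the threshold 1/2 of the step polynomials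
becomes the threshold a for s.  The factor exp (- s) makes the weights
integrable, as required for dominated convergence. *)
Lemma laplace_ray (a : R) : (0 < a)%R ->
  \int[mu]_t ((step_poly n).[expR (- (ln 2 / a) * S t)]
       * (expR (- 1 * S t) * Y t))%:E @[n --> \oo] -->
  \int[mu]_t ((a < S t)%R%:R * (expR (- 1 * S t) * Y t))%:E.
Proof.
move=> a0; pose k : R := (ln 2 / a)%R.
have k0 : (0 < k)%R by rewrite divr_gt0// ln_gt0// ltr1n.
have mind : measurable_fun setT (fun t => (a < S t)%R%:R : R).
  rewrite (_ : (fun _ => _) = (fun t => if (a < S t)%R then 1%R else 0%R : R)).
    by apply: measurable_fun_ifT => //; exact: measurable_fun_ltr.
  by apply/funext => t; case: (a < S t)%R.
have mg : measurable_fun setT (fun t => expR (- 1 * S t) * Y t)%R.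
  by apply: measurable_funM => //; exact: mexp.
pose g t := (expR (- 1 * S t) * Y t)%R.
have g0 t : (0 <= g t)%R by rewrite mulr_ge0 ?expR_ge0.
pose x t := expR (- k * S t).
have x01 t : (Y t != 0)%R -> (0 < x t <= 1)%R.
  move=> /SY St; rewrite expR_gt0/= -expR0 ler_expR mulNr oppr_le0.
  by rewrite mulr_ge0// ltW.
have [] := @dominated_convergence _ _ _ mu setT measurableT
  (fun n t => ((step_poly n).[x t] * g t)%:E)
  (fun t => ((a < S t)%R%:R * g t)%:E) (fun t => (g t)%:E).
- move=> n; apply/measurable_EFinP; apply: measurable_funM => //.
  under eq_fun do rewrite horner_step_poly.
  apply: measurable_funX; apply: measurable_funB => //.
  by apply: measurable_funX; exact: mexp.
- by apply/measurable_EFinP; exact: measurable_funM.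
- apply/aeW => t _; apply: cvg_EFin; first exact: nearW.
  rewrite /comp/=; have [Yt|Yt] := eqVneq (Y t) 0%R.
    rewrite /g Yt !mulr0; under eq_fun do rewrite mulr0; exact: cvg_cst.
  apply: cvgM; last exact: cvg_cst.
  have -> : (a < S t)%R = (x t < 2^-1)%R.
    rewrite -[RHS]ltr_ln ?posrE ?expR_gt0 ?invr_gt0// expRK lnV ?posrE//.
    by rewrite mulNr ltrN2 /k mulrAC ltr_pdivlMr// ltr_pM2l// ln_gt0 ?ltr1n.
  exact: cvg_step_poly (x01 _ Yt).
- exact: laplace_integrable.
- apply/aeW => t n _; have [Yt|Yt] := eqVneq (Y t) 0%R.
    by rewrite /g Yt !mulr0 abse0.
  have /andP[r0 r1] := step_poly_bounds n (x01 _ Yt).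
  by rewrite /= ger0_norm ?mulr_ge0// lee_fin ler_piMl.
by [].
Qed.

End one.

Section two.
Variable Y1 Y2 : T -> R.
Hypotheses (mY1 : measurable_fun setT Y1) (Y1_ge0 : forall t, (0 <= Y1 t)%R).
Hypotheses (mY2 : measurable_fun setT Y2) (Y2_ge0 : forall t, (0 <= Y2 t)%R).
Hypothesis SY1 : forall t, (Y1 t != 0 -> 0 < S t)%R.
Hypothesis SY2 : forall t, (Y2 t != 0 -> 0 < S t)%R.
Hypothesis fY1 : forall l : R, (0 < l)%R ->
  \int[mu]_t (expR (- l * S t) * Y1 t)%:E < +oo.
Hypothesis Y12 : forall l : R, (0 < l)%R ->
  \int[mu]_t (expR (- l * S t) * Y1 t)%:E =
  \int[mu]_t (expR (- l * S t) * Y2 t)%:E.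

Let fY2 (l : R) : (0 < l)%R -> \int[mu]_t (expR (- l * S t) * Y2 t)%:E < +oo.
Proof. by move=> l0; rewrite -Y12// fY1. Qed.

Let ray_eq (a : R) : (0 < a)%R ->
  \int[mu]_t ((a < S t)%R%:R * (expR (- 1 * S t) * Y1 t))%:E =
  \int[mu]_t ((a < S t)%R%:R * (expR (- 1 * S t) * Y2 t))%:E.
Proof.
move=> a0; have k0 : (0 < ln 2 / a :> R)%R by rewrite divr_gt0// ln_gt0// ltr1n.
have := laplace_ray mY1 Y1_ge0 SY1 fY1 a0.
rewrite (_ : (fun n => _) = (fun n => \int[mu]_t
    ((step_poly n).[expR (- (ln 2 / a) * S t)]
       * (expR (- 1 * S t) * Y2 t))%:E)).
  by move=> h; apply: (cvg_unique _ h (laplace_ray mY2 Y2_ge0 SY2 fY2 a0)).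
apply/funext => n; rewrite !laplace_poly//; apply: eq_bigr => i _; congr (_ * _).
by apply: Y12; rewrite ltr_pwDl// mulr_ge0// ltW.
Qed.

Let g1 t := (expR (- 1 * S t) * Y1 t)%R.
Let g2 t := (expR (- 1 * S t) * Y2 t)%R.

Let mg1 : measurable_fun setT g1.
Proof. by apply: measurable_funM => //; exact: mexp. Qed.
Let mg2 : measurable_fun setT g2.
Proof. by apply: measurable_funM => //; exact: mexp. Qed.
Let g1_ge0 t : (0 <= g1 t)%R. Proof. by rewrite mulr_ge0 ?expR_ge0. Qed.
Let g2_ge0 t : (0 <= g2 t)%R. Proof. by rewrite mulr_ge0 ?expR_ge0. Qed.

Let ray_measure (m : {measure set (measurableTypeR R) -> \bar R}) (g Y : T -> R) :
  (forall t, g t = expR (- 1 * S t) * Y t)%R ->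
  (forall t, (Y t != 0 -> 0 < S t)%R) ->
  (forall A, measurable A -> m A = \int[mu]_(t in S @^-1` A) (g t)%:E) ->
  forall a, m `]a, +oo[%classic = if (0 < a)%R then
    \int[mu]_t ((a < S t)%R%:R * g t)%:E else \int[mu]_t (g t)%:E.
Proof.
move=> gE SY mE a; rewrite mE// integral_mkcond.
have aS t : (t \in S @^-1` `]a, +oo[) = (a < S t)%R.
  by apply/idP/idP; rewrite inE/= in_itv/= andbT.
case: ifPn => a0; apply: eq_integral => t _; rewrite patchE aS.
  by case: ifPn => _; rewrite ?mul1r ?mul0r.
case: ifPn => // aSt; congr (_%:E).
rewrite gE; have [->|/SY St] := eqVneq (Y t) 0%R; first by rewrite mulr0.
by move: aSt; rewrite (le_lt_trans _ St)// leNgt.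
Qed.

(** The images under S of the measures of density exp (- S) Y1 and exp (- S) Y2 are
finite and agree on the rays ]a, +oo[, hence everywhere. *)
Theorem laplace_determines (f : R -> \bar R) :
  measurable_fun setT f -> (forall y, 0 <= f y) ->
  \int[mu]_t (f (S t) * (Y1 t)%:E) = \int[mu]_t (f (S t) * (Y2 t)%:E).
Proof.
move=> mf f0.
have [m1 m1E] := @density_image_measure _ _ T (measurableTypeR R) R mu S g1 mS mg1 g1_ge0.
have [m2 m2E] := @density_image_measure _ _ T (measurableTypeR R) R mu S g2 mS mg2 g2_ge0.
have m12 (A : set (measurableTypeR R)) : measurable A -> m1 A = m2 A.
  move=> mA; pose GG : set (set (measurableTypeR R)) := @RGenOInfty.G R.
  pose gg k : set (measurableTypeR R) := `](- k%:R)%R, +oo[%classic.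
  apply: (@measure_unique _ R (measurableTypeR R) GG gg).
  - exact: RGenOInfty.measurableE.
  - move=> _ _ [x ->] [y ->]; exists (Num.max x y).
    by apply/seteqP; split=> z /=; rewrite !in_itv/= !andbT gt_max => /andP.
  - by move=> i; eexists.
  - apply/seteqP; split=> // z _; exists (Num.truncn `|z|).+1 => //=.
    rewrite /gg/= in_itv/= andbT ltrNl; apply: le_lt_trans (truncnS_gt _).
    by rewrite -normrN ler_norm.
  - move=> _ [a ->]; rewrite (ray_measure _ SY1 m1E)// (ray_measure _ SY2 m2E)//.
    by case: ifPn => a0; [exact: ray_eq|exact: Y12].
  - move=> k; rewrite (ray_measure _ SY1 m1E)// oppr_gt0 ltrn0; exact: fY1.
  exact: mA.
pose h (y : R) := f y * (expR y)%:E.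
have mh : measurable_fun setT h.
  by apply: emeasurable_funM => //; apply/measurable_EFinP.
have h0 y : 0 <= h y by rewrite mule_ge0 ?lee_fin ?expR_ge0.
have hE (Y : T -> R) t : f (S t) * (Y t)%:E = h (S t) * (expR (- 1 * S t) * Y t)%:E.
  rewrite /h -muleA -EFinM mulrA -expRD mulN1r subrr expR0 mul1r//.
have hI (Y : T -> R) : \int[mu]_t (f (S t) * (Y t)%:E) =
    \int[mu]_t (h (S t) * (expR (- 1 * S t) * Y t)%:E).
  by apply: eq_integral => t _; exact: hE.
rewrite !hI.
rewrite -(@integral_transfer _ _ T (measurableTypeR R) R mu m1 S g1 mS mg1 g1_ge0 m1E h mh h0).
rewrite -(@integral_transfer _ _ T (measurableTypeR R) R mu m2 S g2 mS mg2 g2_ge0 m2E h mh h0).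
by apply: eq_measure_integral => A mA _; exact: m12.
Qed.

End two.

End laplace.

(** * Exchangeability of the Green ratios inside a block *)
Section exchange.
Context {R : realType}.
Local Notation Rn n := (n.-tuple (measurableTypeR R)).

Lemma qformZ n (A : 'M[R]_n) c x : qform A (c *: x) = c ^+ 2 * qform A x.
Proof.
by rewrite /qform [(c *: x)^T]linearZ/= -!scalemxAl -scalemxAr !mxE; ring.
Qed.

Lemma qformN n (A : 'M[R]_n) x : qform A (- x) = qform A x.
Proof. by rewrite -scaleN1r qformZ sqrrN expr1n mul1r. Qed.

(** A linear term proportional to the all-ones vector is an exponential in
[total_green]: this is how Laplace transforms enter. *)
Lemma hdens_scale n (A : 'M[R]_n) c x :
  hdens A (c *: x) = expR (- (c ^+ 2 / 2) * qform (invmx A) x) * hdens A 0.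
Proof.
rewrite /hdens; case: ifP => // _; last by rewrite mulr0.
rewrite qformZ qform0 addr0 mulrA -expRD; congr (expR _ / _).
by field.
Qed.

Definition total_green n (A : 'M[R]_n) : R := qform (invmx A) (const_mx 1).

Definition row_green n (A : 'M[R]_n) k : R :=
  (invmx A *m (const_mx 1 : 'cV_n)) k 0 * hdens A 0.

Lemma measurable_hmx_inv n (W : 'M[R]_n) :
  measurable_mx (fun t : Rn n => invmx (hmx W t)).
Proof. by apply: measurable_invmx; exact: measurable_hmx. Qed.

Lemma measurable_total_green n (W : 'M[R]_n) :
  measurable_fun setT (fun t : Rn n => total_green (hmx W t)).
Proof. by apply: measurable_qform => //; exact: measurable_hmx_inv. Qed.

Lemma row_green_ge0 n (W : 'M[R]_n) t k : symnonneg W ->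
  0 <= row_green (hmx W t) k.
Proof.
move=> [_ W0]; rewrite /row_green /hdens; case: ifPn => [/asboolP pA|_].
  rewrite mulr_ge0 ?divr_ge0 ?expR_ge0 ?sqrtr_ge0//.
  by apply: invmx_ge0 => //; [exact: offdiag_hmx|move=> i; rewrite mxE].
by rewrite mulr0.
Qed.

Lemma measurable_row_green n (W : 'M[R]_n) k : W^T = W ->
  measurable_fun setT (fun t : Rn n => row_green (hmx W t) k).
Proof.
move=> sW; apply: measurable_funM.
  by apply: measurable_mulmx => //; exact: measurable_hmx_inv.
apply: measurable_hdens => //; last exact: measurable_hmx.
by move=> t; exact: tr_hmx.
Qed.

Local Open Scope ereal_scope.

Lemma row_green_laplace n (W : 'M[R]_n) k (l : R) : symnonneg W -> (0 < l)%R ->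
  \int[@lebesgue_tuple R n]_t
    (expR (- l * total_green (hmx W t)) * row_green (hmx W t) k)%:E
  = ((Num.sqrt (2 * l))^-1 * hmass (Num.sqrt (2 * l) *: const_mx 1 : 'cV[R]_n))%:E.
Proof.
move=> snW l0; set c := Num.sqrt (2 * l).
have c0 : (0 < c)%R by rewrite sqrtr_gt0 mulr_gt0.
have e0 i : (0 < (c *: const_mx 1 : 'cV[R]_n) i 0)%R by rewrite !mxE mulr1.
have [_ _ /(_ e0 k) hE] := hdens_integral snW (fun i => ltW (e0 i)).
transitivity (\int[@lebesgue_tuple R n]_t
    ((c^-1)%:E * (hsol (hmx W t) (c *: const_mx 1) k)%:E)).
  apply: eq_integral => t _; rewrite -EFinM /hsol /row_green hdens_scale.
  rewrite (_ : c ^+ 2 / 2 = l)%R; last first.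
    by rewrite sqr_sqrtr ?mulr_ge0 ?ltW//; field.
  rewrite -[invmx _ *m (c *: _)]scalemxAr [in RHS]mxE /total_green.
  by congr (_%:E); field; rewrite gt_eqF.
rewrite ge0_integralZl_EFin//.
- by rewrite hE.
- by move=> t _; rewrite lee_fin hsol_ge0// => i; exact/ltW.
- apply/measurable_EFinP; apply: measurable_hsol => //; last exact: measurable_hmx.
  by move=> t; apply: tr_hmx; case: snW.
- by rewrite invr_ge0 ltW.
Qed.

(** The Laplace transforms in [total_green] of the weights [row_green _ k] do not
depend on k, by [row_green_laplace]. *)
Theorem row_green_exchange n (W : 'M[R]_n) k l (f : R -> \bar R) :
  symnonneg W -> measurable_fun setT f -> (forall y, 0 <= f y) ->
  \int[@lebesgue_tuple R n]_t
    (f (total_green (hmx W t)) * (row_green (hmx W t) k)%:E) =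
  \int[@lebesgue_tuple R n]_t
    (f (total_green (hmx W t)) * (row_green (hmx W t) l)%:E).
Proof.
move=> snW mf f0; have [sW _] := snW.
have pos (i : 'I_n) t : (row_green (hmx W t) i != 0 -> 0 < total_green (hmx W t))%R.
  rewrite /row_green /hdens; case: ifPn => [/asboolP pA _|_]; last by rewrite mulr0 eqxx.
  have uA := posdefmx_unit pA.
  rewrite /total_green qform_invV ?tr_hmx//; apply: pA.
  apply/eqP => /(congr1 (mulmx (hmx W t))); rewrite mulKVmx// mulmx0.
  by move=> /matrixP/(_ i ord0) /eqP; rewrite !mxE oner_eq0.
apply: laplace_determines => //.
- exact: measurable_total_green.
- exact: measurable_row_green.
- by move=> t; exact: row_green_ge0.
- exact: measurable_row_green.
- by move=> t; exact: row_green_ge0.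
- exact: pos.
- exact: pos.
- by move=> l0 l0_gt0; rewrite row_green_laplace// ltry.
- by move=> l0 l0_gt0; rewrite !row_green_laplace.
Qed.

Definition green_ratio n (W : 'M[R]_n) (c : n.-tuple R) (j i : 'I_n) : R :=
  (invmx (hmx W c) i j / invmx (hmx W c) j j)%R.

Lemma invmx_col n (A : 'M[R]_n) i j : (A i j = (A *m (delta_mx j ord0 : 'cV_n)) i 0)%R.
Proof. by rewrite -colE mxE. Qed.

Lemma green_ratio_ge0 n (W : 'M[R]_n) c j i : symnonneg W ->
  posdefmx (hmx W c) -> (0 <= green_ratio W c j i)%R.
Proof.
have d0 k k' : (0 <= (delta_mx k ord0 : 'cV[R]_n) k' 0)%R by rewrite mxE ler0n.
move=> [_ W0] pM; rewrite /green_ratio divr_ge0// invmx_col;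
  by apply: invmx_ge0 => //; apply: offdiag_hmx.
Qed.

Lemma measurable_green_ratio n (W : 'M[R]_n) j i :
  measurable_fun setT (fun c : Rn n => green_ratio W c j i).
Proof. by apply: measurable_div; apply: measurable_hmx_inv. Qed.

Section split.
Variables (m p : nat) (W : 'M[R]_(m + p)).
Implicit Types (a : m.-tuple R) (b : p.-tuple R) (c : (m + p).-tuple R).
Hypothesis snW : symnonneg W.
Let sW : (W^T = W)%R. Proof. by case: snW. Qed.
Let W0 i j : (0 <= W i j)%R. Proof. by case: snW. Qed.
Let Wa := ulsubmx W.
Let N := ursubmx W.
Let Wb := drsubmx W.

Lemma hmx_cat (a : m.-tuple R) (b : p.-tuple R) :
  hmx W [tuple of a ++ b] =
  block_mx (hmx Wa a) (- N)%R ((- N)^T)%R (hmx Wb b).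
Proof.
apply/matrixP => i j; rewrite [LHS]mxE.
case: (split_ordP i) => {}i ->; case: (split_ordP j) => {}j ->.
- by rewrite block_mxEul tnth_lshift !mxE eq_lshift.
- by rewrite block_mxEur !mxE eq_lrshift sub0r.
- by rewrite block_mxEdl !mxE eq_rlshift sub0r -[in LHS]sW mxE.
- by rewrite block_mxEdr tnth_rshift !mxE eq_rshift.
Qed.

Lemma symnonneg_ul : symnonneg Wa.
Proof. by split=> [|i j]; [rewrite trmx_ulsub sW|rewrite !mxE]. Qed.

Lemma symnonneg_dr : symnonneg Wb.
Proof. by split=> [|i j]; [rewrite trmx_drsub sW|rewrite !mxE]. Qed.

Let sA a : ((hmx Wa a)^T = hmx Wa a)%R.
Proof. by apply: tr_hmx; case: symnonneg_ul. Qed.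

Let sC b : ((hmx Wb b)^T = hmx Wb b)%R.
Proof. by apply: tr_hmx; case: symnonneg_dr. Qed.

Definition split_schur (a : m.-tuple R) (b : p.-tuple R) : 'M[R]_p :=
  schur (hmx Wa a) (- N)%R (hmx Wb b).

Lemma split_schurE a b :
  split_schur a b = (hmx Wb b - N^T *m invmx (hmx Wa a) *m N)%R.
Proof. by rewrite /split_schur /schur [((- N)^T)%R]linearN/= !mulNmx mulmxN opprK. Qed.

Lemma posdefmx_split a b : posdefmx (hmx W [tuple of a ++ b]) <->
  posdefmx (hmx Wa a) /\ posdefmx (split_schur a b).
Proof. by rewrite hmx_cat; apply: posdefmx_block. Qed.

Lemma column_split a b j : posdefmx (hmx W [tuple of a ++ b]) ->
  let y := (invmx (split_schur a b) *m (delta_mx j ord0 : 'cV_p))%R in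
  (invmx (hmx W [tuple of a ++ b]) *m (delta_mx (rshift m j) ord0 : 'cV_(m + p)) =
  col_mx (invmx (hmx Wa a) *m (N *m y)) y)%R.
Proof.
move=> pM y; have [pA _] := (posdefmx_split a b).1 pM.
have -> : delta_mx (rshift m j) ord0 = col_mx 0%R (delta_mx j ord0) :> 'cV[R]_(m + p).
  apply/matrixP => i k; rewrite [LHS]mxE.
  case: (split_ordP i) => {}i ->; rewrite ?col_mxEu ?col_mxEd mxE.
    by rewrite eq_lrshift.
  by rewrite eq_rshift.
move: (posdefmx_unit pM); rewrite hmx_cat => uM.
rewrite (invmx_block (posdefmx_unit pA) uM).
by rewrite mulmx0 subr0 sub0r mulNmx opprK.
Qed.

Let mcat : measurable_fun setT
  ((fun ab : Rn m * Rn p => [tuple of ab.1 ++ ab.2]) : _ -> Rn (m + p)).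
Proof. exact: measurable_cat. Qed.

Lemma integral_lebesgue_tuple_cat (f : Rn (m + p) -> \bar R) :
  measurable_fun setT f -> (forall c, 0 <= f c) ->
  \int[@lebesgue_tuple R (m + p)]_c f c =
  \int[@lebesgue_tuple R p]_b \int[@lebesgue_tuple R m]_a f [tuple of a ++ b].
Proof.
move=> mf f0.
transitivity (\int[pushforward (@lebesgue_tuple R m \x @lebesgue_tuple R p)
    (fun ab : Rn m * Rn p => [tuple of ab.1 ++ ab.2])]_c f c).
  apply: eq_measure_integral => A mA _.
  by apply/esym; exact: (lebesgue_tuple_cat mA).
rewrite ge0_integral_pushforward//.
rewrite preimage_setT (fubini_tonelli2
  (fun ab : Rn m * Rn p => f [tuple of ab.1 ++ ab.2]))//.
exact: measurableT_comp mf mcat.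
Qed.

Lemma integral_lebesgue_tuple_cat_swap (f : Rn (m + p) -> \bar R) :
  measurable_fun setT f -> (forall c, 0 <= f c) ->
  \int[@lebesgue_tuple R (m + p)]_c f c =
  \int[@lebesgue_tuple R m]_a \int[@lebesgue_tuple R p]_b f [tuple of a ++ b].
Proof.
move=> mf f0; rewrite integral_lebesgue_tuple_cat//.
apply/esym.
apply: (fubini_tonelli (fun ab : Rn m * Rn p => f [tuple of ab.1 ++ ab.2])) => //.
exact: measurableT_comp mf mcat.
Qed.

Definition ltuple (c : (m + p).-tuple R) : m.-tuple R :=
  [tuple tnth c (lshift p i) | i < m].
Definition rtuple (c : (m + p).-tuple R) : p.-tuple R :=
  [tuple tnth c (rshift m i) | i < p].

Lemma ltuple_cat a b : ltuple [tuple of a ++ b] = a.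
Proof. by apply: eq_from_tnth => i; rewrite tnth_mktuple tnth_lshift. Qed.

Lemma rtuple_cat a b : rtuple [tuple of a ++ b] = b.
Proof. by apply: eq_from_tnth => i; rewrite tnth_mktuple tnth_rshift. Qed.

Lemma cat_lrtuple c : [tuple of ltuple c ++ rtuple c] = c.
Proof.
apply: eq_from_tnth => i; case: (split_ordP i) => {}i ->.
  by rewrite tnth_lshift tnth_mktuple.
by rewrite tnth_rshift tnth_mktuple.
Qed.

Lemma hmx_ltuple c : hmx Wa (ltuple c) = ulsubmx (hmx W c).
Proof.
by apply/matrixP => i k; rewrite !mxE tnth_mktuple eq_lshift.
Qed.

Lemma measurable_ltuple : measurable_fun setT (ltuple : Rn (m + p) -> Rn m).
Proof.
apply/measurable_fun_tnthP => i; rewrite (_ : _ \o _ = (fun c => tnth c (lshift p i))).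
  exact: measurable_tnth.
by apply/funext => c /=; rewrite tnth_mktuple.
Qed.

Lemma measurable_rtuple : measurable_fun setT (rtuple : Rn (m + p) -> Rn p).
Proof.
apply/measurable_fun_tnthP => i; rewrite (_ : _ \o _ = (fun c => tnth c (rshift m i))).
  exact: measurable_tnth.
by apply/funext => c /=; rewrite tnth_mktuple.
Qed.

Section indistinguishable_rows.
Variable w : 'rV[R]_p.
Hypothesis NE : (N = const_mx 1 *m w)%R.
Let s a : R := total_green (hmx Wa a).
Let z : R := (\sum_j w 0 j)%R.

(** The Schur complement of the first block when all vertices of this block have
the same weights w to the second one. *)
Definition rest (b : p.-tuple R) (s : R) : 'M[R]_p :=
  (hmx Wb b - s *: (w^T *m w))%R.

Lemma split_schur_rest a b : split_schur a b = rest b (s a).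
Proof.
rewrite split_schurE NE trmx_mul; congr (_ - _)%R.
pose o : 'cV[R]_m := const_mx 1%R.
have e : (o^T *m invmx (hmx Wa a) *m o)%R = (s a)%:M by rewrite [LHS]mx11_scalar.
transitivity (w^T *m (o^T *m invmx (hmx Wa a) *m o) *m w)%R; first by rewrite !mulmxA.
by rewrite e mul_mx_scalar -scalemxAl.
Qed.

Lemma tr_rest b x : ((rest b x)^T = rest b x)%R.
Proof.
by rewrite /rest [LHS]linearB/= sC [((_ *: _)^T)%R]linearZ/= trmx_mul trmxK.
Qed.

(** The density factors as [hdens (hmx Wa a) 0] times this function of b and
[s a]. *)
Let gfac b (x : R) : R :=
  (expR (- (2 * (- (m%:R * z)) + z ^+ 2 * x) / 2) * hdens (rest b x) 0)%R.

Let ycol b (x : R) j : 'cV[R]_p := (invmx (rest b x) *m delta_mx j ord0)%R.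

(** The factor common to the ratios of all the vertices of the first block. *)
Let cfac b (x : R) j : R := ((w *m ycol b x j) 0 0 / ycol b x j j 0)%R.

Let w1 : ((w *m (const_mx 1 : 'cV_p)) 0 0 = z)%R.
Proof. by rewrite mxE; apply: eq_bigr => i _; rewrite mxE mulr1. Qed.

Let hdens_split a b :
  (hdens (hmx W [tuple of a ++ b]) 0 = hdens (hmx Wa a) 0 * gfac b (s a))%R.
Proof.
rewrite hmx_cat -[0%R in LHS]col_mx0 hdens_block// [in RHS]/hdens.
have [pA|npA] := pselect (posdefmx (hmx Wa a)); last by rewrite !asboolF// mul0r.
rewrite !asboolT// mulmx0 subr0 -/(split_schur a b) split_schur_rest /gfac.
rewrite qform0 addr0 addr0 mulrA; congr (_ * _)%R.
have -> : (- N *m const_mx 1 = - z *: (const_mx 1 : 'cV_m))%R.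
  rewrite mulNmx NE -mulmxA [(w *m _)%R]mx11_scalar w1 mul_mx_scalar.
  by rewrite scaleNr.
rewrite qformZ -/(total_green _) -/(s a).
have -> : (((const_mx 1 : 'cV_m)^T *m - N *m (const_mx 1 : 'cV_p)) 0 0 = - (m%:R * z))%R.
  rewrite mulmxN mulNmx mxE NE !mulmxA -mulmxA [(w *m _)%R]mx11_scalar w1.
  rewrite mul_mx_scalar mxE [((_ *m _) 0 0)%R]mxE.
  under eq_bigr do rewrite !mxE mulr1.
  by rewrite sumr_const card_ord mulrC.
rewrite [RHS]mulrAC -expRD; congr (expR _ / _)%R.
by rewrite sqrrN; field.
Qed.

Let ratio_split a b j i : posdefmx (hmx W [tuple of a ++ b]) ->
  green_ratio W [tuple of a ++ b] (rshift m j) (lshift p i) =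
  ((invmx (hmx Wa a) *m (const_mx 1 : 'cV_m)) i 0 * cfac b (s a) j)%R.
Proof.
move=> pM; rewrite /green_ratio !invmx_col column_split// col_mxEu col_mxEd.
rewrite split_schur_rest -/(ycol _ _ _) NE -mulmxA.
rewrite [(w *m _)%R]mx11_scalar mul_mx_scalar -scalemxAr mxE.
by rewrite /cfac mulrCA mulrA.
Qed.

(** With b fixed, the integrand is a function of [s a] times [row_green], so
[row_green_exchange] applies under the integral over b. *)
Lemma ratio_exchange (B : set (Rn p * R)) j k l : measurable B ->
  let f i c := ((((rtuple c, total_green (hmx Wa (ltuple c))) \in B)%:R
    * `|green_ratio W c (rshift m j) (lshift p i)| * hdens (hmx W c) 0)%R%:E) in
  \int[@lebesgue_tuple R (m + p)]_c f k c = \int[@lebesgue_tuple R (m + p)]_c f l c.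
Proof.
move=> mB f.
have mrest b : measurable_mx (rest b).
  apply: measurable_addmx => //; apply: measurable_oppmx.
  exact: measurable_scalemx.
have mgfac b : measurable_fun setT (gfac b).
  apply: measurable_funM; last first.
    by apply: measurable_hdens => // t; exact: tr_rest.
  have mx : measurable_fun setT (fun x : R => 2 * (- (m%:R * z)) + z ^+ 2 * x)%R.
    by apply: measurable_funD => //; apply: measurable_funM.
  apply: measurable_expR_comp; apply: measurable_funM => //.
  exact: measurable_funN.
have mycol b : measurable_mx (fun x => ycol b x j).
  by apply: measurable_mulmx => //; exact: measurable_invmx.
have mcfac b : measurable_fun setT (fun x => cfac b x j).
  apply: measurable_div; last exact: mycol.
  exact: (measurable_mulmx (measurable_cstmx w) (mycol b)).
pose F b x : \bar R := ((((b, x) \in B)%:R * `|cfac b x j| * gfac b x)%R)%:E.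
have mB1 b : measurable_fun setT (fun x => ((b, x) \in B)%:R : R).
  rewrite (_ : (fun _ => _) = \1_[set x | B (b, x)]).
    apply: measurable_indic; rewrite (_ : [set _ | _] = xsection B b).
      exact: measurable_xsection.
    by rewrite xsectionE.
  by apply/funext => x; rewrite indicE; congr (nat_of_bool _)%:R; apply/idP/idP; rewrite !inE.
have mF b : measurable_fun setT (F b).
  apply/measurable_EFinP; apply: measurable_funM => //.
  by apply: measurable_funM => //; exact: measurableT_comp.
have F0 b x : 0 <= F b x.
  by rewrite lee_fin !mulr_ge0 ?expR_ge0 ?hdens_ge0.
have fE i a b : f i [tuple of a ++ b] = F b (s a) * (row_green (hmx Wa a) i)%:E.
  rewrite /f rtuple_cat ltuple_cat -/(s a) /F -EFinM; congr (_%:E).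
  have [pM|npM] := pselect (posdefmx (hmx W [tuple of a ++ b])).
    rewrite ratio_split// normrM hdens_split /row_green [`|_ i 0|%R]ger0_norm.
      by ring.
    have [pA _] := (posdefmx_split a b).1 pM.
    apply: invmx_ge0 => //; first by apply: offdiag_hmx; case: symnonneg_ul.
    by move=> i'; rewrite mxE.
  have h0 : (hdens (hmx Wa a) 0 * gfac b (s a) = 0)%R.
    by rewrite -hdens_split /hdens asboolF.
  rewrite hdens_split h0 mulr0 /row_green -[LHS](mulr0 (((b, s a) \in B)%:R *
    `|cfac b (s a) j| * (invmx (hmx Wa a) *m (const_mx 1 : 'cV_m)) i 0)%R).
  by rewrite -h0; ring.
have int_f i : \int[@lebesgue_tuple R (m + p)]_c f i c =
    \int[@lebesgue_tuple R p]_b \int[@lebesgue_tuple R m]_a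
       (F b (s a) * (row_green (hmx Wa a) i)%:E).
  rewrite integral_lebesgue_tuple_cat.
  - by apply: eq_integral => b _; apply: eq_integral => a _; rewrite fE.
  - apply/measurable_EFinP; apply: measurable_funM; last exact: measurable_hdens_hmx.
    apply: measurable_funM; last first.
      by apply: measurableT_comp => //; exact: measurable_green_ratio.
    have mS : measurable_fun setT (fun c : Rn (m + p) =>
        (rtuple c, total_green (hmx Wa (ltuple c)))).
      apply/measurable_fun_pairP; split; first exact: measurable_rtuple.
      exact: (measurableT_comp (measurable_total_green Wa) measurable_ltuple).
    rewrite (_ : (fun _ => _) = (\1_B : _ -> R) \o (fun c : Rn (m + p) =>
        (rtuple c, total_green (hmx Wa (ltuple c))))).
      by apply: measurableT_comp; [exact: measurable_indic|exact: mS].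
    by apply/funext => c; rewrite /= indicE.
  - by move=> c; rewrite lee_fin !mulr_ge0 ?hdens_ge0.
rewrite !int_f; apply: eq_integral => b _.
by apply: row_green_exchange => //; exact: symnonneg_ul.
Qed.

Lemma measurable_rest d (T : measurableType d) (b : T -> Rn p) (x : T -> R) :
  measurable_fun setT b -> measurable_fun setT x ->
  measurable_mx (fun t => rest (b t) (x t)).
Proof.
move=> mb mx; apply: measurable_addmx.
  by move=> i k; apply: (measurableT_comp (measurable_hmx Wb i k) mb).
by apply: measurable_oppmx; exact: measurable_scalemx.
Qed.

(** The linear system that determines the ratios to the vertex j: the row of j,
the only one containing the potential at j, is replaced by the equation that
sets the value at j to 1. *)
Definition pinned_mx b (x : R) j : 'M[R]_p :=
  (\matrix_(i, k) if i == j then (k == j)%:R else rest b x i k)%R.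

Definition pinned_col b (x : R) j : 'cV[R]_p :=
  (invmx (pinned_mx b x j) *m delta_mx j ord0)%R.

Lemma pinned_mxE b x j (v : 'cV[R]_p) i : ((pinned_mx b x j *m v) i 0 =
  if i == j then v j 0 else (rest b x *m v) i 0)%R.
Proof.
rewrite mxE; case: ifPn => [/eqP ->|ij].
  rewrite (bigD1 j)//= big1 ?addr0 => [|k kj]; rewrite !mxE eqxx ?eqxx ?mul1r//.
  by rewrite (negbTE kj) mul0r.
by rewrite [RHS]mxE; apply: eq_bigr => k _; rewrite mxE (negbTE ij).
Qed.

(** A vector of the kernel vanishes at j and is annihilated by the other rows of
[rest], so it has zero energy. *)
Lemma pinned_mx_unit b x j : posdefmx (rest b x) -> pinned_mx b x j \in unitmx.
Proof.
move=> pr; apply: unitmx_ker => v Mv; apply: (posdefmx_ker pr).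
rewrite /qform -mulmxA mxE big1// => i _; rewrite mxE.
have := pinned_mxE b x j v i; rewrite Mv mxE.
by case: eqVneq => [->|_] <-; rewrite ?mul0r ?mulr0.
Qed.

Lemma green_ratio_pinned a b j k : posdefmx (hmx W [tuple of a ++ b]) ->
  green_ratio W [tuple of a ++ b] (rshift m j) (rshift m k) = pinned_col b (s a) j k ord0.
Proof.
move=> pM; have [_ pS] := (posdefmx_split a b).1 pM.
have gE i : green_ratio W [tuple of a ++ b] (rshift m j) (rshift m i) =
    (ycol b (s a) j i 0 / ycol b (s a) j j 0)%R.
  rewrite /green_ratio !invmx_col column_split// !col_mxEd.
  by rewrite split_schur_rest.
rewrite split_schur_rest in pS; have uS := posdefmx_unit pS.
have y0 : (ycol b (s a) j j 0 != 0)%R.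
  have -> : (ycol b (s a) j j 0 = qform (invmx (rest b (s a))) (delta_mx j ord0))%R.
    by rewrite /qform -mulmxA trmx_delta -rowE [RHS]mxE.
  rewrite qform_invV ?tr_rest// gt_eqF//; apply: pS.
  apply/eqP => /(congr1 (mulmx (rest b (s a)))); rewrite mulKVmx// mulmx0.
  by move=> /matrixP/(_ j ord0) /eqP; rewrite !mxE !eqxx oner_eq0.
pose v : 'cV[R]_p := ((ycol b (s a) j j 0)^-1 *: ycol b (s a) j)%R.
have -> : pinned_col b (s a) j = v.
  apply: (can_inj (mulKmx (pinned_mx_unit j pS))).
  rewrite mulKVmx ?pinned_mx_unit//.
  apply/matrixP => i l; rewrite !ord1 pinned_mxE mxE eqxx andbT.
  case: eqVneq => [_|ij]; first by rewrite mxE mulVf.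
  rewrite -scalemxAr /ycol mulKVmx// [RHS]mxE.
  by rewrite [delta_mx _ _ _ _]mxE (negbTE ij) mulr0.
by rewrite gE [RHS]mxE mulrC.
Qed.

(** The coordinates of A^-1 1 sum to <1, A^-1 1>. *)
Lemma sum_green_ratio a b j : posdefmx (hmx W [tuple of a ++ b]) ->
  (\sum_i green_ratio W [tuple of a ++ b] (rshift m j) (lshift p i) =
   s a * (w *m pinned_col b (s a) j) 0 0)%R.
Proof.
move=> pM; rewrite [((w *m _) 0 0)%R]mxE.
have -> : (\sum_k w 0 k * pinned_col b (s a) j k 0 = cfac b (s a) j)%R.
  rewrite /cfac mxE mulr_suml; apply: eq_bigr => k _.
  rewrite -green_ratio_pinned// /green_ratio !invmx_col column_split// !col_mxEd.
  by rewrite split_schur_rest mulrA.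
under eq_bigr do rewrite ratio_split//.
rewrite -mulr_suml; congr (_ * _)%R; rewrite /s /total_green /qform -mulmxA mxE.
by apply: eq_bigr => i _; rewrite !mxE mul1r.
Qed.

Lemma invmx_dr a b j : posdefmx (hmx W [tuple of a ++ b]) ->
  (invmx (hmx W [tuple of a ++ b]) (rshift m j) (rshift m j) =
   invmx (rest b (s a)) j j)%R.
Proof.
move=> pM; rewrite [LHS]invmx_col column_split// col_mxEd split_schur_rest.
by rewrite [RHS]invmx_col.
Qed.

End indistinguishable_rows.

End split.

Section pinned_vertex.
Variables (m : nat) (W : 'M[R]_(m + 1)).
Hypothesis snW : symnonneg W.
Let Wa := ulsubmx W.
Let N := ursubmx W.
Let Wb := drsubmx W.
Let snA : symnonneg Wa. Proof. exact: symnonneg_ul. Qed.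
Let snB : symnonneg Wb. Proof. exact: symnonneg_dr. Qed.
Let N0 i j : (0 <= N i j)%R. Proof. by rewrite !mxE; case: snW. Qed.
Let o : 'cV[R]_1 := const_mx 1%R.
Let o1 : o = 1%:M%R.
Proof. by apply/matrixP => i j; rewrite !mxE !ord1 eqxx. Qed.

(** For a pinned block reduced to one vertex the ratio is (A^-1 N)_i, and the
integral of the density over the potential of that vertex, once the factor of
the first block is taken out, is the same for all a; what is left
is the integral of [hsol] with linear term N. *)
Lemma integral_green_ratio_lty (i : 'I_m) :
  \int[@lebesgue_tuple R (m + 1)]_c
    (`|green_ratio W c (rshift m ord0) (lshift 1 i)| * hdens (hmx W c) 0)%:E < +oo.
Proof.
pose E : R := expR (\sum_i N i 0).
have fE (a : Rn m) (b : Rn 1) :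
    (`|green_ratio W [tuple of a ++ b] (rshift m ord0) (lshift 1 i)|
     * hdens (hmx W [tuple of a ++ b]) 0 =
     E * hsol (hmx Wa a) N i * hdens (split_schur W a b) 0)%R.
  have dE : (hdens (hmx W [tuple of a ++ b]) 0 =
      E * hdens (hmx Wa a) N * hdens (split_schur W a b) 0)%R.
    have sA : ((hmx Wa a)^T = hmx Wa a)%R by apply: tr_hmx; case: snA.
    rewrite hmx_cat// -[0%R in LHS]col_mx0 hdens_block//; last first.
      by apply: tr_hmx; case: snB.
    rewrite mulmx0 subr0 -/(split_schur W a b) [in RHS]/hdens.
    case: ifPn => _; last by rewrite mulr0 mul0r.
    congr (_ * _)%R; rewrite /E mulrA -expRD; congr (expR _ / _)%R.
    rewrite -/o o1 !mulmx1 qformN mulmxN qform0 addr0.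
    have oppE (X : 'M[R]_1) : ((- X) 0 0 = - X 0 0)%R by rewrite mxE.
    rewrite oppE.
    have -> : (((const_mx 1 : 'cV_m)^T *m N) 0 0 = \sum_i N i 0)%R.
      by rewrite mxE; apply: eq_bigr => k _; rewrite !mxE mul1r.
    by field.
  have [pM|npM] := pselect (posdefmx (hmx W [tuple of a ++ b])); last first.
    have h0 : (hdens (hmx W [tuple of a ++ b]) 0 = 0)%R by rewrite /hdens asboolF.
    rewrite h0 mulr0 /hsol -[LHS](mulr0 ((invmx (hmx Wa a) *m N) i 0)%R) -h0 dE.
    by ring.
  have [pA pS] := (posdefmx_split snW a b).1 pM.
  rewrite dE ger0_norm; last exact: green_ratio_ge0.
  rewrite /green_ratio !invmx_col column_split// col_mxEu col_mxEd.
  set y := (invmx (split_schur W a b) *m _)%R.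
  have y0 : (y 0 0 != 0)%R.
    apply/eqP => y0; have : y = 0%R by apply/matrixP => k l; rewrite !ord1 y0 mxE.
    move=> /(congr1 (mulmx (split_schur W a b))).
    rewrite mulKVmx ?posdefmx_unit// mulmx0 => /matrixP/(_ ord0 ord0) /eqP.
    by rewrite !mxE eqxx oner_eq0.
  rewrite -/N [y]mx11_scalar mul_mx_scalar -scalemxAr mxE [(_%:M 0 0)%R]mxE.
  rewrite eqxx mulr1n /hsol.
  by field.
have mf : measurable_fun setT (fun c : Rn (m + 1) =>
    (`|green_ratio W c (rshift m ord0) (lshift 1 i)| * hdens (hmx W c) 0)%:E).
  apply/measurable_EFinP; apply: measurable_funM.
    by apply: measurableT_comp => //; exact: measurable_green_ratio.
  by apply: measurable_hdens_hmx; case: snW.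
rewrite integral_lebesgue_tuple_cat_swap//; last first.
  by move=> c; rewrite lee_fin mulr_ge0 ?hdens_ge0.
have hE (a : Rn m) : \int[@lebesgue_tuple R 1]_b
    (`|green_ratio W [tuple of a ++ b] (rshift m ord0) (lshift 1 i)|
     * hdens (hmx W [tuple of a ++ b]) 0)%:E =
    (E * hmass (0 : 'cV[R]_1))%:E * (hsol (hmx Wa a) N i)%:E.
  have h0 : (0 <= hsol (hmx Wa a) N i)%R by exact: hsol_ge0.
  have [pA|npA] := pselect (posdefmx (hmx Wa a)); last first.
    rewrite (_ : hsol _ _ _ = 0%R); last by rewrite /hsol /hdens asboolF// mulr0.
    rewrite mule0 -[RHS](integral0 (@lebesgue_tuple R 1) setT).
    apply: eq_integral => b _; rewrite fE /hsol /hdens asboolF//.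
    by rewrite !mulr0 mul0r.
  pose W2 : 'M[R]_1 := (Wb + (N^T *m invmx (hmx Wa a) *m N))%R.
  have SE b : split_schur W a b = hmx W2 b.
    by rewrite split_schurE// /W2; apply/matrixP => k l; rewrite !mxE opprD addrA.
  have snW2 : symnonneg W2.
    have [sB B0] := snB; split=> [|k l].
      by apply/matrixP => k l; rewrite !ord1 mxE.
    rewrite mxE; apply: addr_ge0; first exact: B0.
    rewrite !ord1; apply: qform_inv_ge0 => //.
    by apply: tr_hmx; case: snA.
  have [|d1 _ _] := @hdens_integral _ _ _ (0 : 'cV[R]_1)%R snW2.
    by move=> k; rewrite mxE.
  transitivity (\int[@lebesgue_tuple R 1]_b
      ((E * hsol (hmx Wa a) N i)%:E * (hdens (hmx W2 b) 0)%:E)).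
    by apply: eq_integral => b _; rewrite fE SE EFinM.
  rewrite ge0_integralZl_EFin//; last 3 first.
  - by move=> b _; rewrite lee_fin hdens_ge0.
  - by apply/measurable_EFinP; apply: measurable_hdens_hmx; case: snW2.
  - by rewrite mulr_ge0 ?expR_ge0.
  by rewrite d1 -!EFinM; congr (_%:E); ring.
under eq_integral do rewrite hE.
have c0 : (0 <= E * hmass (0 : 'cV[R]_1))%R.
  by rewrite mulr_ge0 ?mulr_ge0 ?expR_ge0 ?exprn_ge0 ?sqrtr_ge0.
rewrite ge0_integralZl_EFin//; last 2 first.
- by move=> a _; rewrite lee_fin hsol_ge0.
- apply/measurable_EFinP; apply: measurable_hsol => //; last exact: measurable_hmx.
  by move=> a; apply: tr_hmx; case: snA.
have [_ /(_ i) Hle _] := hdens_integral snA (fun k => N0 k ord0).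
apply: le_lt_trans (lee_wpmul2l _ Hle) _; first by rewrite lee_fin.
by rewrite -EFinM ltry.
Qed.

End pinned_vertex.

End exchange.

(** * The law of the potential in a chosen enumeration of the vertices *)
Section reindexing.
Context {R : realType}.

Lemma qformE n (A : 'M[R]_n) x :
  qform A x = \sum_i \sum_j x i 0 * A i j * x j 0.
Proof.
rewrite /qform mxE exchange_big/=; apply: eq_bigr => j _.
by rewrite mxE mulr_suml; apply: eq_bigr => i _; rewrite mxE.
Qed.

Section finite_type.
Variables (V : finType) (q : nat) (e : 'I_q -> V).
Hypothesis be : bijective e.

Definition reindex_mx (A : V -> V -> R) : 'M[R]_q := \matrix_(i, j) A (e i) (e j).

Lemma posdef_reindex A : posdef A <-> posdefmx (reindex_mx A).
Proof.
have [e' eK e'K] := be; split=> [pA x x0|pA x [k xk]].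
  have := pA (fun k => x (e' k) 0); rewrite qformE (reindex e)/=; last exact: onW_bij.
  under eq_bigr => i _.
    rewrite (reindex e)/=; last exact: onW_bij.
    under eq_bigr do rewrite !eK.
    over.
  under [X in _ -> 0 < X]eq_bigr => i _ do under eq_bigr do rewrite mxE.
  apply; apply/not_existsP => h; move/eqP: x0; apply.
  apply/matrixP => i j; rewrite ord1 mxE; apply/eqP.
  by apply: contra_notT (h (e i)); rewrite eK.
have := pA (\col_i x (e i)); rewrite qformE (reindex e)/=; last exact: onW_bij.
under [X in _ -> 0 < X]eq_bigr => i _.
  rewrite (reindex e)/=; last exact: onW_bij.
  over.
under eq_bigr => i _ do under eq_bigr do rewrite !mxE.
apply; apply: contraNneq xk => /matrixP/(_ (e' k) 0).
by rewrite !mxE e'K => ->.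
Qed.

Let r := enum_rank \o e.

Let br : bijective r.
Proof. by apply: bij_comp be; exact: enum_rank_bij. Qed.

Let rE A : reindex_mx A = \matrix_(i, j) fin_mx A (r i) (r j).
Proof. by apply/matrixP => i j; rewrite !mxE /r /= !enum_rankK. Qed.

Lemma fin_det_reindex A : fin_det A = \det (reindex_mx A).
Proof.
rewrite rE /fin_det; move: (fin_mx A) => M; move: r br => s bs.
have qn : q = #|V| by have := bij_eq_card bs; rewrite !card_ord.
move: s bs; rewrite qn => s bs.
have is_ : injective s by exact: bij_inj.
have -> : \matrix_(i, j) M (s i) (s j) = row_perm (perm is_) (col_perm (perm is_) M).
  by apply/matrixP => i j; rewrite !mxE !permE.
rewrite row_permE col_permE !det_mulmx !det_perm odd_permV mulrCA.
by rewrite -expr2 sqrr_sign mulr1.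
Qed.

Lemma fin_inv_reindex A i j : reindex_mx A \in unitmx ->
  fin_inv A (e i) (e j) = invmx (reindex_mx A) i j.
Proof.
move=> uA; have uM : fin_mx A \in unitmx.
  by move: uA; rewrite !unitmxE -fin_det_reindex.
have -> : invmx (reindex_mx A) = \matrix_(i, j) invmx (fin_mx A) (r i) (r j).
  apply: (can_inj (mulKmx uA)); rewrite mulmxV//; apply/matrixP => k l.
  rewrite [RHS]mxE [LHS]mxE.
  transitivity ((fin_mx A *m invmx (fin_mx A)) (r k) (r l)).
    by rewrite mulmxV// mxE (inj_eq (bij_inj br)).
  rewrite mxE (reindex r)/=; last exact: onW_bij.
  by apply: eq_bigr => h _; rewrite rE !mxE.
by rewrite mxE.
Qed.

Lemma sum_reindex (A : V -> V -> R) :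
  \sum_i \sum_j A i j = qform (reindex_mx A) (const_mx 1).
Proof.
rewrite qformE (reindex e)/=; last exact: onW_bij.
apply: eq_bigr => i _; rewrite (reindex e)/=; last exact: onW_bij.
by apply: eq_bigr => j _; rewrite !mxE mul1r mulr1.
Qed.

End finite_type.

Section law.
Local Open Scope ereal_scope.
Variables (V : finType) (g : weighted_graph R V).
Variables (d : measure_display) (Omega : measurableType d).
Variables (P : probability Omega R) (beta : V -> {RV P >-> R}).
Hypothesis beta_law : has_law_nu g beta.
Local Notation Rn n := (n.-tuple (measurableTypeR R)).

Variables (q : nat) (e : 'I_q -> V).
Hypothesis be : bijective e.

Definition weight_mx : 'M[R]_q := reindex_mx e (weight g).

Lemma weight_ge0 i j : (0 <= weight g i j)%R.
Proof.
case: (boolP (edge g i j)) => [/(weight_gt0 (w := g))/ltW//|].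
by move=> /(weight_eq0 (w := g)) ->.
Qed.

Lemma symnonneg_weight : symnonneg weight_mx.
Proof.
split=> [|i j]; last by rewrite mxE weight_ge0.
by apply/matrixP => i j; rewrite !mxE weight_sym.
Qed.

Definition btuple (w : Omega) : q.-tuple R := [tuple beta (e i) w | i < q].

Lemma reindex_Hmx (b : V -> R) :
  reindex_mx e (Hmx g b) = hmx weight_mx [tuple b (e i) | i < q].
Proof.
apply/matrixP => i j; rewrite !mxE /Hmx tnth_mktuple (inj_eq (bij_inj be)).
case: eqVneq => [->|_]; last by rewrite sub0r.
by rewrite (weight_eq0 (w := g)) ?subr0// (edge_irr g).
Qed.

Let K : R := (Num.sqrt (2 / pi) ^+ #|V|)%R.

Lemma nu_densityE (b : V -> R) :
  nu_density g b = (K * hdens (hmx weight_mx [tuple b (e i) | i < q]) 0)%R.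
Proof.
rewrite /nu_density -reindex_Hmx /hdens qform0 addr0 -(sum_reindex be) indicE.
have -> : (b \in [set b | posdef (Hmx g b)]) = `[< posdefmx (reindex_mx e (Hmx g b)) >].
  by apply/idP/asboolP; rewrite inE => /(posdef_reindex be).
case: ifPn => _; last by rewrite !(mulr0, mul0r).
rewrite -fin_det_reindex// mulr1 -mulrA; congr (_ * (expR _ * _))%R; last by rewrite mul1r.
by field.
Qed.

Lemma measurable_btuple : measurable_fun setT (btuple : Omega -> Rn q).
Proof.
apply/measurable_fun_tnthP => i; rewrite (_ : _ \o _ = (fun w => beta (e i) w)); last first.
  by apply/funext => w /=; rewrite tnth_mktuple.
have h : measurable_fun [set: Omega] (beta (e i)) by [].
exact: h.
Qed.

Lemma integral_law (f : Rn q -> \bar R) :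
  measurable_fun setT f -> (forall c, 0 <= f c) ->
  \int[P]_w f (btuple w) =
  \int[@lebesgue_tuple R q]_c (f c * (K * hdens (hmx weight_mx c) 0)%:E).
Proof.
move=> mf f0.
have mh : measurable_fun setT (fun c : Rn q => K * hdens (hmx weight_mx c) 0)%R.
  apply: measurable_funM => //; apply: measurable_hdens_hmx.
  by case: symnonneg_weight.
have h0 c : (0 <= K * hdens (hmx weight_mx c) 0)%R.
  by rewrite mulr_ge0 ?hdens_ge0// exprn_ge0// sqrtr_ge0.
transitivity (\int[pushforward P (btuple : Omega -> Rn q)]_c f c).
  rewrite ge0_integral_pushforward ?preimage_setT//; exact: measurable_btuple.
apply: (@integral_transfer _ _ (Rn q) (Rn q) R _ _ idfun) => //.
- exact: measurable_btuple.
- exact: measurable_id.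
move=> mT A mA.
pose Psi (t : Rn #|V|) : Rn q := [tuple tnth t (enum_rank (e i)) | i < q].
have bs : bijective (enum_rank \o e) by apply: bij_comp be; exact: enum_rank_bij.
have mPsi : measurable_fun setT Psi.
  apply/measurable_fun_tnthP => i.
  rewrite (_ : _ \o _ = (fun t => tnth t (enum_rank (e i)))).
    exact: measurable_tnth.
  by apply/funext => t /=; rewrite tnth_mktuple.
have mPA : measurable (Psi @^-1` A).
  by rewrite -[X in measurable X]setTI; exact: mPsi.
transitivity (nu g (Psi @^-1` A)).
  rewrite -beta_law// /pushforward; congr (P _); apply/seteqP; split=> w /=;
  rewrite (_ : Psi _ = btuple w)//; apply: eq_from_tnth => i;
  by rewrite !tnth_mktuple enum_rankK.
rewrite /nu.
transitivity (\int[@lebesgue_tuple R #|V|]_(t in Psi @^-1` A)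
   ((fun c => (K * hdens (hmx weight_mx c) 0)%:E) \o Psi) t).
  by apply: eq_integral => t _ /=; rewrite nu_densityE.
rewrite -(@ge0_integral_pushforward _ _ (Rn #|V|) (Rn q) R Psi mPsi _ A
  (fun c => (K * hdens (hmx weight_mx c) 0)%:E))//; last 2 first.
- exact/measurable_funTS/measurable_EFinP.
- by move=> c _; rewrite lee_fin.
rewrite preimage_id; apply: eq_measure_integral => B mB _.
exact: (lebesgue_tuple_reindex bs mB).
Qed.

Lemma ae_posdefmx : {ae P, forall w, posdefmx (hmx weight_mx (btuple w))}.
Proof.
have mD : measurable [set c : Rn q | posdefmx (hmx weight_mx c)].
  apply: measurable_posdefmx; last exact: measurable_hmx.
  by move=> c; apply: tr_hmx; case: symnonneg_weight.
set D := [set c : Rn q | posdefmx (hmx weight_mx c)] in mD.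
have mN : measurable (btuple @^-1` (~` D)).
  rewrite -[X in measurable X]setTI; apply: measurable_btuple => //.
  exact: measurableC.
exists (btuple @^-1` (~` D)); split => //.
have := @integral_law (EFin \o \1_(~` D)).
rewrite (_ : (fun w => _) = EFin \o \1_(btuple @^-1` (~` D))); last first.
  by apply/funext => w /=; rewrite !indicE; congr (nat_of_bool _)%:R%:E;
    apply/idP/idP; rewrite !inE.
rewrite integral_indic// setIT => ->.
- apply: integral0_eq => c _ /=; rewrite indicE -EFinM.
  have [pc|npc] := pselect (D c); first by rewrite memNset ?mul0r//; apply.
  by rewrite /hdens asboolF// !mulr0.
- by apply/measurable_EFinP; apply: measurable_indic; exact: measurableC.
- by move=> c; rewrite lee_fin.
Qed.

End law.

End reindexing.

(** * Conditional expectations given the coarse-grained potential *)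
Section joint_enumeration.
Variables (V : finType) (m p : nat) (f : 'I_m -> V) (h : 'I_p -> V).

Definition joint (i : 'I_(m + p)) : V :=
  match fintype.split i with inl j => f j | inr j => h j end.

Lemma joint_lshift i : joint (lshift p i) = f i.
Proof. by rewrite /joint (unsplitK (inl _ i)). Qed.

Lemma joint_rshift i : joint (rshift m i) = h i.
Proof. by rewrite /joint (unsplitK (inr _ i)). Qed.

Lemma joint_bijective : injective f -> injective h ->
  (forall i j, f i != h j) -> (#|V| <= m + p)%N -> bijective joint.
Proof.
move=> fi hi fh Vmp; apply: inj_card_bij; last by rewrite card_ord.
move=> i j; case: (split_ordP i) => {}i ->; case: (split_ordP j) => {}j ->;
  rewrite ?joint_lshift ?joint_rshift.
- by move=> /fi ->.
- by move=> /eqP; rewrite (negbTE (fh _ _)).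
- by move=> /esym/eqP; rewrite (negbTE (fh _ _)).
- by move=> /hi ->.
Qed.

End joint_enumeration.

Section measurable_fin_inv.
Context d (T : measurableType d) (R : realType) (I : finType).

Lemma measurable_fin_inv (A : T -> I -> I -> R) :
  (forall i j, measurable_fun setT (fun t => A t i j)) ->
  forall i j, measurable_fun setT (fun t => fin_inv (A t) i j).
Proof.
move=> mA i j; apply: measurable_invmx => k l.
by under eq_fun do rewrite mxE; exact: mA.
Qed.

End measurable_fin_inv.

Section green_ratios.
Local Open Scope ereal_scope.
Context {R : realType} (V : finType) (g : weighted_graph R V).
Context (d : measure_display) (Omega : measurableType d).
Context (P : probability Omega R) (beta : V -> {RV P >-> R}).
Hypothesis beta_law : has_law_nu g beta.
Local Notation Rn n := (n.-tuple (measurableTypeR R)).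

Local Notation H w := (Hmx g (fun k => beta k w)).

Lemma measurable_Hmx i j : measurable_fun setT (fun w => H w i j).
Proof.
rewrite /Hmx; case: (i == j) => //; apply: measurable_funM => //.
Qed.

Lemma measurable_exp_u i0 k :
  measurable_fun setT (fun w => exp_u (fin_inv (H w)) i0 k).
Proof.
by apply: measurable_div; apply: measurable_fin_inv; exact: measurable_Hmx.
Qed.

Lemma exp_u_reindex q (e : 'I_q -> V) (be : bijective e) w j i :
  posdefmx (hmx (weight_mx g e) (btuple beta e w)) ->
  exp_u (fin_inv (H w)) (e j) (e i) =
  green_ratio (weight_mx g e) (btuple beta e w) j i.
Proof.
move=> /posdefmx_unit uM; rewrite /exp_u /green_ratio.
have hE : reindex_mx e (H w) = hmx (weight_mx g e) (btuple beta e w).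
  by rewrite reindex_Hmx.
by rewrite !fin_inv_reindex// hE.
Qed.

(** Enumerate the vertices with i0 last and apply [integral_green_ratio_lty].
The case k = i0 is separate: there the ratio is bounded by 1. *)
Lemma integrable_exp_u i0 k :
  P.-integrable setT (fun w => (exp_u (fin_inv (H w)) i0 k)%:E).
Proof.
have mX := measurable_exp_u i0 k.
have [->|ki0] := eqVneq k i0.
  apply: (@le_integrable _ _ _ P setT measurableT _ (fun=> 1%:E)).
  - by apply/measurable_EFinP; exact: measurable_exp_u.
  - move=> w _ /=; rewrite lee_fin normr1 /exp_u.
    by have [->|x0] := eqVneq (fin_inv (H w) i0 i0) 0%R; rewrite ?mul0r ?normr0// divff ?normr1.
  - exact: finite_measure_integrable_cst.
pose S := {v : V | v != i0}.
pose f (i : 'I_#|{: S}|) : V := val (enum_val i).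
pose e := joint f (fun _ : 'I_1 => i0).
have be : bijective e.
  apply: joint_bijective.
  - by move=> i j /val_inj/enum_val_inj.
  - by move=> i j _; rewrite !ord1.
  - by move=> i _; exact: (valP (enum_val i)).
  - rewrite card_sig addn1 (cardD1 i0) inE add1n ltnS.
    by apply/eq_leq/eq_card => v; rewrite !inE andbT.
pose i := enum_rank (exist _ k ki0 : S).
have eiE : e (lshift 1 i) = k by rewrite /e joint_lshift /f enum_rankK.
have e0E : e (rshift _ ord0) = i0 by rewrite /e joint_rshift.
have snW := symnonneg_weight g e.
apply/integrableP; split; first exact/measurable_EFinP.
pose F (c : Rn (#|{: S}| + 1)) : \bar R :=
  (`|green_ratio (weight_mx g e) c (rshift _ ord0) (lshift 1 i)|)%:E.
have mF : measurable_fun setT F.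
  apply/measurable_EFinP; apply: measurableT_comp => //.
  exact: measurable_green_ratio.
rewrite (@ge0_ae_eq_integral _ _ _ P setT _ (fun w => F (btuple beta e w)))//.
- rewrite (integral_law beta_law be mF)//.
  set K := (Num.sqrt _ ^+ _)%R.
  have K0 : (0 <= K)%R by rewrite exprn_ge0// sqrtr_ge0.
  rewrite (eq_integral (fun c : Rn (#|{: S}| + 1) => K%:E *
      (`|green_ratio (weight_mx g e) c (rshift _ ord0) (lshift 1 i)|
       * hdens (hmx (weight_mx g e) c) 0)%:E)); last first.
    by move=> c _; rewrite /F -!EFinM; congr (_%:E); ring.
  rewrite ge0_integralZl_EFin//; last 2 first.
  + by move=> c _; rewrite lee_fin mulr_ge0 ?hdens_ge0.
  + apply/measurable_EFinP; apply: measurable_funM.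
      by apply: measurableT_comp => //; exact: measurable_green_ratio.
    by apply: measurable_hdens_hmx; case: snW.
  by apply: lte_mul_pinfty => //; exact: integral_green_ratio_lty.
- by move=> c; rewrite lee_fin.
- by apply: measurableT_comp => //; exact/measurable_EFinP.
- exact: (measurableT_comp mF (measurable_btuple beta e)).
- by move=> w _; rewrite lee_fin.
- apply: filterS (ae_posdefmx beta_law be) => w pw _.
  by rewrite /F /= -exp_u_reindex// eiE e0E.
Qed.

(** The vertices of U are enumerated first, so that the upper left block of H is
H_{U,U}.  The pair S = (bw, sw), of the potential outside U and the sum of the
entries of the inverse of H_{U,U}, plays the role of (b, s). *)
Section coarse_graining.
Variables (U : {set V}) (U_neq0 : U != finset.set0).
Hypothesis indU : indistinguishable g U.
Variables (i0 : V) (i0U : i0 \notin U).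

Let SU := {v : V | v \in U}.
Let SB := {v : V | v \notin U}.
Let m := #|{: SU}|.
Let p := #|{: SB}|.
Let f (i : 'I_m) : V := val (enum_val i : SU).
Let h (j : 'I_p) : V := val (enum_val j : SB).
Let e := joint f h.

Let be : bijective e.
Proof.
apply: joint_bijective.
- by move=> i j /val_inj/enum_val_inj.
- by move=> i j /val_inj/enum_val_inj.
- move=> i j; apply: contraTneq (valP (enum_val i)) => fE.
  by rewrite -/(f i) fE; exact: (valP (enum_val j)).
- by rewrite /m /p !card_sig cardC.
Qed.

Let W := weight_mx g e.
Let snW : symnonneg W. Proof. exact: symnonneg_weight. Qed.
Let j0 : 'I_p := enum_rank (exist _ i0 i0U : SB).
Let hj0 : h j0 = i0. Proof. by rewrite /h enum_rankK. Qed.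
Let e_l i : e (lshift p i) = f i. Proof. exact: joint_lshift. Qed.
Let e_r j : e (rshift m j) = h j. Proof. exact: joint_rshift. Qed.
Let e_0 : e (rshift m j0) = i0. Proof. by rewrite e_r. Qed.

Let u0 : V := xchoose (set0Pn _ U_neq0).
Let u0U : u0 \in U. Proof. exact: (xchooseP (set0Pn _ U_neq0)). Qed.
Let wrow : 'rV[R]_p := (\row_j weight g (h j) u0)%R.

Let NE : (ursubmx W = const_mx 1 *m wrow)%R.
Proof.
apply/matrixP => i j; rewrite !mxE big_ord1 !mxE mul1r e_l e_r weight_sym.
by apply: indU => //; [exact: (valP (enum_val i))|exact: (valP (enum_val j))].
Qed.

Let c (w : Omega) : Rn (m + p) := btuple beta e w.
Let bw (w : Omega) : Rn p := rtuple (c w).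
Let sw (w : Omega) : R := total_green (hmx (ulsubmx W) (ltuple (c w))).
Let pd (w : Omega) := posdefmx (hmx W (c w)).

Let mc : measurable_fun setT c. Proof. exact: measurable_btuple. Qed.
Let mbw : measurable_fun setT bw.
Proof. exact: (measurableT_comp (@measurable_rtuple R m p) mc). Qed.
Let msw : measurable_fun setT sw.
Proof.
apply: (measurableT_comp (measurable_total_green (ulsubmx W))).
exact: (measurableT_comp (@measurable_ltuple R m p) mc).
Qed.

Let bwE w j : tnth (bw w) j = beta (h j) w.
Proof. by rewrite !tnth_mktuple e_r. Qed.

Let ae_pd : {ae P, forall w, pd w}.
Proof. exact: (ae_posdefmx beta_law be). Qed.

Let swE w : (\sum_(i : SU) \sum_(j : SU) fin_inv (principal_submx (U := U) (H w)) i j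
  = sw w)%R.
Proof.
have -> : sw w = qform (invmx (fin_mx (principal_submx (U := U) (H w)))) (const_mx 1%R).
  rewrite /sw /total_green hmx_ltuple; congr (qform (invmx _) _).
  rewrite /c /btuple /W -(reindex_Hmx g be (fun k => beta k w)).
  by apply/matrixP => i j; rewrite !mxE !e_l.
pose ev : 'I_m -> SU := fun i => enum_val i.
have bev : bijective ev by exact: enum_val_bij.
rewrite qformE (reindex ev)/=; last exact: onW_bij.
apply: eq_bigr => i _; rewrite (reindex ev)/=; last exact: onW_bij.
by apply: eq_bigr => j _; rewrite /fin_inv !enum_valK !mxE mul1r mulr1.
Qed.

Let X k w := exp_u (fin_inv (H w)) i0 k.

Let cw w : c w = [tuple of ltuple (c w) ++ bw w].
Proof. by rewrite cat_lrtuple. Qed.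

Let X_l w i : pd w -> X (f i) w = green_ratio W (c w) (rshift m j0) (lshift p i).
Proof. by move=> pw; rewrite /X -e_0 -e_l exp_u_reindex. Qed.

Let X_r w j : pd w -> X (h j) w = green_ratio W (c w) (rshift m j0) (rshift m j).
Proof. by move=> pw; rewrite /X -e_0 -e_r exp_u_reindex. Qed.

Let col w : 'cV[R]_p := pinned_col W wrow (bw w) (sw w) j0.
(** Versions of e^{u_k} outside U, and of the mean of e^{u_k} over U, that are
measurable for F' everywhere and not only up to a null event. *)
Let Zr j w : R := (col w j 0)%R.
Let Zu w : R := (#|U|%:R^-1 * (sw w * (wrow *m col w) 0 0))%R.

Let X_rE w j : pd w -> X (h j) w = Zr j w.
Proof.
move=> pw; rewrite X_r// /Zr /col cw.
by rewrite (green_ratio_pinned snW NE)// -cw.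
Qed.

Let sumU (F : V -> R) : (\sum_(v in U) F v = \sum_i F (f i))%R.
Proof.
rewrite (reindex e)/=; last exact: onW_bij.
rewrite big_split_ord/= [X in (_ + X)%R]big1 ?addr0.
  apply: eq_big => [i|i _]; last by rewrite e_l.
  by rewrite e_l (valP (enum_val i)).
by move=> j; rewrite e_r => jU; have := valP (enum_val j); rewrite jU.
Qed.

Let X_sum w : pd w -> (\sum_(v in U) X v w = sw w * (wrow *m col w) 0 0)%R.
Proof.
move=> pw; rewrite sumU; under eq_bigr do rewrite X_l//.
rewrite {1}cw (sum_green_ratio snW NE) -?cw//.
Qed.

Let ZuE w : pd w -> (Zu w = #|U|%:R^-1 * \sum_(v in U) X v w)%R.
Proof. by move=> pw; rewrite /Zu X_sum. Qed.

Let G_sym w k l : pd w -> fin_inv (H w) k l = fin_inv (H w) l k.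
Proof.
move=> pw; have uM := posdefmx_unit pw.
have hE : reindex_mx e (H w) = hmx W (c w) by rewrite reindex_Hmx.
have [e' eK e'K] := be; rewrite -(e'K k) -(e'K l) !fin_inv_reindex ?hE//.
have sG : ((invmx (hmx W (c w)))^T = invmx (hmx W (c w)))%R.
  by rewrite trmx_inv tr_hmx//; case: snW.
by rewrite -[in LHS]sG mxE.
Qed.

Let i0' : coarse_vertex U := Some (exist _ i0 i0U).

Let coarse_exp_u w : pd w -> exp_u (coarse_G (U := U) (fin_inv (H w))) i0' None = Zu w.
Proof.
move=> pw; rewrite ZuE// /exp_u /= -mulrA mulr_suml; congr (_ * _)%R.
by apply: eq_bigr => v _; rewrite G_sym.
Qed.

Let gamma w := (1 / (2 * fin_inv (H w) i0 i0))%R.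
Let beta' (k : coarse_vertex U) w := coarse_beta (H w) (fun k => beta k w) k.
Let Gen : set (set Omega) :=
  \bigcup_(k in [set k | k <> i0']) preimages (beta' k) `|` preimages gamma.

Let beta'_NoneE w : (beta' None w = 1 / (2 * ((#|U|%:R ^+ 2)^-1 * sw w)))%R.
Proof. by rewrite /beta' /coarse_beta swE. Qed.

Let mbeta' k : measurable_fun setT (beta' k).
Proof.
case: k => [k|]; first by [].
rewrite (_ : beta' None = (fun w => 1 / (2 * ((#|U|%:R ^+ 2)^-1 * sw w)))%R).
  by apply: measurable_div => //; do 2 apply: measurable_funM => //.
by apply/funext => w; exact: beta'_NoneE.
Qed.

Let mgamma : measurable_fun setT gamma.
Proof.
apply: measurable_div => //; apply: measurable_funM => //.
by apply: measurable_fin_inv; exact: measurable_Hmx.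
Qed.

Let F'_sub : <<s Gen>> `<=` measurable.
Proof.
apply: smallest_sub; first exact: sigma_algebra_measurable.
move=> A [[k _]|]; rewrite /preimages => -[B mB <-].
  exact: mbeta'.
exact: mgamma.
Qed.

Let S w : Rn p * R := (bw w, sw w).

Let mS : measurable_fun setT S.
Proof. by apply/measurable_fun_pairP; split. Qed.

(** F' need not be included in the sigma-algebra generated by S: gamma is a
function of S only where H is positive definite. *)
Let factor A := exists2 B : set (Rn p * R), measurable B &
  forall w, pd w -> (A w <-> B (S w)).

Let factor_fun (Y : Omega -> R) (q : Rn p * R -> R) :
  measurable_fun setT q -> (forall w, pd w -> Y w = q (S w)) ->
  forall A, preimages Y A -> factor A.
Proof.
move=> mq YE _ [B mB <-]; exists (q @^-1` B).
  by rewrite -[X in measurable X]setTI; exact: mq.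
by move=> w pw; split=> /=; [move=> [_]|]; rewrite YE.
Qed.

Let F'_factor A : <<s Gen>> A -> factor A.
Proof.
move: A; apply: smallest_sub.
  split=> [|A [B mB AB]|A_ hA].
  - by exists set0 => // w _; split.
  - exists (~` B); first exact: measurableC.
    move=> w pw; rewrite setTD; split=> /= + Bw; apply; exact/(AB w pw).
  - have {}hA n : {B : set (Rn p * R) | measurable B /\
        forall w, pd w -> (A_ n w <-> B (S w))}.
      by apply/cid; have [B mB AB] := hA n; exists B.
    exists (\bigcup_n sval (hA n)).
      by apply: bigcupT_measurable => n; case: (svalP (hA n)).
    move=> w pw; split=> -[n _ An]; exists n => //; have [_ /(_ w pw)] := svalP (hA n);
    by case => AB BA; auto.
move=> A [[k _]|].
  case: k => [k|].
    apply: (factor_fun (q := fun x => tnth x.1 (enum_rank k))).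
      exact: (measurableT_comp (@measurable_tnth _ _ _ _) measurable_fst).
    by move=> w _; rewrite bwE /h enum_rankK.
  apply: (factor_fun (q := fun x => 1 / (2 * ((#|U|%:R ^+ 2)^-1 * x.2)))%R).
    by apply: measurable_div => //; do 2 apply: measurable_funM => //.
  by move=> w _; exact: beta'_NoneE.
apply: (factor_fun (q := fun x => 1 / (2 * invmx (rest W wrow x.1 x.2) j0 j0))%R).
  apply: measurable_div => //; apply: measurable_funM => //.
  by apply: measurable_invmx; apply: measurable_rest.
move=> w pw; rewrite /gamma.
have hE : reindex_mx e (H w) = hmx W (c w) by rewrite reindex_Hmx.
rewrite -e_0 fin_inv_reindex ?hE ?posdefmx_unit//.
have /= := @invmx_dr _ _ _ W snW wrow NE (ltuple (c w)) (bw w) j0.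
by rewrite -cw => /(_ pw) ->.
Qed.

Let K : R := (Num.sqrt (2 / pi) ^+ #|V|)%R.
Let K0 : (0 <= K)%R. Proof. by rewrite exprn_ge0// sqrtr_ge0. Qed.

Let integral_X A B i : measurable A -> measurable B ->
  (forall w, pd w -> (A w <-> B (S w))) ->
  \int[P]_(w in A) (X (f i) w)%:E =
  K%:E * \int[@lebesgue_tuple R (m + p)]_c
    (((rtuple c, total_green (hmx (ulsubmx W) (ltuple c))) \in B)%:R
     * `|green_ratio W c (rshift m j0) (lshift p i)| * hdens (hmx W c) 0)%R%:E.
Proof.
move=> mA mB AB.
pose s (c : Rn (m + p)) : Rn p * R :=
  (rtuple c, total_green (hmx (ulsubmx W) (ltuple c))).
pose q (c : Rn (m + p)) : \bar R :=
  ((s c \in B)%:R * `|green_ratio W c (rshift m j0) (lshift p i)|)%R%:E.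
have ms : measurable_fun setT s.
  apply/measurable_fun_pairP; split; first exact: measurable_rtuple.
  exact: (measurableT_comp (measurable_total_green _) (@measurable_ltuple R m p)).
have mq : measurable_fun setT q.
  apply/measurable_EFinP; apply: measurable_funM; last first.
    by apply: measurableT_comp => //; exact: measurable_green_ratio.
  rewrite (_ : (fun _ => _) = (\1_B : _ -> R) \o s).
    by apply: measurableT_comp; [exact: measurable_indic|exact: ms].
  by apply/funext => t; rewrite /= indicE.
have q0 t : 0 <= q t by rewrite lee_fin mulr_ge0.
rewrite integral_mkcond.
transitivity (\int[P]_w q (c w)).
  apply: ae_eq_integral => //.
  - apply/(measurable_restrictT _ mA); apply/measurable_funTS/measurable_EFinP.
    exact: measurable_exp_u.
  - exact: (measurableT_comp mq mc).
  - apply: filterS ae_pd => w pw _; rewrite patchE /q /s -[X in X \in B]/(S w).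
    have -> : (w \in A) = (S w \in B).
      by apply/idP/idP; rewrite !inE => /(AB w pw).
    case: ifPn => _; last by rewrite mul0r.
    by rewrite mul1r X_l// ger0_norm//; exact: green_ratio_ge0.
rewrite (integral_law beta_law be mq q0) -/K -/W.
rewrite -ge0_integralZl_EFin//; last 2 first.
- by move=> t _; rewrite lee_fin !mulr_ge0 ?hdens_ge0.
- apply/measurable_EFinP; apply: measurable_funM.
    by apply/measurable_EFinP; exact: mq.
  by apply: measurable_hdens_hmx; case: snW.
by apply: eq_integral => t _; rewrite /q -!EFinM; congr (_%:E); ring.
Qed.

(** An event of F' agrees almost surely with an event of the form S \in B, for
which the integrals over the potential are those of [ratio_exchange]. *)
Let exchange A k l : <<s Gen>> A -> k \in U -> l \in U ->
  \int[P]_(w in A) (X k w)%:E = \int[P]_(w in A) (X l w)%:E.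
Proof.
move=> FA kU lU; have mA := F'_sub FA; have [B mB AB] := F'_factor FA.
have fE v (vU : v \in U) : v = f (enum_rank (exist _ v vU)).
  by rewrite /f enum_rankK.
rewrite (fE k kU) (fE l lU) !(integral_X _ mA mB AB).
by rewrite (ratio_exchange snW NE _ _ (enum_rank (exist _ l lU)) mB).
Qed.

Let F'_type := g_sigma_algebraType Gen.

Let F'_measurable (Z : Omega -> R) :
  measurable_fun (setT : set F'_type) (Z : F'_type -> R) ->
  forall B : set (measurableTypeR R), measurable B -> <<s Gen>> (Z @^-1` B).
Proof. by move=> mZ B mB; have := mZ measurableT B mB; rewrite setTI. Qed.

Let F'_beta' k : k <> i0' ->
  measurable_fun (setT : set F'_type) (beta' k : F'_type -> R).
Proof.
move=> ki _ B mB; apply: sub_sigma_algebra; left; exists k => //.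
by exists B.
Qed.

(** The relation between s and beta'_u can be inverted even for s = 0, because
the inverse of 0 is 0. *)
Let F'_sw : measurable_fun (setT : set F'_type) (sw : F'_type -> R).
Proof.
have U0 : (#|U|%:R != 0 :> R)%R by rewrite pnatr_eq0 cards_eq0.
rewrite (_ : sw = (fun w => (#|U|%:R ^+ 2 / 2) / beta' None w)%R).
  apply: measurable_div; first exact: measurable_cst.
  by apply: F'_beta'.
apply/funext => w; rewrite beta'_NoneE.
have [->|s0] := eqVneq (sw w) 0%R; first by rewrite !(mulr0, invr0, mul0r).
by field; rewrite U0 s0.
Qed.

(** The potential enters the pinned system only through s and its values outside U
and off i0, which F' determines. *)
Let F'_col j : measurable_fun (setT : set F'_type) ((fun w => col w j 0%R) : F'_type -> R).
Proof.
apply: (@measurable_mulmx _ F'_type _ _ _ _ (fun w => invmx (pinned_mx W wrow (bw w) (sw w) j0))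
   (fun=> delta_mx j0 ord0)).
  apply: measurable_invmx => i k.
  under eq_fun do rewrite mxE.
  case: eqVneq => ij; first exact: measurable_cst.
  under eq_fun do rewrite 2!mxE.
  apply: measurable_funD.
    under eq_fun do rewrite mxE.
    case: eqVneq => [<-|_] /=.
      under eq_fun do rewrite bwE.
      apply: measurable_funD; last exact: measurable_cst.
      apply: measurable_funM; first exact: measurable_cst.
      apply: (@F'_beta' (Some (enum_val i))) => -[] /(congr1 val) /= hi.
      by move/eqP: ij; apply; apply: enum_val_inj; apply: val_inj; rewrite enum_rankK.
    by under eq_fun do rewrite mulr0n; exact: measurable_cst.
  under eq_fun do rewrite 2!mxE.
  apply: measurable_funN; apply: (@measurable_funM _ F'_type); last exact: measurable_cst.
  exact: F'_sw.
by move=> i k; exact: measurable_cst.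
Qed.

Let F'_Zu : measurable_fun (setT : set F'_type) (Zu : F'_type -> R).
Proof.
apply: measurable_funM; first exact: measurable_cst.
apply: measurable_funM; first exact: F'_sw.
apply: (@measurable_mulmx _ F'_type _ _ _ _ (fun=> wrow) col).
  by move=> i k; exact: measurable_cst.
by move=> i k; rewrite ord1; exact: F'_col.
Qed.

Let F'_measurable_fun (Z : Omega -> R) :
  measurable_fun (setT : set F'_type) (Z : F'_type -> R) ->
  measurable_fun setT (Z : Omega -> R).
Proof.
by move=> mZ _ B mB; rewrite setTI; apply: F'_sub; exact: F'_measurable.
Qed.

Let integrable_ae (Y Z : Omega -> R) :
  measurable_fun (setT : set F'_type) (Z : F'_type -> R) ->
  P.-integrable setT (EFin \o Y) -> (forall w, pd w -> Y w = Z w) ->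
  P.-integrable setT (EFin \o Z).
Proof.
move=> mZ /integrableP[mY iY] YZ.
have mZ' : measurable_fun setT (EFin \o Z).
  by apply/measurable_EFinP; exact: F'_measurable_fun.
apply/integrableP; split => //; rewrite (le_lt_trans _ iY)// le_eqVlt; apply/orP; left.
apply/eqP; apply: ae_eq_integral => //; do ?exact: measurableT_comp.
by apply: filterS ae_pd => w pw _ /=; rewrite YZ.
Qed.

Let average w : R := (#|U|%:R^-1 * \sum_(v in U) X v w)%R.

Let integrable_average : P.-integrable setT (EFin \o average).
Proof.
rewrite (_ : EFin \o _ = (fun w => (#|U|%:R^-1)%:E * \sum_(v <- enum U) (X v w)%:E)).
  apply: integrableZl => //; apply: integrable_sum => // v _.
  exact: integrable_exp_u.
by apply/funext => w; rewrite /= /average EFinM sumEFin big_enum.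
Qed.

Let integral_average A k : <<s Gen>> A -> k \in U ->
  \int[P]_(w in A) (average w)%:E = \int[P]_(w in A) (X k w)%:E.
Proof.
move=> FA kU; have mA := F'_sub FA.
have iX v : P.-integrable A (EFin \o X v).
  by apply: (integrableS measurableT) => //; exact: integrable_exp_u.
transitivity (\int[P]_(w in A) ((#|U|%:R^-1)%:E * \sum_(v <- enum U) (X v w)%:E)).
  by apply: eq_integral => w _; rewrite /average EFinM sumEFin big_enum.
rewrite integralZl//; last by apply: integrable_sum => // v _; exact: iX.
rewrite integral_sum//.
rewrite big_seq (eq_bigr (fun=> \int[P]_(w in A) (X k w)%:E)); last first.
  by move=> v; rewrite mem_enum => vU; exact: exchange.
have /fineK <- := integrable_fin_num mA (iX k).
rewrite -big_seq sumEFin -EFinM big_enum/= sumr_const.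
rewrite -[X in (_ * X)%R]mulr_natl mulrA mulVf ?mul1r//.
by rewrite pnatr_eq0 cards_eq0.
Qed.

Let F'_sigma : sigma_algebra setT <<s Gen>>.
Proof. exact: smallest_sigma_algebra. Qed.

Let ae_integral A (Y Z : Omega -> R) :
  measurable_fun setT Y -> measurable_fun (setT : set F'_type) (Z : F'_type -> R) ->
  (forall w, pd w -> Y w = Z w) -> <<s Gen>> A ->
  \int[P]_(w in A) (Y w)%:E = \int[P]_(w in A) (Z w)%:E.
Proof.
move=> mY mZ YZ FA; apply: ae_eq_integral; first exact: F'_sub.
- exact/measurable_funTS/measurable_EFinP.
- by apply/measurable_funTS/measurable_EFinP; exact: F'_measurable_fun.
- by apply: filterS ae_pd => w pw _; rewrite YZ.
Qed.

Lemma cond_exp_outside k (kU : k \notin U) :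
  cond_exp_eq P <<s Gen>> (fun w => exp_u (fin_inv (H w)) i0 k)
    (fun w => exp_u (coarse_G (U := U) (fin_inv (H w))) i0' (Some (exist _ k kU))).
Proof.
pose j : 'I_p := enum_rank (exist _ k kU : SB).
have hj : h j = k by rewrite /h enum_rankK.
have XZ w : pd w -> X k w = Zr j w by move=> pw; rewrite -X_rE// hj.
exists (Zr j); last by apply: filterS ae_pd => w pw; exact: XZ.
split => //.
- exact: integrable_exp_u.
- exact: (integrable_ae (F'_col j) (integrable_exp_u i0 k)).
- by apply: F'_measurable; exact: F'_col.
- move=> A FA; apply: ae_integral => //; first exact: measurable_exp_u.
  exact: F'_col.
Qed.

(** The mean over U has the version [Zu]; by exchangeability its integral over an
event of F' is that of each of its terms. *)
Lemma cond_exp_inside k : k \in U ->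
  cond_exp_eq P <<s Gen>> (fun w => exp_u (fin_inv (H w)) i0 k)
    (fun w => exp_u (coarse_G (U := U) (fin_inv (H w))) i0' None).
Proof.
move=> kU; have AZ w : pd w -> average w = Zu w by move=> pw; rewrite ZuE.
exists Zu; last by apply: filterS ae_pd => w; exact: coarse_exp_u.
split => //.
- exact: integrable_exp_u.
- exact: (integrable_ae F'_Zu integrable_average).
- by apply: F'_measurable; exact: F'_Zu.
- move=> A FA; rewrite -(integral_average FA kU); apply: ae_integral => //.
  by apply/measurable_EFinP; exact: measurable_int integrable_average.
Qed.

End coarse_graining.

End green_ratios.

Theorem corollary12 (R : realType) (V : finType) (g : weighted_graph R V)
    (U : {set V}) (U_neq0 : U != finset.set0) (indU : indistinguishable g U)
    (i0 : V) (i0U : i0 \notin U)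
    (d : measure_display) (Omega : measurableType d) (P : probability Omega R)
    (beta : V -> {RV P >-> R}) (beta_law : has_law_nu g beta) :
  let H := fun w : Omega => Hmx g (fun k => beta k w) in
  let G := fun w => fin_inv (H w) in
  let gamma := fun w => 1 / (2 * G w i0 i0) in
  let G' := fun w => coarse_G (U := U) (G w) in
  let beta' := fun (k : coarse_vertex U) w =>
    coarse_beta (H w) (fun k => beta k w) k in
  let i0' : coarse_vertex U := Some (exist _ i0 i0U) in
  let u : coarse_vertex U := None in
  let F' := <<s \bigcup_(k in [set k | k <> i0']) preimages (beta' k)
                `|` preimages gamma >> in
  (forall (k : V) (kU : k \notin U),
     cond_exp_eq P F' (fun w => exp_u (G w) i0 k)
       (fun w => exp_u (G' w) i0' (Some (exist _ k kU)))) /\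
  (forall k : V, k \in U ->
     cond_exp_eq P F' (fun w => exp_u (G w) i0 k)
       (fun w => exp_u (G' w) i0' u)).
Proof.
split=> [k kU|k kU].
- exact: (cond_exp_outside beta_law U_neq0 indU i0U kU).
- exact: (cond_exp_inside beta_law U_neq0 indU i0U kU).
Qed.
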